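(* Let $\mathbf{k}$ be a field, let $e\colon\mathbb{R}\to\mathbb{S}^1\simeq\mathbb{R}/2\pi\mathbb{Z}$ be the quotient map, and let $F\in\mathrm{Mod}_c(\mathbf{k}_{\mathbb{S}^1})$ be a constructible sheaf of $\mathbf{k}$-vector spaces on the circle. Then there exist a finite family $\{(I_a,n_a)\}_{a\in A}$ of bounded intervals $I_a$ of $\mathbb{R}$ and integers $n_a$, and a locally constant sheaf of finite rank $L\in\mathrm{Mod}(\mathbf{k}_{\mathbb{S}^1})$, such that $$F\simeq L\oplus\bigoplus_{a\in A}e_*(\mathbf{k}_{I_a}^{n_a}).$$
   Context: A sheaf on a real analytic manifold is constructible if there is a real analytic stratification such that its restriction to each stratum is constant of finite rank. Intervals may be open, closed or half-closed (including points), and may have length larger than $2\pi$. $\mathbf{k}_I$ is the constant sheaf on $I$ extended by zero to $\mathbb{R}$. *)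

(* Defs.v *)
From HB Require Import structures.
From mathcomp Require Import all_boot all_order all_algebra generic_quotient.
From mathcomp Require Import all_classical all_reals all_analysis.
Set Implicit Arguments.
Unset Strict Implicit.
Unset Printing Implicit Defensive.
Import Order.TTheory GRing.Theory Num.Theory.
Import numFieldNormedType.Exports.
Local Open Scope classical_set_scope.
Local Open Scope ring_scope.
Local Open Scope quotient_scope.

Identity Coercion fun_of_set : set >-> Funclass.

Section Opens.
Context {X : topologicalType}.

Record opens := Opens { oset :> set X; oset_open : open oset }.

Lemma opens_eq (U V : opens) : (U : set X) = V -> U = V.
Proof.
case: U V => [U oU] [V oV] /= E; case: _ / E oV => oV.
by congr Opens; exact: Prop_irrelevance.
Qed.

Definition opensI (U V : opens) : opens :=
  Opens (openI (@oset_open U) (@oset_open V)).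

Lemma opensIl (U V : opens) : opensI U V `<=` U.
Proof. exact: subIsetl. Qed.

Lemma opensIr (U V : opens) : opensI U V `<=` V.
Proof. exact: subIsetr. Qed.

Definition opensT : opens := Opens (@openT X).

End Opens.
Arguments opens : clear implicits.

Definition opens_preim {X Y : topologicalType} (f : continuousType X Y)
    (U : opens Y) : opens X :=
  Opens ((proj1 (continuousP f) (@cts_fun _ _ f)) _ (@oset_open _ U)).

(* The product of a family of vector spaces.  The alias keeps the instances
   below apart from those of mathcomp on non-dependent functions. *)
Definition dprod (T : Type) (K : T -> Type) := forall t, K t.

Section Dprod.
Context (k : fieldType) (T : Type) (E : T -> lmodType k).
Implicit Types s t u : dprod E.

HB.instance Definition _ := gen_eqMixin (dprod E).
HB.instance Definition _ := gen_choiceMixin (dprod E).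

Definition dprod_zero : dprod E := fun=> 0.
Definition dprod_opp s : dprod E := fun i => - s i.
Definition dprod_add s t : dprod E := fun i => s i + t i.
Definition dprod_scale (a : k) s : dprod E := fun i => a *: s i.

Fact dprod_addA : associative dprod_add.
Proof. by move=> s t u; apply: functional_extensionality_dep => i; exact: addrA. Qed.
Fact dprod_addC : commutative dprod_add.
Proof. by move=> s t; apply: functional_extensionality_dep => i; exact: addrC. Qed.
Fact dprod_add0 : left_id dprod_zero dprod_add.
Proof. by move=> s; apply: functional_extensionality_dep => i; exact: add0r. Qed.
Fact dprod_addN : left_inverse dprod_zero dprod_opp dprod_add.
Proof. by move=> s; apply: functional_extensionality_dep => i; exact: addNr. Qed.

HB.instance Definition _ := GRing.isZmodule.Build (dprod E) dprod_addA dprod_addC dprod_add0 dprod_addN.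

Fact dprod_scaleA a b s : dprod_scale a (dprod_scale b s) = dprod_scale (a * b) s.
Proof. by apply: functional_extensionality_dep => i; exact: scalerA. Qed.
Fact dprod_scale1 : left_id 1 dprod_scale.
Proof. by move=> s; apply: functional_extensionality_dep => i; exact: scale1r. Qed.
Fact dprod_scaleDr : right_distributive dprod_scale +%R.
Proof. by move=> a s t; apply: functional_extensionality_dep => i; exact: scalerDr. Qed.
Fact dprod_scaleDl s : {morph dprod_scale^~ s : a b / a + b}.
Proof. by move=> a b; apply: functional_extensionality_dep => i; exact: scalerDl. Qed.

HB.instance Definition _ :=
  GRing.Zmodule_isLmodule.Build k (dprod E) dprod_scaleA dprod_scale1 dprod_scaleDr dprod_scaleDl.

Lemma dprodP s t : (forall i, s i = t i) -> s = t.
Proof. exact: functional_extensionality_dep. Qed.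

Lemma dprodDE s t i : (s + t) i = s i + t i. Proof. by []. Qed.
Lemma dprodZE a s i : (a *: s) i = a *: s i. Proof. by []. Qed.
Lemma dprod0E i : (0 : dprod E) i = 0. Proof. by []. Qed.

End Dprod.

Definition mklin (k : fieldType) (U V : lmodType k) (f : U -> V)
    (fL : linear f) : {linear U -> V} :=
  HB.pack f (GRing.isLinear.Build _ _ _ _ f fL).

Section Sheaf.
Context (k : fieldType) (X : topologicalType).

Record sheaf := Sheaf {
  sec :> opens X -> lmodType k;
  res : forall U V : opens X, V `<=` U -> {linear sec U -> sec V};
  res_id : forall (U : opens X) (UU : U `<=` U) s, res UU s = s;
  res_comp : forall (U V W : opens X)
    (VU : V `<=` U) (WV : W `<=` V) (WU : W `<=` U) s,
    res WV (res VU s) = res WU s;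
  sheaf_separated : forall (I : Type) (U : I -> opens X) (W : opens X)
    (UW : forall i, U i `<=` W), W `<=` \bigcup_i U i ->
    forall s t : sec W, (forall i, res (UW i) s = res (UW i) t) -> s = t;
  sheaf_glue : forall (I : Type) (U : I -> opens X) (W : opens X)
    (UW : forall i, U i `<=` W), W `<=` \bigcup_i U i ->
    forall s : forall i, sec (U i),
    (forall i j, res (@opensIl _ (U i) (U j)) (s i) = res (@opensIr _ (U i) (U j)) (s j)) ->
    exists t : sec W, forall i, res (UW i) t = s i
}.

Arguments res {_} [U V].

Record sheaf_hom (F G : sheaf) := SheafHom {
  hom_sec :> forall U : opens X, {linear F U -> G U};
  hom_res : forall (U V : opens X) (VU : V `<=` U) s,
    hom_sec V (res VU s) = res VU (hom_sec U s)
}.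

Definition sheaf_iso (F G : sheaf) :=
  exists (phi : sheaf_hom F G) (psi : sheaf_hom G F),
    forall U, cancel (phi U) (psi U) /\ cancel (psi U) (phi U).

End Sheaf.
Arguments res {k X _} [U V].

Section Stalk.
Context (k : fieldType) (X : topologicalType) (F : sheaf k X) (x : X).

Record pregerm := Pregerm {
  pg_open : opens X; pg_in : pg_open x; pg_sec : F pg_open }.

HB.instance Definition _ := gen_eqMixin pregerm.
HB.instance Definition _ := gen_choiceMixin pregerm.

Definition pregerm_rel (g h : pregerm) : bool :=
  `[< exists (W : opens X) (Wg : W `<=` pg_open g) (Wh : W `<=` pg_open h),
      W x /\ res Wg (pg_sec g) = res Wh (pg_sec h) >].

Fact pregerm_rel_refl : reflexive pregerm_rel.
Proof.
move=> g; apply/asboolP; exists (pg_open g), (@subset_refl _ _), (@subset_refl _ _).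
by split=> //; exact: pg_in.
Qed.

Fact pregerm_rel_sym : symmetric pregerm_rel.
Proof.
have H g h : pregerm_rel g h -> pregerm_rel h g.
  move=> /asboolP[W [Wg [Wh [Wx E]]]]; apply/asboolP.
  by exists W, Wh, Wg.
by move=> g h; apply/idP/idP; exact: H.
Qed.

Fact pregerm_rel_trans : transitive pregerm_rel.
Proof.
move=> h g l /asboolP[W [Wg [Wh [Wx E]]]] /asboolP[W' [Wh' [Wl [Wx' E']]]].
apply/asboolP.
have iW : opensI W W' `<=` W by move=> ? [].
have iW' : opensI W W' `<=` W' by move=> ? [].
exists (opensI W W'), (subset_trans iW Wg), (subset_trans iW' Wl); split=> //.
rewrite -(res_comp Wg iW) E -(res_comp Wl iW') -E'.
by rewrite !(res_comp _ _ (subset_trans iW Wh)).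
Qed.

Canonical pregerm_equiv := EquivRel pregerm_rel pregerm_rel_refl pregerm_rel_sym pregerm_rel_trans.

Definition stalk := {eq_quot pregerm_equiv}.

HB.instance Definition _ := Choice.on stalk.
HB.instance Definition _ := EqQuotient.on stalk.

Definition germ (U : opens X) (Ux : U x) (s : F U) : stalk :=
  \pi_stalk (Pregerm Ux s).

Lemma germ_eqP (U V : opens X) (Ux : U x) (Vx : V x) (s : F U) (t : F V) :
  germ Ux s = germ Vx t <->
  exists (W : opens X) (WU : W `<=` U) (WV : W `<=` V),
    W x /\ res WU s = res WV t.
Proof. by split=> [/eqmodP/asboolP|H] //; apply/eqmodP/asboolP. Qed.

Lemma germ_res (U V : opens X) (VU : V `<=` U) (Ux : U x) (Vx : V x) (s : F U) :
  germ Vx (res VU s) = germ Ux s.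
Proof.
apply/germ_eqP; exists V, (@subset_refl _ V), VU; split=> //.
by rewrite res_id.
Qed.

Lemma germ_irr (U : opens X) (Ux Ux' : U x) (s : F U) : germ Ux s = germ Ux' s.
Proof. by congr germ; exact: Prop_irrelevance. Qed.

Lemma stalkP (g : stalk) :
  exists (U : opens X) (Ux : U x) (s : F U), g = germ Ux s.
Proof.
elim/quotP: g => -[U Ux s] _; exists U, Ux, s; by [].
Qed.

Lemma stalk2P (g h : stalk) :
  exists (U : opens X) (Ux : U x) (s t : F U), g = germ Ux s /\ h = germ Ux t.
Proof.
have [U [Ux [s ->]]] := stalkP g; have [V [Vx [t ->]]] := stalkP h.
have iU : opensI U V `<=` U by move=> ? [].
have iV : opensI U V `<=` V by move=> ? [].
by exists (opensI U V), (conj Ux Vx), (res iU s), (res iV t); rewrite !germ_res.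
Qed.

Lemma stalk3P (g h l : stalk) :
  exists (U : opens X) (Ux : U x) (s t u : F U),
    [/\ g = germ Ux s, h = germ Ux t & l = germ Ux u].
Proof.
have [U [Ux [s [t [-> ->]]]]] := stalk2P g h; have [V [Vx [u ->]]] := stalkP l.
have iU : opensI U V `<=` U by move=> ? [].
have iV : opensI U V `<=` V by move=> ? [].
exists (opensI U V), (conj Ux Vx), (res iU s), (res iU t), (res iV u).
by rewrite !germ_res.
Qed.

Definition stalk_zero : stalk := germ (I : opensT x) 0.

Definition stalk_opp (g : stalk) : stalk :=
  germ (pg_in (repr g)) (- pg_sec (repr g)).

Definition stalk_add (g h : stalk) : stalk :=
  germ (conj (pg_in (repr g)) (pg_in (repr h))
         : opensI (pg_open (repr g)) (pg_open (repr h)) x)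
    (res (@opensIl _ _ _) (pg_sec (repr g)) + res (@opensIr _ _ _) (pg_sec (repr h))).

Definition stalk_scale (a : k) (g : stalk) : stalk :=
  germ (pg_in (repr g)) (a *: pg_sec (repr g)).

Fact germ_repr (g : stalk) : germ (pg_in (repr g)) (pg_sec (repr g)) = g.
Proof. by rewrite -[RHS]reprK /germ; case: (repr g). Qed.

Fact germ_zeroE (U : opens X) (Ux : U x) : germ Ux 0 = stalk_zero.
Proof.
apply/germ_eqP; exists U, (@subset_refl _ _), (fun _ _ => I).
by rewrite !linear0.
Qed.

Fact germ_oppE (U : opens X) (Ux : U x) (s : F U) :
  stalk_opp (germ Ux s) = germ Ux (- s).
Proof.
have /germ_eqP[W [W1 [W2 [Wx E]]]] := germ_repr (germ Ux s).
by apply/germ_eqP; exists W, W1, W2; rewrite !linearN E.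
Qed.

Fact germ_scaleE a (U : opens X) (Ux : U x) (s : F U) :
  stalk_scale a (germ Ux s) = germ Ux (a *: s).
Proof.
have /germ_eqP[W [W1 [W2 [Wx E]]]] := germ_repr (germ Ux s).
by apply/germ_eqP; exists W, W1, W2; rewrite !linearZ /= E.
Qed.

Fact germ_addE (U : opens X) (Ux : U x) (s t : F U) :
  stalk_add (germ Ux s) (germ Ux t) = germ Ux (s + t).
Proof.
have /germ_eqP[W [W1 [W2 [Wx E]]]] := germ_repr (germ Ux s).
have /germ_eqP[V [V1 [V2 [Vx E']]]] := germ_repr (germ Ux t).
have iW : opensI W V `<=` W by move=> ? [].
have iV : opensI W V `<=` V by move=> ? [].
apply/germ_eqP; exists (opensI W V).
have iWV : opensI W V `<=` opensI (pg_open (repr (germ Ux s))) (pg_open (repr (germ Ux t))).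
  by move=> y [Wy Vy]; split; [exact: (W1 y Wy)|exact: (V1 y Vy)].
exists iWV, (subset_trans iW W2).
split=> //; rewrite !linearD /=.
rewrite (res_comp _ _ (subset_trans iW W1)) (res_comp _ _ (subset_trans iV V1)).
rewrite -(res_comp W1 iW) E -(res_comp V1 iV) E'.
by rewrite !(res_comp _ _ (subset_trans iW W2)).
Qed.

Fact stalk_addA : associative stalk_add.
Proof.
move=> g h l; have [U [Ux [s [t [u [-> -> ->]]]]]] := stalk3P g h l.
by rewrite !germ_addE addrA.
Qed.
Fact stalk_addC : commutative stalk_add.
Proof.
move=> g h; have [U [Ux [s [t [-> ->]]]]] := stalk2P g h.
by rewrite !germ_addE addrC.
Qed.
Fact stalk_add0 : left_id stalk_zero stalk_add.
Proof.
move=> g; have [U [Ux [s ->]]] := stalkP g.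
by rewrite -(germ_zeroE Ux) germ_addE add0r.
Qed.
Fact stalk_addN : left_inverse stalk_zero stalk_opp stalk_add.
Proof.
move=> g; have [U [Ux [s ->]]] := stalkP g.
by rewrite germ_oppE germ_addE addNr germ_zeroE.
Qed.

HB.instance Definition _ := GRing.isZmodule.Build stalk stalk_addA stalk_addC stalk_add0 stalk_addN.

Fact stalk_scaleA a b (g : stalk) : stalk_scale a (stalk_scale b g) = stalk_scale (a * b) g.
Proof. by have [U [Ux [s ->]]] := stalkP g; rewrite !germ_scaleE scalerA. Qed.
Fact stalk_scale1 : left_id 1 stalk_scale.
Proof. by move=> g; have [U [Ux [s ->]]] := stalkP g; rewrite germ_scaleE scale1r. Qed.
Fact stalk_scaleDr : right_distributive stalk_scale +%R.
Proof.
move=> a g h; have [U [Ux [s [t [-> ->]]]]] := stalk2P g h.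
by rewrite [_ + _]germ_addE !germ_scaleE [RHS]germ_addE scalerDr.
Qed.
Fact stalk_scaleDl (g : stalk) : {morph stalk_scale^~ g : a b / a + b}.
Proof.
move=> a b; have [U [Ux [s ->]]] := stalkP g.
by rewrite !germ_scaleE [RHS]germ_addE scalerDl.
Qed.

HB.instance Definition _ :=
  GRing.Zmodule_isLmodule.Build k stalk stalk_scaleA stalk_scale1 stalk_scaleDr stalk_scaleDl.

Lemma germ_linear (U : opens X) (Ux : U x) : linear (@germ U Ux).
Proof.
move=> a s t; rewrite -germ_addE -germ_scaleE; by [].
Qed.

Lemma germ0 (U : opens X) (Ux : U x) : germ Ux 0 = 0.
Proof. exact: germ_zeroE. Qed.

End Stalk.
Arguments germ {k X F x} [U] Ux s.

(* The subsheaf of sections satisfying a property [P] that is linear, stable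
   under restriction and local. *)
Section Subsheaf.
Context (k : fieldType) (X : topologicalType) (F : sheaf k X).

Record local_property := LocalProperty {
  lp_pred :> forall U : opens X, set (F U);
  lp_zero : forall U, lp_pred (0 : F U);
  lp_linear : forall U a (s t : F U),
    lp_pred s -> lp_pred t -> lp_pred (a *: s + t);
  lp_res : forall (U V : opens X) (VU : V `<=` U) (s : F U),
    lp_pred s -> lp_pred (res VU s);
  lp_local : forall (I : Type) (U : I -> opens X) (W : opens X)
    (UW : forall i, U i `<=` W), W `<=` \bigcup_i U i ->
    forall s : F W, (forall i, lp_pred (res (UW i) s)) -> lp_pred s
}.

Context (P : local_property) (U : opens X).

Definition subsec_pred : {pred F U} := fun s => `[< P U s >].

Fact subsec_submod_closed : submod_closed subsec_pred.
Proof.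
split=> [|a s t /asboolP Ps /asboolP Pt]; apply/asboolP; first exact: lp_zero.
exact: lp_linear.
Qed.

HB.instance Definition _ :=
  GRing.isSubmodClosed.Build k (F U) subsec_pred subsec_submod_closed.

Record subsec := Subsec { subsec_val :> F U; subsec_in : subsec_val \in subsec_pred }.

HB.instance Definition _ := [isSub for subsec_val].
HB.instance Definition _ := [Choice of subsec by <:].
HB.instance Definition _ := [SubChoice_isSubLmodule of subsec by <:].

Lemma subsecP (s : subsec) : P U s.
Proof. by case: s => s /= /asboolP. Qed.

End Subsheaf.
Arguments subsec_pred {k X F} P U.

Section SubsheafSheaf.
Context (k : fieldType) (X : topologicalType) (F : sheaf k X).
Context (P : local_property F).

Definition subsheaf_res_fun (U V : opens X) (VU : V `<=` U) (s : subsec P U) :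
    subsec P V :=
  Subsec (asboolT (lp_res VU (subsecP s)) : res VU (subsec_val s) \in subsec_pred P V).

Fact subsheaf_res_linear (U V : opens X) (VU : V `<=` U) : linear (subsheaf_res_fun VU).
Proof. by move=> a s t; apply: val_inj; rewrite /= !linearP. Qed.

Definition subsheaf : sheaf k X.
Proof.
refine (@Sheaf k X (fun U => subsec P U)
  (fun U V VU => mklin (subsheaf_res_linear VU)) _ _ _ _).
- by move=> U UU s; apply: val_inj; exact: res_id.
- by move=> U V W VU WV WU s; apply: val_inj; exact: res_comp.
- move=> I U W UW WU s t st; apply: val_inj.
  by apply: (@sheaf_separated _ _ _ _ _ _ UW WU) => i; exact: (congr1 val (st i)).
- move=> I U W UW WU s sE.
  have [t tE] : exists t : F W, forall i, res (UW i) t = subsec_val (s i).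
    apply: (@sheaf_glue _ _ _ _ _ _ UW WU) => i j; exact: (congr1 val (sE i j)).
  have Pt : P W t.
    by apply: (@lp_local _ _ _ _ _ _ _ UW WU) => i; rewrite tE; exact: subsecP.
  by exists (Subsec (asboolT Pt : t \in subsec_pred P W)) => i; apply: val_inj; exact: tE.
Defined.

End SubsheafSheaf.

(* The sheaf of all (discontinuous) families, U |-> \prod_(x in U) E x. *)
Section FamilySheaf.
Context (k : fieldType) (X : topologicalType) (E : X -> lmodType k).

Definition fam (U : opens X) : lmodType k :=
  dprod (fun x => dprod (fun _ : U x => E x)).

Definition fam_res_fun (U V : opens X) (VU : V `<=` U) (s : fam U) : fam V :=
  fun x Vx => s x (VU x Vx).

Fact fam_res_linear (U V : opens X) (VU : V `<=` U) : linear (fam_res_fun VU).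
Proof. by []. Qed.

Definition family_sheaf : sheaf k X.
Proof.
refine (@Sheaf k X fam (fun U V VU => mklin (fam_res_linear VU)) _ _ _ _).
- move=> U UU s; do 2![apply: dprodP => ?]; rewrite /= /fam_res_fun.
  by congr (s _ _); exact: Prop_irrelevance.
- move=> U V W VU WV WU s; do 2![apply: dprodP => ?]; rewrite /= /fam_res_fun.
  by congr (s _ _); exact: Prop_irrelevance.
- move=> I U W UW WU s t st; apply: dprodP => x; apply: dprodP => Wx.
  have [i _ Uix] := WU x Wx.
  move: (congr1 (fun f : fam (U i) => f x Uix) (st i)); rewrite /= /fam_res_fun.
  by rewrite (Prop_irrelevance (UW i x Uix) Wx).
- move=> I U W UW WU s sE.
  have c x (Wx : W x) : {i | U i x}.
    by apply: cid; have [i _ Uix] := WU x Wx; exists i.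
  exists (fun x Wx => s (projT1 (c x Wx)) x (projT2 (c x Wx))) => i.
  apply: dprodP => x; apply: dprodP => Uix; rewrite /= /fam_res_fun.
  case: c => j /= Ujx.
  have := congr1 (fun f : fam (opensI (U i) (U j)) => f x (conj Uix Ujx)) (sE i j).
  rewrite /= /fam_res_fun => sijE.
  rewrite (Prop_irrelevance Uix (@opensIl _ _ _ _ (conj Uix Ujx))) sijE.
  by congr (s j x _); exact: Prop_irrelevance.
Defined.

End FamilySheaf.

Section ConstantSheaf.
Context (k : fieldType) (X : topologicalType).

Definition locally_constant_fun (U : opens X)
    (s : family_sheaf (fun _ : X => k^o : lmodType k) U) :=
  forall x (Ux : U x), \forall y \near x, forall Uy : U y, s y Uy = s x Ux.

Definition locally_constant_property :
  local_property (family_sheaf (fun _ : X => k^o : lmodType k)).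
Proof.
apply: (@LocalProperty _ _ _ locally_constant_fun).
- by move=> U x Ux; apply: nearW.
- move=> U a s t sP tP x Ux; apply: filterS2 (sP x Ux) (tP x Ux) => y sE tE Uy.
  by rewrite !dprodDE !dprodZE sE tE.
- move=> U V VU s sP x Vx; apply: filterS (sP x (VU x Vx)) => y yE Vy.
  exact: yE.
- move=> I U W UW WU s sP x Wx; have [i _ Uix] := WU x Wx.
  have Uin : \forall y \near x, U i y.
    by apply: open_nbhs_nbhs; split=> //; exact: oset_open.
  apply: filterS2 Uin (sP i x Uix) => y Uiy /(_ Uiy) yE Wy.
  rewrite (Prop_irrelevance Wy (UW i y Uiy)) (Prop_irrelevance Wx (UW i x Uix)).
  exact: yE.
Defined.

Definition constant_sheaf : sheaf k X := subsheaf locally_constant_property.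

End ConstantSheaf.

Section DirectImage.
Context (k : fieldType) (X Y : topologicalType) (f : continuousType X Y).

Fact opens_preimS (U V : opens Y) :
  V `<=` U -> opens_preim f V `<=` opens_preim f U.
Proof. by move=> VU x; exact: VU. Qed.

Definition direct_image (G : sheaf k X) : sheaf k Y.
Proof.
refine (@Sheaf k Y (fun U => G (opens_preim f U))
  (fun U V VU => res (opens_preimS VU)) _ _ _ _).
- by move=> U UU s; exact: res_id.
- by move=> U V W VU WV WU s; exact: res_comp.
- move=> I U W UW WU s t st.
  apply: (@sheaf_separated _ _ _ _ _ _ (fun i => opens_preimS (UW i))) => //.
  by move=> x /WU[i _ Ux]; exists i.
- move=> I U W UW WU s sE.
  apply: (@sheaf_glue _ _ _ _ _ _ (fun i => opens_preimS (UW i))).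
    by move=> x /WU[i _ Ux]; exists i.
  move=> i j; have := sE i j.
  have H : opensI (opens_preim f (U i)) (opens_preim f (U j)) `<=`
           opens_preim f (opensI (U i) (U j)) by move=> x [].
  move=> /(congr1 (res H)).
  rewrite (res_comp _ _ (@opensIl _ (opens_preim f (U i)) (opens_preim f (U j)))).
  by rewrite (res_comp _ _ (@opensIr _ (opens_preim f (U i)) (opens_preim f (U j)))).
Defined.

End DirectImage.

(* The inverse image, as the sheaf of those families of germs
   (s_y in F_(f y))_y that are locally induced by a section of F. *)
Section InverseImage.
Context (k : fieldType) (Y X : topologicalType) (f : continuousType Y X).
Context (F : sheaf k X).

Local Notation fiber := (fun y : Y => stalk F (f y) : lmodType k).

Definition locally_induced (V : opens Y) (s : family_sheaf fiber V) :=
  forall y, V y -> exists (W : opens X) (t : F W), W (f y) /\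
    \forall z \near y, forall (Vz : V z) (Wz : W (f z)), s z Vz = germ Wz t.

Definition locally_induced_property : local_property (family_sheaf fiber).
Proof.
apply: (@LocalProperty _ _ _ locally_induced).
- move=> V y Vy; exists opensT, 0; split=> //; apply: nearW => z Vz Wz.
  by rewrite germ0.
- move=> V a s t sP tP y Vy.
  have [W [u [Wy uE]]] := sP y Vy; have [W' [u' [Wy' uE']]] := tP y Vy.
  have iW : opensI W W' `<=` W by move=> ? [].
  have iW' : opensI W W' `<=` W' by move=> ? [].
  exists (opensI W W'), (a *: res iW u + res iW' u'); split=> //.
  apply: filterS2 uE uE' => z zE zE' Vz WWz.
  rewrite !dprodDE !dprodZE germ_linear.
  by rewrite (germ_res iW WWz.1) (germ_res iW' WWz.2) -zE -zE'.
- move=> U V VU s sP y Vy; have [W [t [Wy tE]]] := sP y (VU y Vy).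
  by exists W, t; split=> //; apply: filterS tE => z zE Vz; exact: zE.
- move=> I U W UW WU s sP y Wy; have [i _ Uiy] := WU y Wy.
  have [Z [t [Zy tE]]] := sP i y Uiy; exists Z, t; split=> //.
  have Uin : \forall z \near y, U i z.
    by apply: open_nbhs_nbhs; split=> //; exact: oset_open.
  apply: filterS2 Uin tE => z Uiz zE Wz Zz; rewrite -(zE Uiz Zz) /= /fam_res_fun.
  by rewrite (Prop_irrelevance (UW i z Uiz) Wz).
Defined.

Definition inverse_image : sheaf k Y := subsheaf locally_induced_property.

End InverseImage.

Definition subset_incl (X : topologicalType) (S : set X) :
    continuousType (set_type S) X :=
  mkcts (@initial_continuous (set_type S) X set_val).

Definition sheaf_restrict (k : fieldType) (X : topologicalType) (S : set X)
    (F : sheaf k X) : sheaf k (set_type S) :=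
  inverse_image (subset_incl S) F.

(* For j : S -> X the inclusion of a locally closed subset, j_! G is the
   subsheaf of j_* G of the sections whose support is closed in the open set
   where they are defined. *)
Section ExtensionByZero.
Context (k : fieldType) (X : topologicalType) (S : set X).
Context (G : sheaf k (set_type S)).
Local Notation j := (subset_incl S).

Definition sec_support (U : opens X) (s : direct_image j G U) : set X :=
  [set x | exists (y : set_type S) (Uy : opens_preim j U y),
             j y = x /\ germ (Uy : opens_preim j U y) (s : G (opens_preim j U)) <> 0].

Definition closed_support (U : opens X) (s : direct_image j G U) :=
  open (U `\` sec_support s).

Definition closed_support_property : local_property (direct_image j G).
Proof.
apply: (@LocalProperty _ _ _ closed_support).
- move=> U; rewrite /closed_support.
  suff -> : U `\` sec_support (0 : direct_image j G U) = U by exact: oset_open.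
  apply/seteqP; split=> [x []//|x Ux]; split=> // -[y [Uy [_]]].
  by rewrite germ0.
- move=> U a s t cs ct.
  rewrite /closed_support openE => x [Ux xNst]; rewrite /interior.
  have [xs|xNs] := pselect (sec_support s x \/ sec_support t x); last first.
    have [xs xt] : ~ sec_support s x /\ ~ sec_support t x by apply/not_orP.
    have Ns : nbhs x (U `\` sec_support s) by apply: open_nbhs_nbhs.
    have Nt : nbhs x (U `\` sec_support t) by apply: open_nbhs_nbhs.
    apply: filterS2 Ns Nt => z [Uz zs] [_ zt]; split=> // -[y [Uy [yz]]].
    apply; rewrite germ_linear.
    have -> : germ Uy (s : G (opens_preim j U)) = 0.
      by apply: contrapT => H; apply: zs; exists y, Uy.
    have -> : germ Uy (t : G (opens_preim j U)) = 0.
      by apply: contrapT => H; apply: zt; exists y, Uy.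
    by rewrite scaler0 addr0.
  have [y jy] : exists y : set_type S, j y = x.
    by case: xs => -[y [_ [jy _]]]; exists y.
  have Uy : opens_preim j U y by rewrite /= jy.
  have /germ_eqP[V [VU [VT [Vy VE]]]] :
      germ Uy (a *: s + t : G (opens_preim j U)) = germ (I : opensT y) 0.
    rewrite germ0; apply: contrapT => H; apply: xNst; by exists y, Uy.
  have [W oW WV] := oset_open V.
  have NW : nbhs x W.
    by apply: open_nbhs_nbhs; split=> //; move: Vy; rewrite -WV /= -jy.
  have NU : nbhs x U by apply: open_nbhs_nbhs; split=> //; exact: oset_open.
  apply: filterS2 NW NU => z Wz Uz; split=> // -[y' [Uy' [jy']]]; apply.
  have Vy' : V y' by rewrite -WV /=; move: Wz; rewrite -jy'.
  by rewrite -(germ_res VU Uy' Vy') VE linear0 germ0.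
- move=> U V VU s cs.
  have suppE : V `\` sec_support (res VU s) = V `&` (U `\` sec_support s).
    apply/seteqP; split=> x [Vx xs]; split=> //.
      split; first exact: (VU x Vx).
      move=> -[y [Uy [jy ys]]]; apply: xs.
      have Vy : opens_preim j V y by rewrite /= jy.
      by exists y, Vy; split=> //; rewrite (germ_res _ Uy).
    move=> -[y [Vy [jy ys]]]; apply: xs.2.
    have Uy : opens_preim j U y by rewrite /= jy; exact: (VU x Vx).
    by exists y, Uy; split=> //; move: ys; rewrite (germ_res _ Uy).
  by rewrite /closed_support suppE; apply: openI => //; exact: oset_open.
- move=> I U W UW WU s sP; rewrite /closed_support openE => x [Wx xs].
  have [i _ Uix] := WU x Wx; rewrite /interior.
  have : nbhs x (U i `\` sec_support (res (UW i) s)).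
    apply: open_nbhs_nbhs; split; first exact: sP.
    split=> // -[y [Uy [jy ys]]]; apply: xs.
    have Wy : opens_preim j W y by rewrite /= jy.
    by exists y, Wy; split=> //; move: ys; rewrite (germ_res _ Wy).
  apply: filterS => z [Uiz zs]; split; first exact: (UW i z Uiz).
  move=> -[y [Wy [jy ys]]]; apply: zs.
  have Uy : opens_preim j (U i) y by rewrite /= jy.
  by exists y, Uy; split=> //; rewrite (germ_res _ Wy).
Defined.

Definition extension_by_zero : sheaf k X := subsheaf closed_support_property.

End ExtensionByZero.

(* The sheaf k_S on X, for S locally closed in X. *)
Definition constant_on (k : fieldType) (X : topologicalType) (S : set X) :
    sheaf k X :=
  extension_by_zero (constant_sheaf k (set_type S)).

Section DirectSum.
Context (k : fieldType) (X : topologicalType).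

Section Finite.
Context (A : finType) (F : A -> sheaf k X).

Definition dsum_sec (U : opens X) : lmodType k := dprod (fun a => F a U).

Definition dsum_res_fun (U V : opens X) (VU : V `<=` U) (s : dsum_sec U) :
  dsum_sec V := fun a => res VU (s a).

Fact dsum_res_linear (U V : opens X) (VU : V `<=` U) : linear (dsum_res_fun VU).
Proof. by move=> a s t; apply: dprodP => i; exact: linearP. Qed.

Definition dsum : sheaf k X.
Proof.
refine (@Sheaf k X dsum_sec (fun U V VU => mklin (dsum_res_linear VU)) _ _ _ _).
- by move=> U UU s; apply: dprodP => a; exact: res_id.
- by move=> U V W VU WV WU s; apply: dprodP => a; exact: res_comp.
- move=> I U W UW WU s t st; apply: dprodP => a.
  apply: (@sheaf_separated _ _ _ _ _ _ UW WU) => i.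
  exact: (congr1 (fun f : dsum_sec (U i) => f a) (st i)).
- move=> I U W UW WU s sE.
  have c a : {t : F a W | forall i, res (UW i) t = s i a}.
    apply: cid; apply: (@sheaf_glue _ _ _ _ _ _ UW WU) => i j.
    exact: (congr1 (fun f : dsum_sec (opensI (U i) (U j)) => f a) (sE i j)).
  by exists (fun a => projT1 (c a)) => i; apply: dprodP => a; exact: (projT2 (c a)).
Defined.

End Finite.

Section Binary.
Context (F G : sheaf k X).

Definition dsum2_res_fun (U V : opens X) (VU : V `<=` U) (s : F U * G U) :
  F V * G V := (res VU s.1, res VU s.2).

Fact dsum2_res_linear (U V : opens X) (VU : V `<=` U) : linear (dsum2_res_fun VU).
Proof. by move=> a s t; congr pair; exact: linearP. Qed.

Definition dsum2 : sheaf k X.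
Proof.
refine (@Sheaf k X (fun U => (F U * G U)%type)
  (fun U V VU => mklin (dsum2_res_linear VU)) _ _ _ _).
- by move=> U UU [s t]; congr pair; exact: res_id.
- by move=> U V W VU WV WU [s t]; congr pair; exact: res_comp.
- move=> I U W UW WU [s s'] [t t'] st; congr pair.
    by apply: (@sheaf_separated _ _ _ _ _ _ UW WU) => i; exact: (congr1 fst (st i)).
  by apply: (@sheaf_separated _ _ _ _ _ _ UW WU) => i; exact: (congr1 snd (st i)).
- move=> I U W UW WU s sE.
  have [t tE] : exists t : F W, forall i, res (UW i) t = (s i).1.
    by apply: (@sheaf_glue _ _ _ _ _ _ UW WU) => i j; exact: (congr1 fst (sE i j)).
  have [t' tE'] : exists t : G W, forall i, res (UW i) t = (s i).2.
    by apply: (@sheaf_glue _ _ _ _ _ _ UW WU) => i j; exact: (congr1 snd (sE i j)).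
  exists (t, t') => i; rewrite /= /dsum2_res_fun /= tE tE'.
  by case: (s i).
Defined.

End Binary.

Definition sheaf_power (F : sheaf k X) (n : nat) : sheaf k X :=
  dsum (fun _ : 'I_n => F).

Definition constant_of_finite_rank (F : sheaf k X) :=
  exists n : nat, sheaf_iso F (sheaf_power (constant_sheaf k X) n).

End DirectSum.

Definition locally_constant_of_finite_rank (k : fieldType)
    (X : topologicalType) (F : sheaf k X) :=
  forall x, exists U : opens X, U x /\ constant_of_finite_rank (sheaf_restrict U F).

Section Circle.
Context (R : realType).

Definition circle_rel (x y : R) : bool :=
  `[< exists n : int, x = y + n%:~R * (2 * pi) >].

Fact circle_rel_refl : reflexive circle_rel.
Proof. by move=> x; apply/asboolP; exists 0; rewrite mul0r addr0. Qed.

Fact circle_rel_sym : symmetric circle_rel.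
Proof.
have H x y : circle_rel x y -> circle_rel y x.
  move=> /asboolP[n ->]; apply/asboolP; exists (- n).
  by rewrite intrN mulNr addrK.
by move=> x y; apply/idP/idP; exact: H.
Qed.

Fact circle_rel_trans : transitive circle_rel.
Proof.
move=> y x z /asboolP[n ->] /asboolP[m ->]; apply/asboolP; exists (m + n).
by rewrite -addrA -mulrDl intrD.
Qed.

Canonical circle_equiv := EquivRel circle_rel circle_rel_refl circle_rel_sym circle_rel_trans.

(* R / 2 pi Z *)
Definition circle := quotient_topology {eq_quot circle_equiv}.

HB.instance Definition _ := Topological.on circle.

Definition circle_map : continuousType R circle :=
  mkcts (@pi_continuous R {eq_quot circle_equiv}).

(* The quotient map provides the analytic coordinates of the circle.  In such a
   coordinate t, centred at x, a submanifold of dimension 1 is everything near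
   x, and a submanifold of dimension 0 is the single point x near x. *)
Definition analytic_submanifold (S : set circle) :=
  forall x, S x -> exists2 t, circle_map t = x &
    (\forall s \near t, S (circle_map s)) \/
    (\forall s \near t, S (circle_map s) <-> s = t).

(* With connected strata, each stratum is a point, an open arc or the circle,
   so subanalyticity of the strata is automatic. *)
Record analytic_stratification (T : set (set circle)) : Prop := {
  stratification_partition : partition T id [set: circle];
  stratification_locally_finite : forall x : circle, exists2 V, nbhs x V &
    finite_set [set S | T S /\ S `&` V !=set0];
  stratum_connected : forall S, T S -> connected S;
  stratum_submanifold : forall S, T S -> analytic_submanifold S;
  stratification_frontier : forall S S', T S -> T S' ->
    S `&` closure S' !=set0 -> S `<=` closure S'
}.

Definition constructible (k : fieldType) (F : sheaf k circle) :=
  exists2 T, analytic_stratification T &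
    forall S, T S -> constant_of_finite_rank (sheaf_restrict S F).

End Circle.
Arguments circle_map {R}.

(* Main.v *)
Require Import Defs.
From mathcomp Require Import all_boot all_order all_algebra generic_quotient.
From mathcomp Require Import all_classical all_reals all_analysis.
From mathcomp Require Import finmap lra zify.
Set Implicit Arguments.
Unset Strict Implicit.
Unset Printing Implicit Defensive.
Import Order.TTheory GRing.Theory Num.Theory.
Import numFieldNormedType.Exports.
Local Open Scope classical_set_scope.
Local Open Scope ring_scope.

(* Let e be the quotient map.  By compactness there are finitely many strata, so
   the lifts of the zero-dimensional ones form a discrete periodic subset of the
   line; they and the intervals between them are the cells.  Trivialising F on
   each stratum identifies its sections with functions to some k^D, and F becomes
   a 2n-periodic zigzag of linear relations between the spaces of germs over
   consecutive cells.

   Assume that some relation is defective at the left end of a cell, in the sense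
   that the generization map is not injective (at a point) or not surjective (onto
   an interval).  Pushing a pair of subspaces A < B to the right through the
   relations produces a section u and a dual section l of e^* F with <u, l> = 1 on
   an interval I starting there.  The process stops: otherwise the pairings
   between translates of u and l give a triangular unipotent matrix of size D + 1
   and rank at most D.  The same triangularity shows that the composite
   e_* k_I -> F -> e_* k_I given by u and l is the identity plus a nilpotent map,
   so e_* k_I is a direct summand of F.  Splitting off such summands decreases the
   dimensions.  When there is no defect left, the dimensions are nonincreasing along
   the zigzag, hence constant by periodicity, so all generization maps are
   isomorphisms and the remaining sheaf is locally constant. *)

(** * Linear relations *)

(** A generization map goes from a point to either neighbouring interval, so along the line the maps
    alternate in direction. Read as linear relations from left to right, they all allow the same
    pushing argument, for both kinds of cells and both kinds of ends. The section u and the dual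
    section l must be found together: at the right end either u is related to 0 or l kills all that
    extends further, and only there is it known which. Hence u and l are chosen backwards from the
    end, and the pair A < B keeps what the left end asks of them: u starts in B and l kills A. The
    interval I may be longer than 2 pi. Then several points of I lie over one point of the circle,
    and the composite given by u and l has off-diagonal terms. The left end makes them one-sided:
    either u starts from 0, or all that comes from the left lies in A. One common k^D for all strata
    makes the pairings between distant cells meaningful and bounds their rank. *)

Section LinearAlgebra.
Context (k : fieldType).

Definition linear_subspace (V : lmodType k) (P : V -> Prop) :=
  P 0 /\ forall a x y, P x -> P y -> P (a *: x + y).

Definition linear_relation (V W : lmodType k) (C : V -> W -> Prop) :=
  C 0 0 /\ forall a x y x' y', C x y -> C x' y' -> C (a *: x + x') (a *: y + y').

Definition dot D (x : 'rV[k]_D) (l : 'cV[k]_D) : k := (x *m l) 0 0.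

Lemma dotDl D a (x y : 'rV[k]_D) l : dot (a *: x + y) l = a * dot x l + dot y l.
Proof. by rewrite /dot mulmxDl -scalemxAl !mxE. Qed.

Lemma dot0l D (l : 'cV[k]_D) : dot 0 l = 0.
Proof. by rewrite /dot mul0mx mxE. Qed.

Lemma dot0r D (x : 'rV[k]_D) : dot x 0 = 0.
Proof. by rewrite /dot mulmx0 mxE. Qed.

Lemma dotZl D a (x : 'rV[k]_D) l : dot (a *: x) l = a * dot x l.
Proof. by rewrite -[a *: x]addr0 dotDl dot0l addr0. Qed.

Lemma dotBl D (x y : 'rV[k]_D) l : dot (x - y) l = dot x l - dot y l.
Proof. by rewrite addrC -scaleN1r dotDl mulN1r addrC. Qed.

Lemma dot_sum D I (r : seq I) (x : I -> 'rV[k]_D) l :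
  dot (\sum_(i <- r) x i) l = \sum_(i <- r) dot (x i) l.
Proof. by rewrite /dot mulmx_suml summxE. Qed.

Lemma subspaceB (V : lmodType k) (P : V -> Prop) x y :
  linear_subspace P -> P x -> P y -> P (x - y).
Proof. by move=> [_ PD] Px Py; rewrite addrC -scaleN1r; apply: PD. Qed.

Lemma linear_relation_sum (V W : lmodType k) (C : V -> W -> Prop) n (a : 'I_n -> k)
    (v : 'I_n -> V) (w : 'I_n -> W) : linear_relation C ->
  (forall i, C (v i) (w i)) -> C (\sum_i a i *: v i) (\sum_i a i *: w i).
Proof.
move=> [C0 CD] Cvw; elim/big_ind2: _ => // [x x' y y' Cx Cy|i _].
  by rewrite -[x]scale1r -[x']scale1r; apply: CD.
by rewrite -[a i *: v i]addr0 -[a i *: w i]addr0; apply: CD.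
Qed.

Lemma linear_relationB (V W : lmodType k) (C : V -> W -> Prop) x y x' y' :
  linear_relation C -> C x y -> C x' y' -> C (x - x') (y - y').
Proof.
move=> [_ CD] Cxy Cxy'; rewrite addrC [y - y']addrC -!scaleN1r.
exact: CD.
Qed.

Lemma subspace_mx D (P : 'rV[k]_D -> Prop) : linear_subspace P ->
  exists M : 'M[k]_D, forall v, P v <-> (v <= M)%MS.
Proof.
move=> sP.
pose Q r := `[< exists M : 'M[k]_D, (forall v, (v <= M)%MS -> P v) /\ \rank M = r >].
have Q0 : exists r, Q r.
  exists 0%N; apply/asboolP; exists 0; split; last exact: mxrank0.
  by move=> v; rewrite submx0 => /eqP ->; exact: sP.1.
have Qle r : Q r -> (r <= D)%N by move=> /asboolP[M [_ <-]]; exact: rank_leq_row.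
have [r /asboolP[M [MP Mr]] rmax] := ex_maxnP Q0 Qle.
exists M => v; split; last exact: MP.
move=> Pv.
have /rmax : Q (\rank (M + v)%MS).
  apply/asboolP; exists (M + v)%MS; split => // w /sub_addsmxP[[x y] /= ->].
  have -> : y *m v = (y 0 0) *: v by rewrite -mul_scalar_mx -mx11_scalar.
  rewrite addrC; apply: sP.2 => //; apply: MP; exact: submxMl.
rewrite -Mr => le; have /mxrank_leqif_sup[_] := addsmxSl M v.
have -> : (\rank M == \rank (M + v)%MS) by rewrite eqn_leq le mxrankS // addsmxSl.
by move=> /esym; apply: submx_trans; exact: addsmxSr.
Qed.

Lemma separating_functional D (P : 'rV[k]_D -> Prop) u : linear_subspace P -> ~ P u ->
  exists l, (forall x, P x -> dot x l = 0) /\ dot u l = 1.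
Proof.
move=> /subspace_mx[M MP] /MP/negP; rewrite submxE => /rV0Pn[j uj].
exists (((u *m cokermx M) 0 j)^-1 *: col j (cokermx M)).
have dotE x : dot x ((((u *m cokermx M) 0 j)^-1 *: col j (cokermx M)))
    = ((u *m cokermx M) 0 j)^-1 * (x *m cokermx M) 0 j.
  rewrite /dot -scalemxAr mxE; congr (_ * _).
  by rewrite !mxE; apply: eq_bigr => a _; rewrite mxE.
split; last by rewrite dotE mulVf.
by move=> x /MP; rewrite submxE dotE => /eqP ->; rewrite [X in _ * X]mxE mulr0.
Qed.

(** The rule sending a + x to <y, l'>, for a in A and C x y, is a functional on A + dom C, well
    defined because l' kills the image of A. [Q] is its graph. A functional that separates (0, -1)
    from [Q] has last entry -1, so its first D entries extend the rule to the whole space. *)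
Lemma functional_extension D (A : 'rV[k]_D -> Prop) (C : 'rV[k]_D -> 'rV[k]_D -> Prop) l' :
  linear_subspace A -> linear_relation C ->
  (forall x y, A x -> C x y -> dot y l' = 0) ->
  exists l, (forall x, A x -> dot x l = 0) /\
    forall x y, C x y -> dot x l = dot y l'.
Proof.
move=> sA sC AC.
pose Q (z : 'rV[k]_(D + 1)) := exists a x y,
  [/\ A a, C x y & z = row_mx (a + x) (dot y l')%:M].
have sQ : linear_subspace Q.
  split.
    exists 0, 0, 0; split; [exact: sA.1|exact: sC.1|].
    by rewrite addr0 dot0l raddf0 row_mx0.
  move=> c _ _ [a [x [y [Aa Cx ->]]]] [a' [x' [y' [Aa' Cx' ->]]]].
  exists (c *: a + a'), (c *: x + x'), (c *: y + y'); split.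
  - exact: sA.2.
  - exact: sC.2.
  - rewrite scale_row_mx add_row_mx dotDl scalerDr addrACA.
    by rewrite raddfD /= -scale_scalar_mx.
have nQ : ~ Q (row_mx 0 (-1)%:M).
  move=> [a [x [y [Aa Cxy /eq_row_mx[ax E]]]]].
  have : dot y l' = 0.
    apply: (AC x) => //; rewrite (_ : x = 0 - a); last by rewrite ax addrAC subrr add0r.
    by apply: subspaceB => //; exact: sA.1.
  move=> E'; move: (congr1 (fun m : 'M[k]_1 => m 0 0) E); rewrite E' !mxE eqxx !mulr1n.
  by move=> /eqP; rewrite oppr_eq0 oner_eq0.
have [m [mQ m1]] := separating_functional sQ nQ.
have dotE x c : dot (row_mx x c%:M) m = dot x (usubmx m) + c * dot 1%:M (dsubmx m).
  rewrite /dot -{1}[m]vsubmxK mul_row_col mxE; congr (_ + _).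
  by rewrite !mul_scalar_mx scale1r mxE.
have E1 : dot 1%:M (dsubmx m) = - 1.
  by move: m1; rewrite dotE dot0l add0r mulN1r => /eqP; rewrite eqr_oppLR => /eqP.
have Q' a x y : A a -> C x y -> dot (a + x) (usubmx m) = dot y l'.
  move=> Aa Cxy; have := mQ (row_mx (a + x) (dot y l')%:M).
  rewrite dotE E1 mulrN1 => /(_ _)/subr0_eq; apply.
  by exists a, x, y.
exists (usubmx m); split.
  by move=> x Ax; rewrite -[x]addr0 (Q' x 0 0) ?dot0l//; exact: sC.1.
by move=> x y Cxy; rewrite -[x]add0r; apply: Q' => //; exact: sA.1.
Qed.

(* The pair [A < B] is pushed through the relations.  The string stops at the
   first [b] where either [B] meets the kernel of [C b] outside of [A], or [B] is
   not contained in [A + dom (C b)]. *)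
Lemma string_prefix D (C : nat -> 'rV[k]_D -> 'rV[k]_D -> Prop) :
  (forall i, linear_relation (C i)) ->
  forall L i (A B : 'rV[k]_D -> Prop), linear_subspace A -> linear_subspace B ->
  (forall x, A x -> B x) -> (exists x, B x /\ ~ A x) ->
  exists b u l,
  [/\ [/\ (i <= b)%N, (b <= i + L)%N, B (u i) & forall x, A x -> dot x (l i) = 0],
      forall q, (i <= q)%N -> (q <= b)%N -> dot (u q) (l q) = 1,
      forall q, (i <= q)%N -> (q < b)%N -> C q (u q) (u q.+1),
      forall q, (i <= q)%N -> (q < b)%N ->
        forall x y, C q x y -> dot x (l q) = dot y (l q.+1)
    & [\/ b = (i + L)%N, C b (u b) 0 | forall x y, C b x y -> dot x (l b) = 0]].
Proof.
move=> Clin; elim=> [|L IH] i A B sA sB AB [z [Bz NAz]].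
  have [l [lA lz]] := separating_functional sA NAz.
  exists i, (fun=> z), (fun=> l); split=> //.
  - by split=> //; rewrite addn0.
  - by move=> q iq qi; have := leq_ltn_trans iq qi; rewrite ltnn.
  - by move=> q iq qi; have := leq_ltn_trans iq qi; rewrite ltnn.
  - by constructor 1; rewrite addn0.
have sC := Clin i.
have [[x [Bx NAx Cx0]]|NK] := pselect (exists x, [/\ B x, ~ A x & C i x 0]).
  have [l [lA lx]] := separating_functional sA NAx.
  exists i, (fun=> x), (fun=> l); split=> //.
  - by split=> //; rewrite leq_addr.
  - by move=> q iq qi; have := leq_ltn_trans iq qi; rewrite ltnn.
  - by move=> q iq qi; have := leq_ltn_trans iq qi; rewrite ltnn.
  - by constructor 2.
pose A1 x := exists a x' y, [/\ A a, C i x' y & x = a + x'].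
have sA1 : linear_subspace A1.
  split; first by exists 0, 0, 0; split; [exact: sA.1|exact: sC.1|rewrite addr0].
  move=> c _ _ [a [x [y [Aa Cx ->]]]] [a' [x' [y' [Aa' Cx' ->]]]].
  exists (c *: a + a'), (c *: x + x'), (c *: y + y'); split.
  - exact: sA.2.
  - exact: sC.2.
  - by rewrite scalerDr addrACA.
have [[x [Bx NAx]]|ND] := pselect (exists x, B x /\ ~ A1 x).
  have [l [lA lx]] := separating_functional sA1 NAx.
  exists i, (fun=> x), (fun=> l); split=> //.
  - split=> //; rewrite ?leq_addr// => a Aa; apply: lA.
    by exists a, 0, 0; split=> //; [exact: sC.1|rewrite addr0].
  - by move=> q iq qi; have := leq_ltn_trans iq qi; rewrite ltnn.
  - by move=> q iq qi; have := leq_ltn_trans iq qi; rewrite ltnn.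
  - constructor 3 => x' y Cxy; apply: lA; exists 0, x', y; split=> //.
      exact: sA.1.
    by rewrite add0r.
pose im (P : 'rV[k]_D -> Prop) y := exists x, P x /\ C i x y.
have im_sub P : linear_subspace P -> linear_subspace (im P).
  move=> sP; split; first by exists 0; split; [exact: sP.1|exact: sC.1].
  move=> c y y' [x [Px Cx]] [x' [Px' Cx']]; exists (c *: x + x'); split.
    exact: sP.2.
  exact: sC.2.
(* Write z = a + x with x in the domain; then x is in B and not in A. If its image y also came from
   some x' in A, then x - x' would be a vector of B outside A related to 0, which [NK] excludes. *)
have imN : exists y, im B y /\ ~ im A y.
  have [a [x [y [Aa Cxy zE]]]] : A1 z.
    by apply: contrapT => NA1; apply: ND; exists z.
  have NAx : ~ A x.
    move=> Ax; apply: NAz; rewrite zE -[a]scale1r.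
    exact: sA.2.
  have Bx : B x.
    have -> : x = z - a by rewrite zE addrAC subrr add0r.
    by apply: subspaceB => //; exact: AB.
  exists y; split; first by exists x.
  move=> [x' [Ax' Cx'y]]; apply: NK; exists (x - x'); split.
  - by apply: subspaceB => //; exact: AB.
  - move=> Axx'; apply: NAx; rewrite -[x](subrK x') -[x - x']scale1r.
    exact: sA.2.
  - by rewrite -(subrr y); exact: linear_relationB.
have imS y : im A y -> im B y by move=> [x [Ax Cxy]]; exists x; split=> //; exact: AB.
have [b [u [l [[ib bL [x [Bx Cx]] lA] ul Cu Cl e]]]] :=
  IH i.+1 (im A) (im B) (im_sub A sA) (im_sub B sB) imS imN.
(* The string is known from [i.+1] on. One step backwards, u at [i] is the preimage [x] in B, and l
   at [i] is an extension along [C i] that kills A. *)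
have [l0 [l0A l0C]] : exists l0, (forall x, A x -> dot x l0 = 0) /\
    forall x y, C i x y -> dot x l0 = dot y (l i.+1).
  apply: functional_extension => // x' y Ax' Cx'y; apply: lA.
  by exists x'.
exists b, (fun q => if q == i then x else u q), (fun q => if q == i then l0 else l q).
have neq q : (i < q)%N -> (q == i) = false by move=> iq; rewrite gtn_eqF.
split; rewrite ?eqxx.
- by rewrite ltnW//; split=> //; rewrite addnS.
- move=> q; rewrite leq_eqVlt eq_sym => /orP[/eqP ->|iq] qb.
    by rewrite !eqxx (l0C _ _ Cx); exact: ul.
  by rewrite neq//; exact: ul.
- move=> q; rewrite leq_eqVlt eq_sym => /orP[/eqP ->|iq] qb.
    by rewrite eqxx neq.
  by rewrite !neq ?(leqW iq)//; exact: Cu.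
- move=> q; rewrite leq_eqVlt eq_sym => /orP[/eqP ->|iq] qb x' y'.
    by rewrite eqxx neq//; exact: l0C.
  by rewrite !neq ?(leqW iq)//; exact: Cl.
- by rewrite !neq// addnS.
Qed.

Lemma triangular_pairing D (u : 'I_D.+1 -> 'rV[k]_D) (l : 'I_D.+1 -> 'cV[k]_D) :
  (forall i, dot (u i) (l i) = 1) ->
  (forall i j : 'I_D.+1, (i < j)%N -> dot (u i) (l j) = 0) -> False.
Proof.
move=> ul1 ul0.
pose U := \matrix_i u i; pose Lm : 'M[k]_(D, D.+1) := \matrix_(a, j) l j a 0.
have ULE i j : (U *m Lm) i j = dot (u i) (l j).
  by rewrite /dot !mxE; apply: eq_bigr => a _; rewrite !mxE.
have trig : is_trig_mx (U *m Lm).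
  by apply/is_trig_mxP => i j ij; rewrite ULE ul0.
have : \det (U *m Lm) = 1.
  by rewrite det_trig// big1// => i _; rewrite ULE.
move=> dE; have : (U *m Lm) \in unitmx by rewrite unitmxE dE unitr1.
rewrite -row_full_unit /row_full => /eqP rE.
have := mxrankM_maxl U Lm; rewrite rE => /leq_trans/(_ (rank_leq_col U)).
by rewrite ltnn.
Qed.

(** The last hypothesis says that the string has a genuine left end. By periodicity the same
    relation holds one or more periods later, where it meets the string again; this makes the
    pairings of u with translates of l vanish, on a side that depends on the kind of left end. *)
Lemma string_exists D N (C : nat -> 'rV[k]_D -> 'rV[k]_D -> Prop) i
    (A B : 'rV[k]_D -> Prop) :
  (0 < N)%N -> (forall q, linear_relation (C q)) ->
  (forall q x y, C (q + N)%N x y <-> C q x y) ->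
  linear_subspace A -> linear_subspace B -> (forall x, A x -> B x) -> (exists x, B x /\ ~ A x) ->
  (forall x, B x -> C i 0 x) \/ (forall x y, C i x y -> A y) ->
  exists b u l,
  [/\ [/\ (i < b)%N, B (u i.+1) & forall x, A x -> dot x (l i.+1) = 0],
      forall q, (i < q)%N -> (q <= b)%N -> dot (u q) (l q) = 1,
      forall q, (i < q)%N -> (q < b)%N -> C q (u q) (u q.+1) /\
        (forall x y, C q x y -> dot x (l q) = dot y (l q.+1)),
      C b (u b) 0 \/ (forall x y, C b x y -> dot x (l b) = 0)
    & (forall q m, (i < q)%N -> (0 < m)%N -> (q + m * N <= b)%N ->
         dot (u q) (l (q + m * N)%N) = 0) \/
      (forall q m, (i < q)%N -> (0 < m)%N -> (q + m * N <= b)%N ->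
         dot (u (q + m * N)%N) (l q) = 0)].
Proof.
move=> N0 Clin Cper sA sB AB ABN start.
have CperM m q x y : C (q + m * N)%N x y <-> C q x y.
  elim: m => [|m IH]; first by rewrite mul0n addn0.
  by rewrite mulSn addnCA addnC Cper.
(* A string of [D.+1 * N] steps would contain D + 1 translates of the index [i.+1]. *)
have [b [u [l [[ib bL Bu lA] ul Cu Cl e]]]] :=
  @string_prefix D C Clin (D.+1 * N) i.+1 A B sA sB AB ABN.
(* Induction on q. At [i.+1], either 0 is related to u by the translated relation, so the adjunction
   gives <0, l> = 0; or u of the later translate lies in the image of [C i], hence in A, which l
   kills. The adjunction then carries the vanishing to the right. *)
have tri : (forall q m, (i < q)%N -> (0 < m)%N -> (q + m * N <= b)%N ->
         dot (u q) (l (q + m * N)%N) = 0) \/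
      (forall q m, (i < q)%N -> (0 < m)%N -> (q + m * N <= b)%N ->
         dot (u (q + m * N)%N) (l q) = 0).
  case: start => start; [left|right] => q m iq m0; rewrite -(subnKC iq);
    elim: (q - i.+1)%N => [|r IH] rb.
  - have mN : (0 < m * N)%N by rewrite muln_gt0 m0.
    have := start _ Bu; rewrite -(CperM m) addn0 => H.
    rewrite addSn -(Cl _ _ _ _ _ H) ?dot0l//; [lia|].
    by move: rb; rewrite addn0 addSn.
  - rewrite addnS in rb *; rewrite addSn in rb *.
    rewrite -(Cl _ _ _ (u (i.+1 + r)%N)) ?CperM; [apply: IH|..]; try lia.
    by apply: Cu; lia.
  - rewrite addn0 in rb *; apply: lA; apply: (start (u (i + m * N)%N)).
    have mN : (0 < m * N)%N by rewrite muln_gt0 m0.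
    by rewrite -(CperM m); rewrite addSn; apply: Cu; lia.
  - rewrite addnS in rb *; rewrite addSn in rb *.
    rewrite -(Cl _ _ _ (u (i.+1 + r + m * N)%N)); [apply: IH|..]; try lia.
    rewrite -(CperM m); apply: Cu; lia.
exists b, u, l; split=> //.
- by move=> q iq qb; split; [exact: Cu|exact: Cl].
case: e => [bE|e|e]; [|by left|by right].
have ineq (j : 'I_D.+1) : (i.+1 + j * N <= b)%N.
  by rewrite bE leq_add2l leq_mul2r ltnW ?orbT.
exfalso; case: tri => tri.
  apply: (@triangular_pairing D (fun j => u (i.+1 + j * N)%N) (fun j => l (i.+1 + j * N)%N)).
    by move=> j; apply: ul => //; rewrite leq_addr.
  move=> j1 j2 j12.
  have j2E : (i.+1 + j2 * N = i.+1 + j1 * N + (j2 - j1) * N)%N.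
    by rewrite -addnA -mulnDl subnKC// ltnW.
  rewrite {1}j2E; apply: tri; rewrite -?j2E//; [lia|lia].
(* Here the other side of the diagonal vanishes, so the translates are listed backwards. *)
apply: (@triangular_pairing D (fun j => u (i.+1 + rev_ord j * N)%N) (fun j => l (i.+1 + rev_ord j * N)%N)).
  by move=> j; apply: ul => //; rewrite leq_addr.
move=> j1 j2 j12.
have j2E : (i.+1 + rev_ord j1 * N = i.+1 + rev_ord j2 * N + (j2 - j1) * N)%N.
  by rewrite -addnA -mulnDl; congr (_ + _ * _)%N; rewrite /=; move: (ltn_ord j2); lia.
rewrite {1}j2E; apply: tri; rewrite -?j2E//; [lia|lia].
Qed.

End LinearAlgebra.

(** * Sheaves and germs *)

Section SheafIsomorphisms.
Context (k : fieldType) (X : topologicalType).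

Lemma bijective_hom_iso (F G : sheaf k X) (phi : sheaf_hom F G) :
  (forall U s, phi U s = 0 -> s = 0) -> (forall U t, exists s, phi U s = t) ->
  sheaf_iso F G.
Proof.
move=> inj0 surj.
have inj U : injective (phi U).
  by move=> s t st; apply/subr0_eq/inj0; rewrite linearB st subrr.
pose inv U t := projT1 (cid (surj U t)).
have invK U t : phi U (inv U t) = t := projT2 (cid (surj U t)).
have inv_lin U : linear (inv U).
  by move=> a s t; apply: inj; rewrite linearP !invK.
have inv_res (U V : opens X) (VU : V `<=` U) s :
    mklin (inv_lin V) (res VU s) = res VU (mklin (inv_lin U) s).
  by apply: inj; rewrite hom_res /= !invK.
exists phi, (SheafHom inv_res) => U; split=> s /=; last exact: invK.
by apply: inj; rewrite invK.
Qed.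

Lemma sheaf_iso_sym (F G : sheaf k X) : sheaf_iso F G -> sheaf_iso G F.
Proof. by move=> [f [g fg]]; exists g, f => U; have [] := fg U. Qed.

Lemma sheaf_iso_trans (F G H : sheaf k X) :
  sheaf_iso F G -> sheaf_iso G H -> sheaf_iso F H.
Proof.
move=> [f [f' ff']] [g [g' gg']].
have lin U : linear (fun s => g U (f U s)) by move=> a s t; rewrite !linearP.
have nat (U V : opens X) (VU : V `<=` U) s :
    mklin (lin V) (res VU s) = res VU (mklin (lin U) s).
  by rewrite /= !hom_res.
apply: (@bijective_hom_iso F H (SheafHom nat)) => U => [s /= E|t].
  have [fK _] := ff' U; have [gK _] := gg' U.
  by rewrite -[s]fK -[f U s]gK E !linear0.
exists (f' U (g' U t)) => /=; have [_ f'K] := ff' U; have [_ g'K] := gg' U.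
by rewrite f'K g'K.
Qed.

(** The inductive step for the final direct sum: the summand split off last gets the index
    [None]. *)
Lemma sheaf_iso_option (F F' L : sheaf k X) (A : finType) (G : option A -> sheaf k X) :
  sheaf_iso F (dsum2 F' (G None)) ->
  sheaf_iso F' (dsum2 L (dsum (fun a => G (Some a)))) ->
  sheaf_iso F (dsum2 L (dsum G)).
Proof.
move=> FF' [f [f' ff']]; apply: (sheaf_iso_trans FF').
pose h U (s : dsum2 F' (G None) U) : dsum2 L (dsum G) U :=
  ((f U s.1).1, fun o => if o is Some a then (f U s.1).2 a else s.2).
have lin U : linear (h U).
  move=> a s t; rewrite /h /= linearP; congr pair.
  by apply: dprodP => -[].
have nat (U V : opens X) (VU : V `<=` U) s :
    mklin (lin V) (res VU s) = res VU (mklin (lin U) s).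
  rewrite /= /h /= hom_res /= /dsum2_res_fun; congr pair.
  by apply: dprodP => -[].
apply: (@bijective_hom_iso _ _ (SheafHom nat)) => U => [[s t] /= E|[s t]].
  have [fK _] := ff' U.
  have E2 := congr1 snd E.
  suff [-> ->] : s = 0 /\ t = 0 by [].
  split; last exact: (congr1 (fun u : dprod (fun o => G o U) => u None) E2).
  rewrite -[s]fK (_ : f U s = 0) ?linear0//.
  rewrite [f U s]surjective_pairing; congr pair; first exact: (congr1 fst E).
  apply: dprodP => a.
  exact: (congr1 (fun u : dprod (fun o => G o U) => u (Some a)) E2).
have [_ f'K] := ff' U.
exists (f' U (s, fun a => t (Some a)), t None); rewrite /= /h /= f'K /=.
by congr pair; apply: dprodP => -[].
Qed.

End SheafIsomorphisms.

Section Germs.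
Context (k : fieldType) (X : topologicalType) (F : sheaf k X).

Lemma germ_inj (U : opens X) (s t : F U) :
  (forall x (Ux : U x), germ Ux s = germ Ux t) -> s = t.
Proof.
move=> st.
have c (x : {x | U x}) : exists W : opens X, exists WU : W `<=` U,
    W (projT1 x) /\ res WU s = res WU t.
  case: x => x Ux /=; have /germ_eqP[W [WU [WU' [Wx E]]]] := st x Ux.
  by exists W, WU; split=> //; rewrite E; congr (res _ _); exact: Prop_irrelevance.
pose W x := projT1 (cid (c x)); pose WU x := projT1 (cid (projT2 (cid (c x)))).
have WE x : W x (projT1 x) /\ res (WU x) s = res (WU x) t :=
  projT2 (cid (projT2 (cid (c x)))).
apply: (@sheaf_separated _ _ F _ W U WU).
  by move=> x Ux; exists (exist _ x Ux) => //; exact: (WE (exist _ x Ux)).1.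
by move=> x; exact: (WE x).2.
Qed.

Lemma glue_germs (U : opens X) (g : forall x, U x -> stalk F x) :
  (forall x, U x -> exists (W : opens X) (s : F W), W x /\
     \forall y \near x, forall (Wy : W y) (Uy : U y), g y Uy = germ Wy s) ->
  exists s : F U, forall x (Ux : U x), germ Ux s = g x Ux.
Proof.
move=> loc.
have c (x : {x | U x}) : exists W : opens X, exists WU : W `<=` U, exists s : F W,
    W (projT1 x) /\ forall y (Wy : W y), germ Wy s = g y (WU y Wy).
  case: x => x Ux /=; have [W [s [Wx near]]] := loc x Ux.
  pose N : opens X := Opens (@open_interior _
    [set y | forall (Wy : W y) (Uy : U y), g y Uy = germ Wy s]).
  pose W' := opensI (opensI U W) N.
  have W'U : W' `<=` U by move=> y [[]].
  have W'W : W' `<=` W by move=> y [[]].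
  exists W', W'U, (res W'W s); split=> //.
  move=> y W'y; rewrite (germ_res W'W (W'W y W'y)).
  by have /interior_subset := W'y.2; move=> /(_ (W'W y W'y) (W'U y W'y)) ->.
pose W x := projT1 (cid (c x)); pose WU x := projT1 (cid (projT2 (cid (c x)))).
pose t x := projT1 (cid (projT2 (cid (projT2 (cid (c x)))))).
have tE x : W x (projT1 x) /\ forall y (Wy : W x y), germ Wy (t x) = g y (WU x y Wy) :=
  projT2 (cid (projT2 (cid (projT2 (cid (c x)))))).
have cov : U `<=` \bigcup_x W x.
  by move=> x Ux; exists (exist _ x Ux) => //; exact: (tE (exist _ x Ux)).1.
have [s sE] : exists s : F U, forall x, res (WU x) s = t x.
  apply: (sheaf_glue WU cov) => x y; apply: germ_inj => z Wz.
  rewrite (germ_res _ Wz.1) (germ_res _ Wz.2) !(tE _).2.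
  by congr g; exact: Prop_irrelevance.
exists s => x Ux; have [y _ Wx] := cov x Ux.
rewrite -(germ_res (WU y) Ux Wx) sE (tE y).2.
by congr g; exact: Prop_irrelevance.
Qed.

Lemma germ_eq0 (U : opens X) x (Ux : U x) (s : F U) : germ Ux s = 0 ->
  \forall y \near x, forall Uy : U y, germ Uy s = 0.
Proof.
rewrite -(germ0 F Ux) => /germ_eqP[W [WU [WU' [Wx E]]]].
have : nbhs x W by apply: open_nbhs_nbhs; split=> //; exact: oset_open.
apply: filterS => y Wy Uy; rewrite -(germ_res WU Uy Wy) E.
by rewrite linear0 germ0.
Qed.

Lemma germ_sum n (a : 'I_n -> k) (U : opens X) x (Ux : U x) (s : 'I_n -> F U) :
  \sum_i a i *: germ Ux (s i) = germ Ux (\sum_i a i *: s i).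
Proof.
have gD u v : germ Ux (u + v) = germ Ux u + germ Ux v.
  by have := germ_linear Ux 1 u v; rewrite !scale1r.
have gZ b u : germ Ux (b *: u) = b *: germ Ux u.
  by have := germ_linear Ux b u 0; rewrite !addr0 germ0 addr0.
elim/big_ind2: _ => [|u u' v v' -> ->|i _]; [by rewrite germ0|by rewrite gD|].
by rewrite gZ.
Qed.

End Germs.

(** * Bases and coordinates for constant restrictions *)

Section ConstantRestriction.
Context (k : fieldType) (X : topologicalType) (F : sheaf k X).

(** The coefficients of a section in the basis are locally constant: the combination that equals its
    germ at y equals it near y, where freeness determines the coefficients. *)
Lemma constant_of_basis (U : opens X) n (s : 'I_n -> F U) :
  (forall x (Ux : U x) (g : stalk F x), exists a, g = \sum_i a i *: germ Ux (s i)) ->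
  (forall x (Ux : U x) a, \sum_i a i *: germ Ux (s i) = 0 -> forall i, a i = 0) ->
  constant_of_finite_rank (sheaf_restrict U F).
Proof.
move=> gen free; exists n; apply: sheaf_iso_sym.
pose K := sheaf_power (constant_sheaf k (set_type U)) n.
have Uin (y : set_type U) : U (subset_incl U y) by exact: set_valP.
pose f (V : opens (set_type U)) (c : K V) :
    family_sheaf (fun y : set_type U => stalk F (subset_incl U y) : lmodType k) V :=
  fun y Vy => (\sum_i (subsec_val (c i) y Vy : k) *: germ (Uin y) (s i) : stalk F (subset_incl U y)).
have f_ind V c : locally_induced (f V c).
  move=> y Vy.
  exists (U : opens X), (\sum_i subsec_val (c i) y Vy *: s i); split; first exact: Uin.
  have H : \forall z \near y, forall i (Vz : V z), subsec_val (c i) z Vz = subsec_val (c i) y Vy.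
    apply: (@filter_forall _ _ _ _ (nbhs_filter y)) => i; exact: (subsecP (c i)).
  apply: filterS H => z zE Vz Wz; rewrite -germ_sum /f; apply: eq_bigr => i _.
  by rewrite zE; congr (_ *: _); exact: germ_irr.
pose h V c : sheaf_restrict U F V := Subsec (asboolT (f_ind V c)
  : f V c \in subsec_pred (locally_induced_property _ _) V).
have lin V : linear (h V).
  move=> a c d; apply: val_inj; apply: dprodP => y; apply: dprodP => Vy.
  rewrite /= /f !dprodDE !dprodZE /= /f scaler_sumr -big_split /=.
  by apply: eq_bigr => i _; rewrite scalerA -scalerDl.
have nat (V W : opens (set_type U)) (WV : W `<=` V) c :
    mklin (lin W) (res WV c) = res WV (mklin (lin V) c).
  by apply: val_inj.
apply: (@bijective_hom_iso _ _ K (sheaf_restrict U F) (SheafHom nat)) => V => [c E|t].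
  apply: dprodP => i; apply: val_inj; apply: dprodP => y; apply: dprodP => Vy.
  apply: (free _ (Uin y) (fun i => subsec_val (c i) y Vy : k) _ i).
  exact: (congr1 (fun u : sheaf_restrict U F V => subsec_val u y Vy) E).
have c y (Vy : V y) : exists a : 'I_n -> k,
    subsec_val t y Vy = \sum_i a i *: germ (Uin y) (s i) by exact: gen.
pose a y Vy := projT1 (cid (c y Vy)).
have aE y Vy : subsec_val t y Vy = \sum_i a y Vy i *: germ (Uin y) (s i) :=
  projT2 (cid (c y Vy)).
have a_lc i : locally_constant_fun
    ((fun y Vy => a y Vy i) : family_sheaf (fun _ : set_type U => k^o : lmodType k) V).
  move=> y Vy; have [W [w [Wy near]]] := subsecP t y Vy.
  have : germ (conj Wy (Uin y) : opensI W U (subset_incl U y))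
      (res (@opensIl _ W U) w - \sum_i a y Vy i *: res (@opensIr _ W U) (s i)) = 0.
    rewrite -[LHS]/(germ _ _) addrC -scaleN1r germ_linear (germ_res _ Wy) -germ_sum.
    rewrite -(nbhs_singleton near Vy Wy) aE scaleN1r addrC; apply/eqP; rewrite subr_eq0; apply/eqP.
    by apply: eq_bigr => j _; rewrite (germ_res _ (Uin y)).
  move=> /germ_eq0/(@cts_fun _ _ (subset_incl U))-E.
  have WU : \forall z \near y, opensI W U (subset_incl U z).
    have : nbhs (subset_incl U y) (opensI W U).
      by apply: open_nbhs_nbhs; split; [exact: oset_open|split].
    exact: (@cts_fun _ _ (subset_incl U)).
  have E' : \forall z \near y, forall WUz : opensI W U (subset_incl U z), germ WUz
      (res (@opensIl _ W U) w - \sum_i a y Vy i *: res (@opensIr _ W U) (s i)) = 0.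
    exact: E.
  apply: (@filterS3 _ _ (nbhs_filter y) _ _ _ _ _ E' near WU) => z zE zW WUz Vz.
  apply/subr0_eq.
  apply: (free _ (Uin z) (fun i => a z Vz i - a y Vy i)).
  under eq_bigr do rewrite scalerBl; rewrite sumrB -aE (zW Vz WUz.1).
  rewrite -[RHS](zE WUz) [in RHS]addrC -scaleN1r germ_linear (germ_res _ WUz.1).
  rewrite -germ_sum scaleN1r addrC; congr (_ - _).
  by apply: eq_bigr => j _; rewrite (germ_res _ (Uin z)).
exists (fun i => Subsec (asboolT (a_lc i)
  : (fun y Vy => a y Vy i) \in subsec_pred (locally_constant_property _ _) V)).
by apply: val_inj; apply: dprodP => y; apply: dprodP => Vy; rewrite /= /f /= aE.
Qed.

(** A point of S has the same stalk for F and for its restriction to S. So a germ is evaluated by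
    representing it, restricting to S and applying the given isomorphism; the inverse isomorphism
    yields injectivity and surjectivity. *)
Lemma constant_coordinates (S : set X) :
  constant_of_finite_rank (sheaf_restrict S F) ->
  exists n (kap : forall x, stalk F x -> 'rV[k]_n),
  [/\ forall x, S x -> linear (kap x),
      forall x, S x -> injective (kap x),
      forall x, S x -> forall v, exists g, kap x g = v
    & forall (U : opens X) (s : F U) x (Ux : U x), S x ->
        \forall y \near x, S y -> forall Uy : U y, kap y (germ Uy s) = kap x (germ Ux s)].
Proof.
move=> [n [phi [psi phiK]]]; exists n.
pose j := subset_incl S.
pose fs (U : opens X) (s : F U) :
    family_sheaf (fun y : set_type S => stalk F (j y) : lmodType k) (opens_preim j U) :=
  fun y Uy => germ (Uy : U (j y)) s.
have fs_ind U s : locally_induced (fs U s).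
  by move=> y Uy; exists U, s; split=> //; apply: (@filterE _ _ (nbhs_filter y)) => z Vz Wz; exact: germ_irr.
pose sg U s : sheaf_restrict S F (opens_preim j U) := Subsec (asboolT (fs_ind U s)
  : fs U s \in subsec_pred (locally_induced_property _ _) (opens_preim j U)).
have sg_lin U : linear (sg U).
  move=> a s t; apply: val_inj; apply: dprodP => y; apply: dprodP => Vy.
  exact: germ_linear.
have sg_res (U V : opens X) (VU : V `<=` U) s : sg V (res VU s) = res (opens_preimS VU) (sg U s).
  apply: val_inj; apply: dprodP => y; apply: dprodP => Vy.
  rewrite /= /fam_res_fun /fs; exact: germ_res.
pose ev (U : opens X) (s : F U) (y : set_type S) (Uy : U (j y)) : 'rV[k]_n :=
  \row_i (subsec_val (phi _ (sg U s) i) y Uy : k).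
have ev_res (U V : opens X) (VU : V `<=` U) s y (Vy : V (j y)) :
    ev V (res VU s) y Vy = ev U s y (VU _ Vy).
  apply/rowP => i; rewrite !mxE sg_res hom_res /= /dsum_res_fun /= /fam_res_fun.
  f_equal; exact: Prop_irrelevance.
have ev_irr (U : opens X) (s : F U) y (Uy Uy' : U (j y)) : ev U s y Uy = ev U s y Uy'.
  by congr ev; exact: Prop_irrelevance.
have ev_germ (U V : opens X) (s : F U) (t : F V) y (Uy : U (j y)) (Vy : V (j y)) :
    germ Uy s = germ Vy t -> ev U s y Uy = ev V t y Vy.
  move=> /germ_eqP[W [WU [WV [Wy E]]]].
  by rewrite (ev_irr _ _ _ Uy (WU _ Wy)) (ev_irr _ _ _ Vy (WV _ Wy)) -!ev_res E.
have ev_lin (U : opens X) y (Uy : U (j y)) : linear (fun s : F U => ev U s y Uy).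
  by move=> a s t; apply/rowP => i; rewrite !mxE sg_lin linearP.
(* Locally constant coordinates that vanish at y vanish on a neighbourhood of y in S; there the
   isomorphism sends the section to 0, so the section is 0. *)
have ev_eq0 (U : opens X) (s : F U) y (Uy : U (j y)) : ev U s y Uy = 0 -> germ Uy s = 0.
  move=> E0.
  have : \forall z \near y, forall i (Uz : U (j z)), subsec_val (phi _ (sg U s) i) z Uz = 0.
    apply: (@filter_forall _ _ _ _ (nbhs_filter y)) => i.
    apply: filterS (subsecP (phi _ (sg U s) i) y Uy) => z E Uz; rewrite (E Uz).
    by have /rowP/(_ i) := E0; rewrite !mxE.
  move=> near.
  pose N : opens (set_type S) := opensI (opens_preim j U) (Opens (@open_interior _
    [set z | forall i (Uz : U (j z)), subsec_val (phi _ (sg U s) i) z Uz = 0])).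
  have NU : N `<=` opens_preim j U by move=> z [].
  have Ny : N y by split.
  have phi0 : phi N (res NU (sg U s)) = 0.
    apply: dprodP => i; apply: val_inj; apply: dprodP => z; apply: dprodP => Nz.
    rewrite hom_res; have /interior_subset := Nz.2; exact.
  have [phiK' _] := phiK N.
  have := phiK' (res NU (sg U s)); rewrite phi0 linear0 => /esym E.
  have := congr1 (fun u : sheaf_restrict S F N => subsec_val u y Ny) E.
  by move=> H; apply: etrans H; exact: germ_irr.
(* The constant section v comes from a section of the restriction, which near y is induced by a
   section of F. *)
have ev_surj (y : set_type S) v : exists (U : opens X) (Uy : U (j y)) (s : F U), ev U s y Uy = v.
  pose cst i : family_sheaf (fun _ : set_type S => k^o : lmodType k) opensT :=
    fun _ _ => v 0 i.
  have cst_lc i : locally_constant_fun (cst i) by move=> z Tz; apply: (@filterE _ _ (nbhs_filter z)).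
  pose c : sheaf_power (constant_sheaf k (set_type S)) n opensT :=
    fun i => Subsec (asboolT (cst_lc i)
      : cst i \in subsec_pred (locally_constant_property _ _) opensT).
  have [W [w [Wy near]]] := subsecP (psi _ c) y I.
  pose N : opens (set_type S) := opensI (opens_preim j W) (Opens (@open_interior _
    [set z | forall (Vz : opensT z) (Wz : W (j z)), subsec_val (psi opensT c) z Vz = germ Wz w])).
  have NW : N `<=` opens_preim j W by move=> z [].
  have NT : N `<=` @opensT (set_type S) by [].
  have Ny : N y by split.
  exists W, Wy, w.
  have E : res NW (sg W w) = res NT (psi opensT c).
    apply: val_inj; apply: dprodP => z; apply: dprodP => Nz.
    have /interior_subset/(_ I (NW z Nz)) H := Nz.2.
    by apply: esym; apply: etrans H; rewrite /= /fam_res_fun; f_equal; exact: Prop_irrelevance.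
  have := congr1 (phi N) E; rewrite !hom_res.
  have [_ psiK] := phiK opensT; rewrite psiK => E'.
  apply/rowP => i; rewrite mxE.
  have := congr1 (fun u : sheaf_power (constant_sheaf k (set_type S)) n N =>
    subsec_val (u i) y Ny) E'.
  rewrite /= /dsum_res_fun /= /fam_res_fun /= => H; apply: etrans H.
  by f_equal; exact: Prop_irrelevance.
pose el x (Sx : S x) : set_type S := exist _ x (mem_set Sx).
pose kap x (g : stalk F x) : 'rV[k]_n :=
  match pselect (S x) with
  | left Sx => ev (pg_open (repr g)) (pg_sec (repr g)) (el x Sx) (pg_in (repr g))
  | right _ => 0
  end.
have kapE (U : opens X) (s : F U) x (Ux : U x) (Sx : S x) :
    kap x (germ Ux s) = ev U s (el x Sx) Ux.
  rewrite /kap; case: pselect => // Sx'; rewrite (Prop_irrelevance Sx' Sx).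
  by apply: ev_germ; rewrite /j; exact: germ_repr.
exists kap; split.
- move=> x Sx a g h; have [U [Ux [s [t [-> ->]]]]] := stalk2P g h.
  by rewrite -germ_linear !(kapE _ _ _ _ Sx) ev_lin.
- move=> x Sx g h; have [U [Ux [s [t [-> ->]]]]] := stalk2P g h.
  rewrite !(kapE _ _ _ _ Sx) => E.
  have : germ Ux (- 1 *: t + s) = 0.
    by apply: (@ev_eq0 U _ (el x Sx) Ux); rewrite (ev_lin U (el x Sx) Ux) E scaleN1r addNr.
  by rewrite germ_linear scaleN1r addrC => /subr0_eq.
- move=> x Sx v; have [U [Ux [s E]]] := ev_surj (el x Sx) v.
  by exists (germ (Ux : U x) s); rewrite (kapE _ _ _ _ Sx).
- move=> U s x Ux Sx.
  have : \forall z \near el x Sx, forall i (Uz : U (j z)),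
      subsec_val (phi _ (sg U s) i) z Uz = subsec_val (phi _ (sg U s) i) (el x Sx) Ux.
    by apply: (@filter_forall _ _ _ _ (nbhs_filter (el x Sx))) => i; exact: (subsecP (phi _ (sg U s) i)).
  move=> [B [[Q oQ QB] Bx] BE].
  have : nbhs x Q.
    by apply: open_nbhs_nbhs; split=> //; move: Bx; rewrite -QB.
  apply: filterS => y Qy Sy Uy; rewrite !(kapE _ _ _ _ Sx, kapE _ _ _ _ Sy).
  have By : B (el y Sy) by rewrite -QB.
  by apply/rowP => i; rewrite !mxE; exact: (BE (el y Sy) By).
Qed.

End ConstantRestriction.

(** * The quotient map *)

Notation turn m := (m%:~R * (2 * pi)).

Lemma near_all (T : topologicalType) (t : T) (P : T -> Prop) :
  (forall s, P s) -> \forall s \near t, P s.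
Proof. by move=> PT; apply: (@filterE _ _ (nbhs_filter t)). Qed.

Section CircleMap.
Context (R : realType).
Implicit Types (s t : R) (m : int).

Lemma turnD m m' : turn (m + m') = turn m + turn m' :> R.
Proof. by rewrite intrD mulrDl. Qed.

Lemma turnN m : turn (- m) = - turn m :> R.
Proof. by rewrite intrN mulNr. Qed.

Lemma turn0 : turn 0 = 0 :> R.
Proof. by rewrite mul0r. Qed.

Lemma turn1_gt0 : 0 < 2 * pi :> R.
Proof. by rewrite mulr_gt0 ?pi_gt0. Qed.

Lemma turn_ge m : 0 < m -> 2 * pi <= turn m :> R.
Proof.
by move=> m0; rewrite -[leLHS]mul1r ler_pM2r ?turn1_gt0// -[1]/(1%:~R) ler_int gtz0_ge1 in m0 *.
Qed.

Lemma turn_le m : m < 0 -> turn m <= - (2 * pi) :> R.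
Proof. by move=> m0; rewrite lerNr -turnN turn_ge// oppr_gt0. Qed.

Lemma circle_map_eqP s t :
  circle_map s = circle_map t <-> exists m, s = t + turn m.
Proof. by split=> [/eqmodP/asboolP|H] //; apply/eqmodP/asboolP. Qed.

Lemma circle_mapD t m : circle_map (t + turn m) = circle_map t.
Proof. by apply/circle_map_eqP; exists m. Qed.

Lemma circle_map_surj (x : circle R) : exists t, circle_map t = x.
Proof. by exists (repr x); exact: reprK. Qed.

Lemma near_translate (P : R -> Prop) t c :
  (\forall s \near t + c, P s) <-> (\forall s \near t, P (s + c)).
Proof.
have H a b (Q : R -> Prop) : (\forall s \near a + b, Q s) -> \forall s \near a, Q (s + b).
  move=> near; have : (fun s : R => s + b) @ a --> a + b.
    by apply: cvgD; [exact: cvg_id|exact: cvg_cst].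
  by move=> /(_ _ near).
split; first exact: H.
move=> near; have := H (t + c) (- c) (fun s => P (s + c)).
rewrite addrK => /(_ near); apply: filterS => s.
by rewrite subrK.
Qed.

(** The quotient map is open, since the preimage of the image of an open set is a union of its
    translates. Every local question on the circle is moved to the line through this. *)
Lemma near_circle_map (P : circle R -> Prop) t :
  (\forall x \near circle_map t, P x) <-> (\forall s \near t, P (circle_map s)).
Proof.
split; first exact: (@cts_fun _ _ circle_map).
move=> near.
pose O : set R := interior [set s | P (circle_map s)].
pose W : set (circle R) := circle_map @` O.
apply: (filterS (P := W)).
  by move=> _ [s /interior_subset Ps <-].
apply: open_nbhs_nbhs; split; last by exists t.
suff : open (circle_map @^-1` W) by [].
rewrite openE => s /= [s' Os' /esym/circle_map_eqP[m sE]].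
rewrite /interior; subst s.
have : nbhs s' O by apply: open_nbhs_nbhs; split=> //; exact: open_interior.
move=> H; apply/near_translate; apply: filterS H => r Or.
by exists r => //; rewrite circle_mapD.
Qed.

(** A level set of f is open and closed in a connected interval. *)
Lemma locally_constant_interval (T : Type) (f : R -> T) a b :
  (forall s, a < s < b -> \forall r \near s, f r = f s) ->
  forall s t, a < s < b -> a < t < b -> f s = f t.
Proof.
move=> lc s t sab tab.
have loc (P : T -> Prop) : open [set r | a < r < b /\ P (f r)].
  rewrite openE => r [rab Pr]; rewrite /interior.
  have : \forall q \near r, q \in `]a, b[ by apply: near_in_itvoo; rewrite in_itv.
  by apply: filterS2 (lc r rab) => q fq; rewrite in_itv /= fq.
have cI : connected [set` `]a, b[] by apply/connected_intervalP; exact: interval_is_interval.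
have /seteqP[_ /(_ t)] : [set r | a < r < b /\ f r = f s] = [set` `]a, b[].
  apply: cI; first by exists s.
  - exists [set r | a < r < b /\ f r = f s]; first exact: (loc (fun y => y = f s)).
    by apply/seteqP; split=> [r [rab fr]|r []] //; split=> //=; rewrite in_itv.
  - exists (~` [set r | a < r < b /\ f r <> f s]).
      by apply: open_closedC; exact: (loc (fun y => y <> f s)).
    apply/seteqP; split=> [r [rab fr]|r [/=]].
      by split=> /=; [rewrite in_itv|move=> []].
    rewrite in_itv /= => rab fr; split=> //; apply: contrapT => fr'.
    exact: fr.
by rewrite /= in_itv => /(_ tab)[_ ->].
Qed.

End CircleMap.

(** * Sheaves of functions on the circle *)

(* A sheaf of functions with values in k^D on the circle, given through its
   pull-back to the line: [adm M t f] says that [f] is a section near [t].  By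
   [adm_eq0] a germ of section is determined by its value. *)
Record function_sheaf (R : realType) (k : fieldType) D := FunctionSheaf {
  adm :> R -> (R -> 'rV[k]_D) -> Prop;
  adm0 : forall t, adm t (fun=> 0);
  adm_linear : forall t a f g, adm t f -> adm t g -> adm t (fun s => a *: f s + g s);
  adm_near : forall t f g, adm t f -> (\forall s \near t, f s = g s) -> adm t g;
  adm_open : forall t f, adm t f -> \forall s \near t, adm s f;
  adm_eq0 : forall t f, adm t f -> f t = 0 -> \forall s \near t, f s = 0;
  adm_turn : forall t (m : int) f, adm (t + turn m) f -> adm t (fun s => f (s + turn m))
}.

Section FunctionSheaf.
Context (R : realType) (k : fieldType) (D : nat).

(** Extending by 0 outside U turns sections into ordinary functions, free of membership proofs. *)
Definition total_fun (U : opens (circle R))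
    (f : family_sheaf (fun _ : circle R => 'rV[k]_D : lmodType k) U) (x : circle R) : 'rV[k]_D :=
  if pselect (U x) is left Ux then f x Ux else 0.

Lemma total_funE (U : opens (circle R)) f x (Ux : U x) : @total_fun U f x = f x Ux.
Proof. by rewrite /total_fun; case: pselect => // Ux'; rewrite (Prop_irrelevance Ux' Ux). Qed.

Lemma total_fun_linear (U : opens (circle R)) a f g :
  @total_fun U (a *: f + g) = (fun x => a *: total_fun f x + total_fun g x).
Proof.
by apply: funext => x; rewrite /total_fun; case: pselect => //; rewrite scaler0 addr0.
Qed.

Lemma near_opens (U : opens (circle R)) t : U (circle_map t) ->
  \forall s \near t, U (circle_map s).
Proof.
move=> Ut; apply/near_circle_map; apply: open_nbhs_nbhs; split=> //.
exact: oset_open.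
Qed.

Section SheafOf.
Context (M : function_sheaf R k D).

Lemma admB t f g : M t f -> M t g -> M t (fun s => f s - g s).
Proof.
move=> Mf Mg; apply: adm_near (adm_linear (-1) Mg Mf) _.
by apply: near_all => s; rewrite scaleN1r addrC.
Qed.

Lemma admZ t a f : M t f -> M t (fun s => a *: f s).
Proof.
move=> Mf; apply: adm_near (adm_linear a Mf (adm0 M t)) _.
by apply: near_all => s; rewrite addr0.
Qed.

Lemma adm_sum t I (r : seq I) (f : I -> R -> 'rV[k]_D) :
  (forall i, M t (f i)) -> M t (fun s => \sum_(i <- r) f i s).
Proof.
move=> Mf; elim: r => [|i r IH].
  by apply: adm_near (adm0 M t) _; apply: near_all => s; rewrite big_nil.
apply: adm_near (adm_linear 1 (Mf i) IH) _.
by apply: near_all => s; rewrite big_cons scale1r.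
Qed.

Lemma adm_eq t f g : M t f -> M t g -> f t = g t -> \forall s \near t, f s = g s.
Proof.
move=> Mf Mg fg; apply: filterS (adm_eq0 (admB Mf Mg) _); last by rewrite fg subrr.
by move=> s /subr0_eq.
Qed.

Lemma adm_turnN t m f : M t (fun s => f (s + turn m)) -> M (t + turn m) f.
Proof.
move=> Mf; have := @adm_turn _ _ _ M (t + turn m) (- m) (fun s => f (s + turn m)).
rewrite turnN addrK => /(_ Mf) H; apply: adm_near H _.
by apply: near_all => s; rewrite subrK.
Qed.

Definition admissible (U : opens (circle R))
    (f : family_sheaf (fun _ : circle R => 'rV[k]_D : lmodType k) U) :=
  forall t, U (circle_map t) -> M t (fun s => total_fun f (circle_map s)).

Definition admissible_property :
  local_property (family_sheaf (fun _ : circle R => 'rV[k]_D : lmodType k)).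
Proof.
apply: (@LocalProperty _ _ _ admissible).
- move=> U t Ut; apply: adm_near (adm0 M t) _; apply: near_all => s.
  by rewrite /total_fun; case: pselect.
- by move=> U a f g Mf Mg t Ut; rewrite total_fun_linear; apply: adm_linear; [exact: Mf|exact: Mg].
- move=> U V VU f Mf t Vt; apply: adm_near (Mf t (VU _ Vt)) _.
  apply: filterS (near_opens Vt) => s Vs.
  by rewrite (total_funE _ Vs) (total_funE _ (VU _ Vs)).
- move=> I U W UW WU f Mf t Wt; have [i _ Uit] := WU _ Wt.
  apply: adm_near (Mf i t Uit) _; apply: filterS (near_opens Uit) => s Us.
  by rewrite (total_funE _ Us) (total_funE _ (UW i _ Us)).
Defined.

Definition sheaf_of : sheaf k (circle R) := subsheaf admissible_property.

Definition sec_fun (U : opens (circle R)) (s : sheaf_of U) : circle R -> 'rV[k]_D :=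
  total_fun (subsec_val s).

Lemma sec_fun_linear U a (s t : sheaf_of U) x :
  sec_fun (a *: s + t) x = a *: sec_fun s x + sec_fun t x.
Proof. by rewrite /sec_fun /= total_fun_linear. Qed.

Lemma sec_fun_res (U V : opens (circle R)) (VU : V `<=` U) (s : sheaf_of U) x :
  V x -> sec_fun (res VU s) x = sec_fun s x.
Proof. by move=> Vx; rewrite /sec_fun (total_funE _ Vx) (total_funE _ (VU _ Vx)). Qed.

Lemma sec_fun_inj (U : opens (circle R)) (s t : sheaf_of U) :
  (forall x, U x -> sec_fun s x = sec_fun t x) -> s = t.
Proof.
move=> st; apply: val_inj; apply: dprodP => x; apply: dprodP => Ux.
by have := st x Ux; rewrite /sec_fun !(total_funE _ Ux).
Qed.

Lemma sec_fun_adm (U : opens (circle R)) (s : sheaf_of U) t :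
  U (circle_map t) -> M t (fun r => sec_fun s (circle_map r)).
Proof. exact: (subsecP s). Qed.

Lemma sec_fun0 (U : opens (circle R)) x : sec_fun (0 : sheaf_of U) x = 0.
Proof. by rewrite /sec_fun /= /total_fun; case: pselect. Qed.

Lemma sec_fun_exists (U : opens (circle R)) (f : circle R -> 'rV[k]_D) :
  (forall t, U (circle_map t) -> M t (f \o circle_map)) ->
  exists s : sheaf_of U, forall x, U x -> sec_fun s x = f x.
Proof.
move=> Mf.
pose g : family_sheaf (fun _ : circle R => 'rV[k]_D : lmodType k) U := fun x _ => f x.
have Mg : admissible g.
  move=> t Ut; apply: adm_near (Mf t Ut) _; apply: filterS (near_opens Ut) => s Us.
  by rewrite (total_funE _ Us).
exists (Subsec (asboolT Mg : g \in subsec_pred admissible_property U)) => x Ux.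
by rewrite /sec_fun (total_funE _ Ux).
Qed.

Lemma germ_sec_fun (U V : opens (circle R)) x (Ux : U x) (Vx : V x)
    (s : sheaf_of U) (t : sheaf_of V) :
  sec_fun s x = sec_fun t x -> germ Ux s = germ Vx t.
Proof.
move=> st; have [r rx] := circle_map_surj x; subst x.
have := adm_eq (sec_fun_adm s Ux) (sec_fun_adm t Vx) st.
move=> /(proj2 (near_circle_map (fun x => sec_fun s x = sec_fun t x) r)) near.
pose W : opens (circle R) := opensI (opensI U V)
  (Opens (@open_interior _ [set x | sec_fun s x = sec_fun t x])).
have WU : W `<=` U by move=> x [[]].
have WV : W `<=` V by move=> x [[]].
apply/germ_eqP; exists W, WU, WV; split=> //.
apply: sec_fun_inj => x Wx; rewrite !sec_fun_res//.
by have /interior_subset := Wx.2.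
Qed.

End SheafOf.
End FunctionSheaf.

Lemma subsec_val_linear (k : fieldType) (X : topologicalType) (F : sheaf k X)
    (P : local_property F) (U : opens X) a (s t : subsec P U) :
  subsec_val (a *: s + t) = a *: subsec_val s + subsec_val t.
Proof. by []. Qed.

Lemma subsec_val_res (k : fieldType) (X : topologicalType) (F : sheaf k X)
    (P : local_property F) (U V : opens X) (VU : V `<=` U) (s : subsheaf P U) :
  subsec_val (res VU s) = res VU (subsec_val s).
Proof. by []. Qed.

Lemma direct_image_res (k : fieldType) (X Y : topologicalType) (f : continuousType X Y)
    (G : sheaf k X) (U V : opens Y) (VU : V `<=` U) (s : direct_image f G U) :
  res VU s = res (opens_preimS VU) (s : G (opens_preim f U)).
Proof. by []. Qed.

Lemma family_res (k : fieldType) (X : topologicalType) (E : X -> lmodType k)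
    (U V : opens X) (VU : V `<=` U) (s : family_sheaf E U) x (Ux : U x) (Vx : V x) :
  res VU s x Vx = s x Ux.
Proof. by rewrite /= /fam_res_fun (Prop_irrelevance (VU x Vx) Ux). Qed.

(** * Sections of k_I as functions on the line *)

Section LineSheaf.
Context (R : realType) (k : fieldType) (I : set R).

Let el r (Ir : I r) : set_type I := exist _ r (mem_set Ir).

Definition line_fun (V : opens R) (s : constant_on k I V) (r : R) : k :=
  match pselect (I r), pselect (V r) with
  | left Ir, left Vr => subsec_val (subsec_val s) (el Ir) Vr
  | _, _ => 0
  end.

Lemma line_funE (V : opens R) (s : constant_on k I V) r (Ir : I r) (Vr : V r) :
  line_fun s r = subsec_val (subsec_val s) (el Ir) Vr.
Proof.
rewrite /line_fun; case: pselect => // Ir'; case: pselect => // Vr'.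
by rewrite (Prop_irrelevance Ir' Ir) (Prop_irrelevance Vr' Vr).
Qed.

Lemma line_fun_off (V : opens R) (s : constant_on k I V) r :
  ~ (I r /\ V r) -> line_fun s r = 0.
Proof.
by rewrite /line_fun; case: pselect => // Ir; case: pselect => // Ur [].
Qed.

Lemma line_fun_linear (V : opens R) a (s t : constant_on k I V) r :
  line_fun (a *: s + t) r = a * line_fun s r + line_fun t r.
Proof.
have [[Ir Ur]|N] := pselect (I r /\ V r).
  rewrite (line_funE _ Ir Ur) (line_funE s Ir Ur) (line_funE t Ir Ur).
  by rewrite (subsec_val_linear a s t) (subsec_val_linear a (subsec_val s)).
by rewrite (line_fun_off _ N) (line_fun_off s N) (line_fun_off t N) mulr0 addr0.
Qed.

Lemma line_fun_res (V W : opens R) (WV : W `<=` V) (s : constant_on k I V) r :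
  W r -> line_fun (res WV s) r = line_fun s r.
Proof.
move=> Wr; have [Ir|NI] := pselect (I r); last first.
  have NW : ~ (I r /\ W r) by case.
  have NV : ~ (I r /\ V r) by case.
  by rewrite (line_fun_off s NV) (line_fun_off (res WV s) NW).
rewrite (line_funE (res WV s) Ir Wr) (line_funE s Ir (WV _ Wr)).
rewrite (subsec_val_res WV s) (direct_image_res WV (subsec_val s)).
rewrite (subsec_val_res (opens_preimS WV) (subsec_val s)).
exact: (@family_res k _ (fun _ : set_type I => k^o : lmodType k) _ _ (opens_preimS WV)
  (subsec_val (subsec_val s)) (el Ir)).
Qed.

Lemma line_fun_inj (V : opens R) (s t : constant_on k I V) :
  (forall r, line_fun s r = line_fun t r) -> s = t.
Proof.
move=> st; apply: val_inj; apply: val_inj; apply: dprodP => -[r Ir'].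
have Ir := set_mem Ir'; rewrite (Prop_irrelevance Ir' (mem_set Ir)).
by apply: dprodP => Vr; have := st r; rewrite (line_funE s Ir Vr) (line_funE t Ir Vr).
Qed.

Lemma near_set_type (P : set_type I -> Prop) r (Ir : I r) :
  (\forall y \near el Ir, P y) ->
  \forall q \near r, forall Iq : I q, P (el Iq).
Proof.
move=> [B [[Q oQ QB] Br] BP].
have : nbhs r Q by apply: open_nbhs_nbhs; split=> //; move: Br; rewrite -QB.
apply: filterS => q Qq Iq; apply: BP.
by rewrite -QB.
Qed.

Lemma set_type_near (P : set_type I -> Prop) r (Ir : I r) :
  (\forall q \near r, forall Iq : I q, P (el Iq)) ->
  \forall y \near el Ir, P y.
Proof.
move=> near.
have E : nbhs (el Ir) (fun y => forall Iq : I (subset_incl I y), P (el Iq)).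
  by move: near; exact: (@cts_fun _ _ (subset_incl I) (el Ir)).
apply: (@filterS _ _ (nbhs_filter (el Ir)) _ _ _ E) => -[q Iq'] /=.
by move=> /(_ (set_mem Iq')); rewrite /el (Prop_irrelevance (mem_set _) Iq').
Qed.

Lemma near_open_set (V : opens R) t : V t -> \forall r \near t, V r.
Proof. by move=> Vt; apply: open_nbhs_nbhs; split=> //; exact: oset_open. Qed.

(** At a point of I this is local constancy. At a point of V outside I it says that the section
    vanishes near that point, which is the closedness of its support. Together with the converse
    [line_fun_exists] it describes k_I by functions alone. *)
Lemma line_fun_near (V : opens R) (s : constant_on k I V) t : V t ->
  \forall r \near t, I r -> line_fun s r = line_fun s t.
Proof.
move=> Vt.
have [It|NI] := pselect (I t).
  have := subsecP (subsec_val s) (el It) Vt.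
  move=> /near_set_type H; apply: filterS2 H (near_open_set Vt) => r rE Vr Ir.
  by rewrite (line_funE s Ir Vr) (line_funE s It Vt); exact: rE.
have -> : line_fun s t = 0 by apply: line_fun_off; case.
have : nbhs t (V `\` sec_support (subsec_val s)).
  apply: open_nbhs_nbhs; split; first exact: (subsecP s).
  by split=> // -[[y Iy] [Vy [/= yt _]]]; apply: NI; rewrite -yt; exact: set_mem.
apply: filterS => r [Vr rN] Ir; rewrite (line_funE s Ir Vr).
have /germ_eqP[W [WU [WT [Wr E]]]] :
    germ (Vr : opens_preim (subset_incl I) V (el Ir))
      (subsec_val s : constant_sheaf k _ _) = germ (Logic.I : opensT (el Ir)) 0.
  by rewrite germ0; apply: contrapT => N; apply: rN; exists (el Ir), Vr.
have := congr1 (fun u : constant_sheaf k (set_type I) W => subsec_val u (el Ir) Wr) E.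
by move=> H; apply: etrans H; rewrite /= /fam_res_fun; f_equal; exact: Prop_irrelevance.
Qed.

Lemma line_fun_exists (V : opens R) (c : R -> k) :
  (forall r, ~ I r -> c r = 0) ->
  (forall t, V t -> \forall r \near t, I r -> c r = c t) ->
  exists s : constant_on k I V, forall r, V r -> line_fun s r = c r.
Proof.
move=> c0 clc.
pose V' := opens_preim (subset_incl I) V.
pose f : family_sheaf (fun _ : set_type I => k^o : lmodType k) V' :=
  fun y _ => c (subset_incl I y).
have f_lc : locally_constant_fun f.
  move=> -[r Ir'] /= Vr; have Ir := set_mem Ir'; rewrite (Prop_irrelevance Ir' (mem_set Ir)).
  apply: (@set_type_near (fun y => forall Vy : V' y, f y Vy = f (el Ir) Vr) r Ir).
  by apply: filterS (clc r Vr) => q cq Iq Vq; exact: cq.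
pose s1 : direct_image (subset_incl I) (constant_sheaf k (set_type I)) V :=
  Subsec (asboolT f_lc : f \in subsec_pred (locally_constant_property _ _) V').
(* Off the support [c t] is 0, so by [clc] the function vanishes on I near t, and so do the germs of
   the section there. *)
have s1_cs : closed_support s1.
  rewrite /closed_support openE => t [Vt tN]; rewrite /interior.
  have ct : c t = 0.
    have [It|/c0//] := pselect (I t).
    apply: contrapT => cN; apply: tN; exists (el It), Vt; split=> //.
    rewrite -(germ0 _ (Logic.I : opensT (el It))) => /germ_eqP[W [WU [WT [Wr E]]]].
    apply: cN.
    exact: (congr1 (fun u : constant_sheaf k (set_type I) W => subsec_val u (el It) Wr) E).
  have near : \forall r \near t, V r /\ (I r -> c r = 0).
    by apply: filterS2 (near_open_set Vt) (clc t Vt) => r Vr; rewrite ct.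
  have near2 : \forall r \near t, \forall q \near r, V q /\ (I q -> c q = 0).
    exact: nbhs_interior near.
  apply: filterS near2 => r rN; have [Vr _] := nbhs_singleton rN.
  split=> // -[[y Iy'] [Vy [/= yr]]]; apply.
  subst r; have Iy := set_mem Iy'; rewrite (Prop_irrelevance Iy' (mem_set Iy)) in Vy *.
  have : \forall z \near el Iy, forall Vz : V' z, f z Vz = 0.
    apply: (@set_type_near (fun z => forall Vz : V' z, f z Vz = 0) y Iy).
    by apply: filterS rN => q [_ cq] Iq Vq; exact: cq.
  move=> nz; pose W : opens (set_type I) := opensI V' (Opens (@open_interior _
    [set z | forall Vz : V' z, f z Vz = 0])).
  have WV : W `<=` V' by move=> z [].
  have W0 : W `<=` @opensT (set_type I) by [].
  rewrite -(germ0 _ (Logic.I : opensT (el Iy))); apply/germ_eqP.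
  exists W, WV, W0; split; first by split.
  apply: val_inj; apply: dprodP => z; apply: dprodP => Wz.
  by have /interior_subset/(_ (WV z Wz)) := Wz.2.
exists (Subsec (asboolT s1_cs : s1 \in subsec_pred (closed_support_property _) _)) => r Vr.
have [Ir|NI] := pselect (I r); first by rewrite (line_funE _ Ir Vr).
by rewrite line_fun_off ?c0// => -[].
Qed.

End LineSheaf.

Section IntervalSheaf.
Context (R : realType) (k : fieldType) (I : set R).

(** The power 1 gives this sheaf literally the form of a summand in the theorem. *)
Definition interval_sheaf : sheaf k (circle R) :=
  direct_image circle_map (sheaf_power (constant_on k I) 1).

Definition interval_fun (U : opens (circle R)) (s : interval_sheaf U) : R -> k :=
  line_fun ((s : sheaf_power (constant_on k I) 1 (opens_preim circle_map U)) ord0).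

Lemma interval_fun_off (U : opens (circle R)) (s : interval_sheaf U) r :
  ~ I r -> interval_fun s r = 0.
Proof. by move=> N; apply: line_fun_off; case. Qed.

Lemma interval_fun_linear (U : opens (circle R)) a (s t : interval_sheaf U) r :
  interval_fun (a *: s + t) r = a * interval_fun s r + interval_fun t r.
Proof.
by rewrite -(line_fun_linear a); congr (line_fun _ r).
Qed.

Lemma interval_fun_res (U V : opens (circle R)) (VU : V `<=` U) (s : interval_sheaf U) r :
  V (circle_map r) -> interval_fun (res VU s) r = interval_fun s r.
Proof. by move=> Vr; exact: (line_fun_res (opens_preimS VU) _ (Vr : opens_preim circle_map V r)). Qed.

Lemma interval_fun_inj (U : opens (circle R)) (s t : interval_sheaf U) :
  (forall r, U (circle_map r) -> interval_fun s r = interval_fun t r) -> s = t.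
Proof.
move=> st; apply: dprodP => i; rewrite (ord1 i); apply: line_fun_inj => r.
have [Ur|NU] := pselect (U (circle_map r)); first exact: st.
by rewrite !line_fun_off// => -[].
Qed.

Lemma interval_fun_near (U : opens (circle R)) (s : interval_sheaf U) t :
  U (circle_map t) -> \forall r \near t, I r -> interval_fun s r = interval_fun s t.
Proof. exact: (@line_fun_near _ _ _ (opens_preim circle_map U)). Qed.

Lemma interval_fun_exists (U : opens (circle R)) (c : R -> k) :
  (forall r, ~ I r -> c r = 0) ->
  (forall t, U (circle_map t) -> \forall r \near t, I r -> c r = c t) ->
  exists s : interval_sheaf U, forall r, U (circle_map r) -> interval_fun s r = c r.
Proof.
move=> c0 clc.
have [s sE] := @line_fun_exists _ _ I (opens_preim circle_map U) c c0 clc.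
by exists (fun=> s).
Qed.

End IntervalSheaf.

(** * Cells *)

Lemma near_gt (R : realType) (b t : R) : b < t -> \forall s \near t, b < s.
Proof.
by move=> bt; apply: (open_nbhs_nbhs (A := [set s | b < s])); split=> //; exact: open_gt.
Qed.

Lemma near_lt (R : realType) (b t : R) : t < b -> \forall s \near t, s < b.
Proof.
by move=> bt; apply: (open_nbhs_nbhs (A := [set s | s < b])); split=> //; exact: open_lt.
Qed.

(* [a] lists the lifts to the line of the points of a finite subset of the circle. *)
Record grid (R : realType) (n : nat) (a : nat -> R) : Prop := Grid {
  grid_gt0 : (0 < n)%N;
  grid_lt : forall j, a j < a j.+1;
  grid_turn : forall j, a (j + n)%N = a j + 2 * pi
}.

Section Cells.
Context (R : realType) (n : nat) (a : nat -> R) (aP : grid n a).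

Local Notation a_lt := (grid_lt aP).
Local Notation n0 := (grid_gt0 aP).

(* The even cells are the points of the grid, the odd ones the intervals between them. *)
Definition cell (i : nat) (t : R) : bool :=
  if odd i then a i./2 < t < a i./2.+1 else t == a i./2.

Lemma grid_homo i j : (i < j)%N -> a i < a j.
Proof.
elim: j => // j IH; rewrite ltnS leq_eqVlt => /orP[/eqP ->|/IH h]; first exact: a_lt.
exact: lt_trans h (a_lt j).
Qed.

Lemma grid_homo_le i j : (i <= j)%N -> a i <= a j.
Proof. by rewrite leq_eqVlt => /orP[/eqP ->//|/grid_homo/ltW]. Qed.

Lemma grid_turnM j m : a (j + m * n)%N = a j + turn m%:Z.
Proof.
elim: m => [|m IH]; first by rewrite mul0n addn0 mul0r addr0.
by rewrite mulSn addnCA addnC (grid_turn aP) IH -addrA intS turnD mul1r [turn _ + _]addrC.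
Qed.

Lemma grid_unbounded t : exists j, t < a j.
Proof.
exists (0 + Num.bound `|(t - a 0%N) / (2 * pi)| * n)%N; rewrite grid_turnM -ltrBlDl.
rewrite -ltr_pdivrMr ?turn1_gt0//; apply: le_lt_trans (ler_norm _) _.
exact: archi_boundP.
Qed.

Lemma cell_bounds i t : cell i t -> a i./2 <= t < a i./2.+1.
Proof.
rewrite /cell; case: ifP => _; first by move=> /andP[/ltW -> ->].
by move=> /eqP ->; rewrite lexx a_lt.
Qed.

Lemma cell_half i j t : cell i t -> cell j t -> (i./2 <= j./2)%N.
Proof.
move=> /cell_bounds/andP[it _] /cell_bounds/andP[_ tj].
rewrite leqNgt; apply/negP => /grid_homo_le h.
by have := le_lt_trans (le_trans h it) tj; rewrite ltxx.
Qed.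

Lemma cell_uniq i j t : cell i t -> cell j t -> i = j.
Proof.
move=> ci cj; have h : (i./2 = j./2)%N.
  by apply/eqP; rewrite eqn_leq (cell_half ci cj) (cell_half cj ci).
move: ci cj; rewrite -(odd_double_half i) -(odd_double_half j) h /cell.
rewrite !oddD !odd_double !addbF !oddb !half_bit_double.
case: (odd i); case: (odd j) => //=.
  by move=> /andP[ij _] /eqP tE; move: ij; rewrite tE ltxx.
by move=> /eqP tE /andP[ij _]; move: ij; rewrite tE ltxx.
Qed.

(** Cells are indexed by natural numbers and cover only the half-line from [a 0]. This is enough,
    because every point of the circle has lifts arbitrarily far to the right. *)
Lemma cell_exists t : a 0 <= t -> exists i, cell i t.
Proof.
move=> a0t; have [j tj jmin] := ex_minnP (grid_unbounded t).
have j0 : (0 < j)%N by rewrite lt0n; apply/negP => /eqP j0; move: tj; rewrite j0 ltNge a0t.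
have : a j.-1 <= t.
  by rewrite leNgt; apply/negP => /jmin; rewrite -ltnS prednK// ltnn.
rewrite le_eqVlt => /orP[/eqP jt|jt].
  by exists j.-1.*2; rewrite /cell odd_double doubleK jt.
exists j.-1.*2.+1; rewrite /cell /= odd_double /= uphalf_double jt.
by rewrite prednK.
Qed.

Lemma cell_ltW i j s t : cell i s -> cell j t -> s <= t -> (i <= j)%N.
Proof.
move=> ci cj st; rewrite leqNgt; apply/negP => ji.
have h : (j./2 <= i./2)%N by apply: half_leq; exact: ltnW.
have hE : i./2 = j./2.
  apply/eqP; rewrite eqn_leq h andbT leqNgt; apply/negP => /grid_homo_le h'.
  have /andP[is_ _] := cell_bounds ci; have /andP[_ tj] := cell_bounds cj.
  by have := lt_le_trans (lt_le_trans tj h') (le_trans is_ st); rewrite ltxx.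
move: ci cj ji st; rewrite -(odd_double_half i) -(odd_double_half j) hE /cell.
rewrite !oddD !odd_double !addbF !oddb !half_bit_double.
case: (odd i); case: (odd j) => //=; rewrite ?ltnn//.
- by move=> /andP[si _] /eqP -> _; rewrite leNgt si.
- by rewrite ltnNge leq_addl.
Qed.

Lemma cell_turn i t m : cell (i + m * n.*2) (t + turn m%:Z) = cell i t.
Proof.
rewrite /cell -doubleMr oddD odd_double addbF halfD odd_double andbF add0n doubleK.
by rewrite -addSn !grid_turnM ltrD2r ltrD2r (inj_eq (addIr _)).
Qed.

Lemma near_odd_cell i t : odd i -> cell i t -> \forall s \near t, cell i s.
Proof.
rewrite /cell => -> /andP[/near_gt h1 /near_lt h2].
by apply: filterS2 h1 h2 => s -> ->.
Qed.

Lemma cell_double j : cell j.*2 (a j).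
Proof. by rewrite /cell odd_double doubleK. Qed.

Lemma near_no_cell t : t < a 0 -> \forall s \near t, forall i, ~~ cell i s.
Proof.
move=> /near_lt; apply: filterS => s sa i; apply/negP => /cell_bounds/andP[is_ _].
by have := le_lt_trans (le_trans (grid_homo_le (leq0n _)) is_) sa; rewrite ltxx.
Qed.

Lemma cell_nonempty i : exists t, cell i t.
Proof.
rewrite /cell; case: (odd i); last by exists (a i./2).
exists ((a i./2 + a i./2.+1) / 2); have := a_lt i./2; lra.
Qed.

End Cells.

(** * Bars *)

Section OneSided.
Context (R : realType).

Lemma near_ex_right (P : R -> Prop) p b : (\forall s \near p, P s) -> p < b ->
  exists2 s, p < s < b & P s.
Proof.
move=> /nbhs_ballP[e /= e0 eP] pb; pose d := Num.min e (b - p).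
have d0 : 0 < d by rewrite lt_min e0 subr_gt0.
have de : d <= e by rewrite ge_min lexx.
have db : d <= b - p by rewrite ge_min lexx orbT.
exists (p + d / 2); first by lra.
by apply: eP; rewrite /ball /= opprD addrA subrr add0r normrN gtr0_norm; lra.
Qed.

Lemma near_ex_left (P : R -> Prop) p b : (\forall s \near p, P s) -> b < p ->
  exists2 s, b < s < p & P s.
Proof.
move=> /nbhs_ballP[e /= e0 eP] pb; pose d := Num.min e (p - b).
have d0 : 0 < d by rewrite lt_min e0 subr_gt0.
have de : d <= e by rewrite ge_min lexx.
have db : d <= p - b by rewrite ge_min lexx orbT.
exists (p - d / 2); first by lra.
by apply: eP; rewrite /ball /= opprB addrCA subrr addr0 gtr0_norm; lra.
Qed.

(** The points just to the right of p form an interval, on which local constancy gives one value. *)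
Lemma right_constant (T : Type) (f : R -> T) p :
  (\forall s \near p, p < s -> \forall r \near s, f r = f s) ->
  exists w, \forall s \near p, p < s -> f s = w.
Proof.
move=> /nbhs_ballP[e /= e0 eP].
have lc s : p < s < p + e -> \forall r \near s, f r = f s.
  move=> /andP[ps se]; apply: eP => //; rewrite /ball /=.
  by rewrite distrC gtr0_norm; lra.
exists (f (p + e / 2)).
have pe : p < p + e by lra.
apply: filterS (near_lt pe) => s se ps.
apply: (locally_constant_interval lc); first by rewrite ps se.
by lra.
Qed.

Lemma left_constant (T : Type) (f : R -> T) p :
  (\forall s \near p, s < p -> \forall r \near s, f r = f s) ->
  exists w, \forall s \near p, s < p -> f s = w.
Proof.
move=> /nbhs_ballP[e /= e0 eP].
have lc s : p - e < s < p -> \forall r \near s, f r = f s.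
  move=> /andP[ps se]; apply: eP => //; rewrite /ball /=.
  by rewrite gtr0_norm; lra.
exists (f (p - e / 2)).
have pe : p - e < p by lra.
apply: filterS (near_gt pe) => s se ps.
apply: (locally_constant_interval lc); first by rewrite ps se.
by lra.
Qed.

End OneSided.

(** On each odd cell M is a constant sheaf whose fibre is one fixed subspace of k^D. *)
Record cell_constant (R : realType) (k : fieldType) D (a : nat -> R)
    (M : function_sheaf R k D) : Prop := CellConstant {
  cell_flat : forall i t f, odd i -> cell a i t -> M t f -> \forall s \near t, f s = f t;
  cell_value_indep : forall i t t' v, odd i -> cell a i t -> cell a i t' ->
    M t (fun=> v) -> M t' (fun=> v)
}.

(* A summand [e_* k_I], given by a section [u] of the pull-back of [M] on [I] and
   a dual section [l], both extended by 0. *)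
Record is_bar (R : realType) (k : fieldType) D (M : function_sheaf R k D)
    (I : set R) (u : R -> 'rV[k]_D) (l : R -> 'cV[k]_D) : Prop := IsBar {
  bar_nonempty : I !=set0;
  bar_interval : is_interval I;
  bar_bounded : exists B, forall t, I t -> `|t| <= B;
  bar_u0 : forall t, ~ I t -> u t = 0;
  bar_l0 : forall t, ~ I t -> l t = 0;
  bar_adm : forall t, I t -> M t u;
  bar_dual : forall t f, M t f -> \forall s \near t, I s -> dot (f s) (l s) = dot (f t) (l t);
  bar_pair : forall t, I t -> dot (u t) (l t) = 1;
  bar_triangular :
    (forall t (m : nat), (0 < m)%N -> dot (u t) (l (t + turn m%:Z)) = 0) \/
    (forall t (m : nat), (0 < m)%N -> dot (u (t + turn m%:Z)) (l t) = 0)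
}.

Section Bars.
Context (R : realType) (k : fieldType) (D : nat) (n : nat) (a : nat -> R).
Context (aP : grid n a) (M : function_sheaf R k D) (MP : cell_constant a M).

Definition cell_value i v := exists t f, [/\ cell a i t, M t f & f t = v].

(** Exactly one of the cells [i] and [i.+1] is a grid point, namely [a (uphalf i)]. The relation is
    the graph of the generization map from that point if [i] is even, and the converse of such a
    graph if [i] is odd. *)
Definition cell_rel i x y := exists f, M (a (uphalf i)) f /\
  \forall s \near a (uphalf i), (cell a i s -> f s = x) /\ (cell a i.+1 s -> f s = y).

Lemma cell_value_adm i v t : odd i -> cell_value i v -> cell a i t -> M t (fun=> v).
Proof.
move=> oi [t' [f [ct' Mf ft']]] ct; apply: (cell_value_indep MP oi ct' ct).
by apply: (adm_near Mf); rewrite -ft'; exact: (cell_flat MP oi ct' Mf).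
Qed.

Lemma cell_value_point j v : cell_value j.*2 v <-> exists f, M (a j) f /\ f (a j) = v.
Proof.
split=> [[t [f [ct Mf ft]]]|[f [Mf fv]]]; last first.
  by exists (a j), f; split=> //; exact: cell_double.
by move: ct; rewrite /cell odd_double doubleK => /eqP tE; exists f; rewrite -tE.
Qed.

Lemma cell_value_subspace i : linear_subspace (cell_value i).
Proof.
split.
  by have [t ct] := cell_nonempty aP i; exists t, (fun=> 0); split=> //; exact: adm0.
move=> c x y Vx Vy; have [oi|ei] := boolP (odd i).
  have [t ct] := cell_nonempty aP i; exists t, (fun=> c *: x + y); split=> //.
  by apply: adm_linear; exact: cell_value_adm ct.
move: Vx Vy; rewrite -(even_halfK ei) => /cell_value_point[f [Mf <-]] /cell_value_point[g [Mg <-]].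
apply/cell_value_point; exists (fun s => c *: f s + g s); split=> //.
exact: adm_linear.
Qed.

Lemma cell_rel_linear i : linear_relation (cell_rel i).
Proof.
split; first by exists (fun=> 0); split; [exact: adm0|exact: near_all].
move=> c x y x' y' [f [Mf fP]] [g [Mg gP]].
exists (fun s => c *: f s + g s); split; first exact: adm_linear.
by apply: filterS2 fP gP => s [f1 f2] [g1 g2]; split=> cs; [rewrite (f1 cs) (g1 cs)|rewrite (f2 cs) (g2 cs)].
Qed.

Lemma uphalf_turn i m : uphalf (i + m * n.*2) = (uphalf i + m * n)%N.
Proof. by rewrite !uphalfE -addSn -doubleMr halfD odd_double andbF add0n doubleK. Qed.

Lemma cell_rel_turn i x y : cell_rel (i + n.*2) x y <-> cell_rel i x y.
Proof.
have pE : a (uphalf (i + n.*2)) = a (uphalf i) + turn 1%:Z.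
  by rewrite -[n.*2]mul1n uphalf_turn (grid_turnM aP).
have cE j t : cell a (j + n.*2) (t + turn 1%:Z) = cell a j t.
  by rewrite -[n.*2]mul1n (cell_turn aP).
split=> -[f [Mf fP]].
  exists (fun s => f (s + turn 1%:Z)); split; first by apply: adm_turn; rewrite -pE.
  rewrite pE in fP; move/near_translate : fP; apply: filterS => s.
  by rewrite -addSn !cE.
exists (fun s => f (s + turn (- 1%:Z))); split.
  rewrite pE; apply: adm_turnN; apply: (adm_near Mf); apply: near_all => s.
  by rewrite turnN addrK.
rewrite pE; apply/near_translate; apply: filterS fP => s.
by rewrite -addSn !cE turnN addrK.
Qed.

Lemma adm_right_limit j f : M (a j) f ->
  exists y, \forall s \near a j, a j < s -> f s = y.
Proof.
move=> Mf; apply: right_constant; apply: filterS2 (adm_open Mf) (near_lt (grid_lt aP j)).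
move=> s Ms sj js; apply: (@cell_flat _ _ _ _ _ MP j.*2.+1) => //; first by rewrite /= odd_double.
by rewrite /cell /= odd_double /= uphalf_double js.
Qed.

Lemma adm_left_limit j f : M (a j.+1) f ->
  exists x, \forall s \near a j.+1, s < a j.+1 -> f s = x.
Proof.
move=> Mf; apply: left_constant; apply: filterS2 (adm_open Mf) (near_gt (grid_lt aP j)).
move=> s Ms sj js; apply: (@cell_flat _ _ _ _ _ MP j.*2.+1) => //; first by rewrite /= odd_double.
by rewrite /cell /= odd_double /= uphalf_double js sj.
Qed.

Lemma cell_oddE j s : cell a j.*2.+1 s = (a j < s < a j.+1).
Proof. by rewrite /cell /= odd_double /= uphalf_double. Qed.

Lemma cell_evenE j s : cell a j.*2 s = (s == a j).
Proof. by rewrite /cell odd_double doubleK. Qed.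

Lemma cell_rel_evenP j x y : cell_rel j.*2 x y <->
  exists f, [/\ M (a j) f, f (a j) = x & \forall s \near a j, a j < s -> f s = y].
Proof.
rewrite /cell_rel uphalf_double; split=> [[f [Mf fP]]|[f [Mf <- fP]]]; exists f.
  split=> //; first by apply: (nbhs_singleton fP).1; rewrite cell_evenE.
  apply: filterS2 fP (near_lt (grid_lt aP j)) => s [_ fs] sj js; apply: fs.
  by rewrite cell_oddE js.
split=> //; apply: filterS fP => s fs; rewrite cell_evenE cell_oddE.
by split=> [/eqP ->//|/andP[+ _]].
Qed.

Lemma cell_rel_oddP j x y : cell_rel j.*2.+1 x y <->
  exists f, [/\ M (a j.+1) f, f (a j.+1) = y & \forall s \near a j.+1, s < a j.+1 -> f s = x].
Proof.
have pE : uphalf j.*2.+1 = j.+1 by rewrite uphalfE -doubleS doubleK.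
rewrite /cell_rel -doubleS pE; split=> [[f [Mf fP]]|[f [Mf <- fP]]]; exists f.
  split=> //; first by apply: (nbhs_singleton fP).2; rewrite cell_evenE.
  apply: filterS2 fP (near_gt (grid_lt aP j)) => s [fs _] sj js; apply: fs.
  by rewrite cell_oddE js sj.
split=> //; apply: filterS fP => s fs; rewrite cell_evenE cell_oddE.
by split=> [/andP[_ +]|/eqP ->].
Qed.

Lemma cell_rel_left i x y : cell_rel i x y -> cell_value i x.
Proof.
rewrite -(odd_double_half i); case: (odd i) => /=; rewrite ?add1n ?add0n.
  move=> /cell_rel_oddP[f [Mf _ fP]].
  have [s js [fs Ms]] := near_ex_left (filterI fP (adm_open Mf)) (grid_lt aP i./2).
  exists s, f; split=> //; last by apply: fs; case/andP: js.
  by rewrite cell_oddE.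
by move=> /cell_rel_evenP[f [Mf fx _]]; apply/cell_value_point; exists f.
Qed.

Lemma cell_rel_right i x y : cell_rel i x y -> cell_value i.+1 y.
Proof.
rewrite -(odd_double_half i); case: (odd i) => /=; rewrite ?add1n ?add0n.
  move=> /cell_rel_oddP[f [Mf fy _]]; rewrite -doubleS; apply/cell_value_point.
  by exists f.
move=> /cell_rel_evenP[f [Mf _ fP]].
have [s js [fs Ms]] := near_ex_right (filterI fP (adm_open Mf)) (grid_lt aP i./2).
exists s, f; split=> //; last by apply: fs; case/andP: js.
by rewrite cell_oddE.
Qed.

Lemma cell_rel_right_total i y : odd i -> cell_value i.+1 y -> exists x, cell_rel i x y.
Proof.
move=> oi; rewrite -(odd_double_half i) oi add1n -doubleS => /cell_value_point[f [Mf fy]].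
by have [x xP] := adm_left_limit Mf; exists x; apply/cell_rel_oddP; exists f.
Qed.

Lemma cell_rel_left_total i x : ~~ odd i -> cell_value i x -> exists y, cell_rel i x y.
Proof.
move=> ei; rewrite -(even_halfK ei) => /cell_value_point[f [Mf fx]].
by have [y yP] := adm_right_limit Mf; exists y; apply/cell_rel_evenP; exists f.
Qed.

Lemma cell_rel0r i y : ~~ odd i -> cell_rel i 0 y -> y = 0.
Proof.
move=> ei; rewrite -(even_halfK ei) => /cell_rel_evenP[f [Mf fx fP]].
have [s /andP[js _] [fs f0]] := near_ex_right (filterI fP (adm_eq0 Mf fx)) (grid_lt aP i./2).
by rewrite -fs.
Qed.

Lemma cell_rel0l i x : odd i -> cell_rel i x 0 -> x = 0.
Proof.
move=> oi; rewrite -(odd_double_half i) oi add1n => /cell_rel_oddP[f [Mf fx fP]].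
have [s /andP[_ js] [fs f0]] := near_ex_left (filterI fP (adm_eq0 Mf fx)) (grid_lt aP i./2).
by rewrite -fs.
Qed.

(* The failure of the generization map between the cells [i] and [i.+1] to be
   injective ([i] odd) or surjective ([i] even). *)
Definition left_defect i :=
  if odd i then exists y, cell_rel i 0 y /\ y <> 0
  else exists y, cell_value i.+1 y /\ forall x, ~ cell_rel i x y.

(** The string is extended by 0 on both sides. The clauses on u concern the grid points of the
    string, because u must be a section at the points of I only. Those on l concern both sides of
    every interval of the string, because pairing with l must be locally constant on I near every
    point, also at an end point missing from I. *)
Lemma string_of_defect i : left_defect i -> exists b u l,
  [/\ (i < b)%N,
      forall q, (i < q <= b)%N -> cell_value q (u q) /\ dot (u q) (l q) = 1,
      (forall q, ~~ (i < q <= b)%N -> u q = 0 /\ l q = 0),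
      (forall q, (i < q.+1 <= b)%N -> (odd q -> cell_rel q (u q) (u q.+1)) /\
          (~~ odd q -> forall x y, cell_rel q x y -> dot x (l q) = dot y (l q.+1))) /\
      (forall q, (i < q <= b)%N -> (~~ odd q -> cell_rel q (u q) (u q.+1)) /\
          (odd q -> forall x y, cell_rel q x y -> dot x (l q) = dot y (l q.+1)))
    & (forall q m, (0 < m)%N -> dot (u q) (l (q + m * n.*2)%N) = 0) \/
      (forall q m, (0 < m)%N -> dot (u (q + m * n.*2)%N) (l q) = 0)].
Proof.
move=> di.
(* For odd [i], B is the kernel of the generization map and A is 0. For even [i], B consists of all
   values on the interval and A of those that extend to the point. *)
have [A [B [sA sB [AB ABN] [start BV Aend Bend]]]] : exists A B : 'rV[k]_D -> Prop,
   [/\ linear_subspace A, linear_subspace B, (forall x, A x -> B x) /\ (exists x, B x /\ ~ A x)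
     & [/\ (forall x, B x -> cell_rel i 0 x) \/ (forall x y, cell_rel i x y -> A y),
           forall x, B x -> cell_value i.+1 x,
           odd i -> forall x, B x -> cell_rel i 0 x
         & ~~ odd i -> forall x y, cell_rel i x y -> A y]].
  have [r0 rD] := cell_rel_linear i.
  move: di; rewrite /left_defect; case: ifP => oi [y [Vy Ny]].
    exists (fun x => x = 0), (cell_rel i 0); split.
    - by split=> // c x z -> ->; rewrite scaler0 addr0.
    - by split=> // c x z rx rz; have := rD c _ _ _ _ rx rz; rewrite scaler0 addr0.
    - by split=> [x ->//|]; exists y.
    - by split=> //; [left|exact: cell_rel_right].
  exists (fun y => exists x, cell_rel i x y), (cell_value i.+1); split.
  - split; first by exists 0.
    by move=> c x z [x' rx] [z' rz]; exists (c *: x' + z'); exact: rD.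
  - exact: cell_value_subspace.
  - split=> [x [x' ]|]; first exact: cell_rel_right.
    by exists y; split=> // -[x]; exact: Ny.
  - by split=> //; [right=> x z rx; exists x|move=> _ x z rx; exists x].
have n20 : (0 < n.*2)%N by rewrite double_gt0 (grid_gt0 aP).
have [b [u [l [[ib Bu lA] ul Cu e tri]]]] :=
  string_exists n20 cell_rel_linear cell_rel_turn sA sB AB ABN start.
pose U q := if (i < q <= b)%N then u q else 0.
pose L q := if (i < q <= b)%N then l q else 0.
have UE q : (i < q <= b)%N -> U q = u q by rewrite /U => ->.
have LE q : (i < q <= b)%N -> L q = l q by rewrite /L => ->.
have uV q : (i < q <= b)%N -> cell_value q (u q).
  case: q => // q /andP[iq qb]; move: (iq); rewrite ltnS leq_eqVlt => /orP[/eqP <-|iq'].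
    exact: BV.
  by have [/cell_rel_right] := Cu _ iq' qb.
have bnz : u b <> 0.
  move=> u0; have := ul b ib (leqnn b); rewrite u0 dot0l => /eqP.
  by rewrite eq_sym oner_eq0.
exists b, U, L; split=> //.
- by move=> q iqb; rewrite UE// LE//; split; [exact: uV|case/andP: iqb => iq qb; exact: ul].
- by move=> q /negbTE N; rewrite /U /L N.
- split=> q iqb.
    rewrite (UE _ iqb) (LE _ iqb); case/andP: iqb => iq qb.
    (* At the left end u and l are 0 on cell [i], and the choice of A and B gives the two
       clauses. *)
    have [->|iq'] := eqVneq q i.
      rewrite /U /L ltnn /=; split=> oi; first exact: Aend.
      by move=> x y r; rewrite dot0r lA//; apply: (Bend oi) r.
    have {}iq' : (i < q)%N by rewrite ltn_neqAle eq_sym iq' -ltnS.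
    have H : (i < q <= b)%N by rewrite iq' ltnW.
    by rewrite (UE _ H) (LE _ H); have [] := Cu _ iq' qb.
  rewrite (UE _ iqb) (LE _ iqb); case/andP: iqb => iq.
  rewrite leq_eqVlt => /orP[/eqP qb|qb].
    (* The parity of [b] decides how the string ends. If [b] is a point, every germ there extends to
       the right, so l cannot kill the whole domain. If [b] is an interval, a germ vanishing at the
       next point vanishes to its left, so [u b] cannot be related to 0. *)
    subst q; rewrite /U /L ltnn andbF; split=> ob.
      case: e => // e; exfalso.
      have Vb : cell_value b (u b) by apply: uV; rewrite ib leqnn.
      have [y r] := cell_rel_left_total ob Vb.
      by have := ul b ib (leqnn b); rewrite (e _ _ r) => /eqP; rewrite eq_sym oner_eq0.
    move=> x y r; rewrite dot0r; case: e => [e|]; last exact: (fun e => e x y r).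
    by exfalso; apply: bnz; exact: cell_rel0l e.
  have H : (i < q.+1 <= b)%N by rewrite qb andbT ltnS ltnW.
  by rewrite (UE _ H) (LE _ H); have [] := Cu _ iq qb.
- case: tri => tri; [left|right] => q m m0; rewrite /U /L.
    case: ifP => [/andP[iq qb]|]; last by rewrite dot0l.
    by case: ifP => [/andP[iq' qb']|]; rewrite ?dot0r// tri.
  case: ifP => [/andP[iq qb]|]; last by rewrite dot0l.
  by case: ifP => [/andP[iq' qb']|]; rewrite ?dot0r// tri.
Qed.

End Bars.

Section BarOfDefect.
Context (R : realType) (k : fieldType) (D : nat) (n : nat) (a : nat -> R).
Context (aP : grid n a) (M : function_sheaf R k D) (MP : cell_constant a M).

Definition cellwise (T : Type) (z : T) (u : nat -> T) (t : R) : T :=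
  if pselect (exists q, cell a q t) is left h then u (projT1 (cid h)) else z.

Lemma cellwiseE T z (u : nat -> T) q t : cell a q t -> cellwise z u t = u q.
Proof.
move=> ct; rewrite /cellwise; case: pselect => [h|[]]; last by exists q.
by congr u; apply: (cell_uniq aP (projT2 (cid h)) ct).
Qed.

Lemma cellwise0 T z (u : nat -> T) t : ~ (exists q, cell a q t) -> cellwise z u t = z.
Proof. by rewrite /cellwise; case: pselect. Qed.

Lemma cell_le0 q t : cell a q t -> a 0%N <= t.
Proof. by move=> /(cell_bounds aP)/andP[+ _]; apply: le_trans; exact: (grid_homo_le aP). Qed.

(** A negative turn may move points to the left of the grid, where the default value is taken; two
    points of one cell leave the grid together. *)
Lemma cellwise_turn T z (u : nat -> T) q t t' (m : int) : cell a q t -> cell a q t' ->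
  cellwise z u (t + turn m) = cellwise z u (t' + turn m).
Proof.
move=> ct ct'; case: m => m.
  have H s : cell a q s -> cell a (q + m * n.*2) (s + turn m%:Z) by rewrite (cell_turn aP).
  by rewrite !(cellwiseE z u (H _ _)).
have H s s' r : cell a q s -> cell a q s' -> cell a r (s + turn (Negz m)) ->
    cell a r (s' + turn (Negz m)).
  move=> cs cs'; have E x : x = x + turn (Negz m) + turn m.+1%:Z.
    by rewrite NegzE turnN subrK.
  rewrite -(cell_turn aP _ _ m.+1) -E => cs2.
  by rewrite -(cell_turn aP _ _ m.+1) -E -(cell_uniq aP cs cs2).
have [[r cr]|N] := pselect (exists r, cell a r (t + turn (Negz m))).
  by rewrite (cellwiseE z u cr) (cellwiseE z u (H _ _ _ ct ct' cr)).
have N' : ~ exists r, cell a r (t' + turn (Negz m)).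
  by move=> [r cr]; apply: N; exists r; exact: H ct' ct cr.
by rewrite !cellwise0.
Qed.

(** The clause on translates of l lets the same grid serve for the kernel of l; the last clause
    names a cell on which the dimension will drop. *)
Lemma bar_of_defect i : left_defect a M i -> exists I u l,
  [/\ is_bar M I u l,
      forall q t t' (m : int), odd q -> cell a q t -> cell a q t' ->
        l (t + turn m) = l (t' + turn m)
    & forall t, cell a i.+1 t -> I t].
Proof.
move=> /(string_of_defect aP MP)[b [u [l [ib uV ul0 [Cl Cr] tri]]]].
have uq0 q : ~~ (i < q <= b)%N -> u q = 0 by move=> /ul0[].
have lq0 q : ~~ (i < q <= b)%N -> l q = 0 by move=> /ul0[].
pose I t := exists q, (i < q <= b)%N /\ cell a q t.
pose uu := cellwise 0 u; pose ll := cellwise 0 l.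
have uuE q t : cell a q t -> uu t = u q := @cellwiseE _ 0 u q t.
have llE q t : cell a q t -> ll t = l q := @cellwiseE _ 0 l q t.
have inI q t : cell a q t -> I t -> (i < q <= b)%N.
  by move=> ct [r [ir cr]]; rewrite (cell_uniq aP ct cr).
have off0 t : ~ I t -> uu t = 0 /\ ll t = 0.
  move=> N; have [[q cq]|N'] := pselect (exists q, cell a q t).
    rewrite (uuE _ _ cq) (llE _ _ cq); apply: ul0; apply/negP => H; apply: N.
    by exists q.
  by rewrite /uu /ll !cellwise0.
exists I, uu, ll; split; last first.
- by move=> t ct; exists i.+1; rewrite ltnSn.
- by move=> q t t' m _ ct ct'; exact: cellwise_turn ct ct'.
split.
- have [t ct] := cell_nonempty aP i.+1.
  by exists t, i.+1; rewrite ltnSn.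
- move=> s t [q [/andP[iq qb] cq]] [r [/andP[ir rb] cr]] v /andP[sv vt].
  have [w cw] := cell_exists aP (le_trans (cell_le0 cq) sv).
  exists w; split=> //; rewrite (leq_trans iq (cell_ltW aP cq cw sv)).
  exact: leq_trans (cell_ltW aP cw cr vt) rb.
- exists (`|a 0%N| + `|a b.+1|) => t [q [/andP[_ qb] cq]].
  have := cell_le0 cq; have /andP[_ tq] := cell_bounds aP cq.
  have : a (q./2.+1) <= a b.+1.
    by apply: (grid_homo_le aP); rewrite ltnS; apply: leq_trans qb; rewrite leq_half_double leqW // -addnn leq_addr.
  move=> h1 h2; rewrite ler_norml.
  have := ler_norm (a b.+1); have := ler_norm (- a 0%N); rewrite normrN => h3 h4.
  have := normr_ge0 (a 0%N); have := normr_ge0 (a b.+1); lra.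
- by move=> t /off0[].
- by move=> t /off0[].
- move=> t [q [iqb cq]]; have [Vq _] := uV q iqb.
  have [oq|eq_] := boolP (odd q).
    apply: (adm_near (cell_value_adm MP oq Vq cq)).
    by apply: filterS (near_odd_cell oq cq) => s /uuE ->.
  (* Since i < q, the point is not [a 0] and has an interval cell on its left. *)
  have [j qE] : exists j, q = j.+1.*2.
    exists q./2.-1; rewrite prednK ?even_halfK//.
    by rewrite half_gt0; move: iqb eq_; clear; case: q => [|[|]].
  have [rr _] := Cr q iqb; have {rr} := rr eq_.
  rewrite qE in iqb cq *; move=> /(cell_rel_evenP aP)[f [Mf ft fr]].
  move: cq; rewrite cell_evenE => /eqP tE; subst t.
  have iqb' : (i < j.*2.+1.+1 <= b)%N by [].
  have [rl _] := Cl j.*2.+1 iqb'.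
  have /rl /(cell_rel_oddP aP)[g [Mg gt gl]] : odd j.*2.+1 by rewrite /= odd_double.
  (* The germ f follows u to the right and g follows u to the left. They agree at the grid point,
     hence near it, so one germ follows u on both sides. *)
  have fg : f (a j.+1) = g (a j.+1) by rewrite ft gt.
  apply: (adm_near Mf).
  have H := near_gt (grid_lt aP j); have H' := near_lt (grid_lt aP j.+1).
  have HH : \forall s \near a j.+1, a j < s < a j.+2.
    by apply: filterS2 H H' => s -> ->.
  have HH' := adm_eq Mf Mg fg.
  have H3 : \forall s \near a j.+1, f s = g s /\ a j < s < a j.+2 by apply: filterS2 HH' HH.
  apply: filterS3 fr gl H3 => s fr' gl' [fg' /andP[sj sj']].
  have [sa|sa|sa] := ltgtP s (a j.+1).
  + have cs : cell a j.*2.+1 s by rewrite cell_oddE sj sa.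
    by rewrite (uuE _ _ cs) fg' gl'.
  + have cs : cell a j.+1.*2.+1 s by rewrite cell_oddE sa sj'.
    by rewrite (uuE _ _ cs) fr'.
  + have cs : cell a j.+1.*2 s by rewrite cell_evenE sa.
    by rewrite (uuE _ _ cs) sa ft.
- move=> t f Mf; have [ta|ta] := ltP t (a 0%N).
    by apply: filterS (near_no_cell aP ta) => s N [q [_ cq]]; have := N q; rewrite cq.
  have [q cq] := cell_exists aP ta; have [oq|eq_] := boolP (odd q).
    apply: filterS2 (near_odd_cell oq cq) (cell_flat MP oq cq Mf) => s cs fs _.
    by rewrite fs (llE _ _ cs) (llE _ _ cq).
  have [j qE] : exists j, q = j.*2 by exists q./2; rewrite even_halfK.
  subst q; move: cq; rewrite cell_evenE => /eqP tE; subst t.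
  have cj := cell_double a j; rewrite (llE _ _ cj).
  have [y yP] := adm_right_limit aP MP Mf.
  have ry : cell_rel a M j.*2 (f (a j)) y by apply/(cell_rel_evenP aP); exists f.
  (* For j = 0 there is nothing to check, as no cell lies to the left of [a 0]. *)
  have H : \forall s \near a j, s < a j -> I s -> dot (f s) (ll s) = dot (f (a j)) (l j.*2).
    case: j => [|j] in Mf cj y yP ry eq_ ta *.
      apply: near_all => s sa [r [_ cr]].
      by have := lt_le_trans sa (cell_le0 cr); rewrite ltxx.
    have [x xP] := adm_left_limit aP MP Mf.
    have rx : cell_rel a M j.*2.+1 x (f (a j.+1)) by apply/(cell_rel_oddP aP); exists f.
    apply: filterS2 xP (near_gt (grid_lt aP j)) => s fs js sa Is.
    have cs : cell a j.*2.+1 s by rewrite cell_oddE js sa.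
    rewrite (fs sa) (llE _ _ cs); have [_ rl] := Cr _ (inI _ _ cs Is).
    by apply: (rl _ _ _ rx); rewrite /= odd_double.
  apply: filterS3 H yP (near_lt (grid_lt aP j)) => s h fs sj Is.
  have [sa|sa|sa] := ltgtP s (a j); first exact: h.
    have cs : cell a j.*2.+1 s by rewrite cell_oddE sj sa.
    rewrite (fs sa) (llE _ _ cs); have [_ rr] := Cl j.*2 (inI _ _ cs Is).
    by rewrite (rr eq_ _ _ ry).
  by rewrite sa (llE _ _ cj).
- by move=> t [q [iqb cq]]; rewrite (uuE _ _ cq) (llE _ _ cq); have [] := uV q iqb.
- case: tri => tri; [left|right] => t m m0.
    have [[q cq]|N] := pselect (exists q, cell a q t); last first.
      by rewrite /uu cellwise0// dot0l.
    have cq' : cell a (q + m * n.*2) (t + turn m%:Z) by rewrite (cell_turn aP).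
    by rewrite (uuE _ _ cq) (llE _ _ cq') tri.
  have [[q cq]|N] := pselect (exists q, cell a q t); last first.
    by rewrite /ll cellwise0// dot0r.
  have cq' : cell a (q + m * n.*2) (t + turn m%:Z) by rewrite (cell_turn aP).
  by rewrite (uuE _ _ cq') (llE _ _ cq) tri.
Qed.

End BarOfDefect.

(** * Splitting off a bar *)

Section Periodization.
Context (R : realType) (V : zmodType).
Implicit Types (h : R -> V) (B t : R).

(** The sum over the fibre of e. For h of bounded support only finitely many terms remain, and the
    choice of [repr x] does not matter. *)
Definition periodization h (x : circle R) : V := \sum_(m \in [set: int]) h (repr x + turn m).

Definition int_range (N : nat) : seq int := [seq Posz i - Posz N | i <- iota 0 N.*2.+1].

Lemma int_range_uniq N : uniq (int_range N).
Proof. by rewrite map_inj_uniq ?iota_uniq// => i j /addIr[]. Qed.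

Lemma mem_int_range N m : (m \in int_range N) = (`|m| <= N)%N.
Proof.
apply/mapP/idP => [[i]|mN]; first by rewrite mem_iota => /andP[_ iN] ->; lia.
by exists (absz ((m + Posz N)%R)); rewrite ?mem_iota; lia.
Qed.

Lemma turn_far (B t : R) (N : nat) m : B + `|t| <= N%:R -> (N < `|m|)%N -> B < `|t + turn m|.
Proof.
move=> BN Nm; have H : N%:R < `|turn m : R|.
  have : N%:R < `|m|%N%:R :> R by rewrite ltr_nat.
  move=> /lt_le_trans; apply; rewrite normrM -[X in _ <= X * _]intr_norm natr_absz.
  have p2 : 1 <= `|2 * pi| :> R by have := pi_ge2 R => p2; rewrite ger0_norm; lra.
  by rewrite ler_peMr// ler0z.
have H2 : `|turn m| <= `|t + turn m| + `|t|.
  by apply: le_trans (ler_normB _ _); rewrite addrAC subrr add0r.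
by lra.
Qed.

Lemma periodizationE h B t N : (forall r, B < `|r| -> h r = 0) -> B + `|t| <= N%:R ->
  periodization h (circle_map t) = \sum_(m <- int_range N) h (t + turn m).
Proof.
move=> hB BN.
have /circle_map_eqP[m0 rE] : circle_map (repr (circle_map t)) = circle_map t by exact: reprK.
rewrite /periodization; transitivity (\sum_(m \in [set: int]) h (t + turn m)).
  rewrite [RHS](reindex_fsbigT (fun m => m + m0)); last first.
    by exists (fun m => m - m0) => m; rewrite ?addrK ?subrK.
  by apply: eq_fsbigr => m _; rewrite rE turnD addrA addrAC -addrA.
rewrite (@fsbigE _ _ _ _ _ (int_range N)) ?int_range_uniq//.
  by apply: eq_bigl => m; rewrite in_setT.
by move=> m _; rewrite mem_int_range -ltnNge => Nm; apply: hB; exact: turn_far BN Nm.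
Qed.

Lemma periodization_range h B t : (forall r, B < `|r| -> h r = 0) ->
  exists N, periodization h (circle_map t) = \sum_(m <- int_range N) h (t + turn m).
Proof.
move=> hB; exists (Num.bound (B + `|t|)); apply: periodizationE hB _.
have [B0|/ltW B0] := leP 0 (B + `|t|); first exact/ltW/archi_boundP.
exact: le_trans B0 _.
Qed.

End Periodization.

Lemma periodization_linear (R : realType) (k : fieldType) (V : lmodType k) (h h' : R -> V) c B x :
  (forall r, B < `|r| -> h r = 0) -> (forall r, B < `|r| -> h' r = 0) ->
  periodization (fun r => c *: h r + h' r) x = c *: periodization h x + periodization h' x.
Proof.
move=> hB hB'; have [t <-] := circle_map_surj x.
have hB2 r : B < `|r| -> c *: h r + h' r = 0 by move=> Br; rewrite hB// hB'// scaler0 addr0.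
have [N0 N0P] : exists N : nat, B + `|t| <= N%:R.
  exists (Num.bound (B + `|t|)).
  have [B0|/ltW B0] := leP 0 (B + `|t|); first exact/ltW/archi_boundP.
  exact: le_trans B0 _.
by rewrite !(periodizationE _ N0P)// big_split scaler_sumr.
Qed.

Section Splitting.
Context (R : realType) (k : fieldType) (D : nat) (M : function_sheaf R k D).
Context (I : set R) (u : R -> 'rV[k]_D) (l : R -> 'cV[k]_D) (bar : is_bar M I u l).

(** The kernel of the map from F to e_* k_I given by l. A germ on the circle meets the fibre at all
    the translates of t, whence the quantifier over m. *)
Definition adm_ker t f := M t f /\
  \forall s \near t, forall m : int, dot (f s) (l (s + turn m)) = 0.

Definition ker_sheaf : function_sheaf R k D.
Proof.
apply: (@FunctionSheaf R k D adm_ker).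
- by move=> t; split; [exact: adm0|apply: near_all => s m; rewrite dot0l].
- move=> t c f g [Mf f0] [Mg g0]; split; first exact: adm_linear.
  by apply: filterS2 f0 g0 => s fs gs m; rewrite dotDl fs gs mulr0 addr0.
- move=> t f g [Mf f0] fg; split; first exact: (adm_near Mf fg).
  by apply: filterS2 f0 fg => s fs <-.
- move=> t f [Mf f0].
  have f0' : \forall s \near t, \forall r \near s, forall m : int, dot (f r) (l (r + turn m)) = 0.
    exact: nbhs_interior f0.
  by apply: filterS2 (adm_open Mf) f0' => s.
- by move=> t f [Mf _]; exact: (adm_eq0 Mf).
- move=> t m f [Mf f0]; split; first exact: adm_turn.
  move/near_translate : f0; apply: filterS => s f0 m'.
  by have := f0 (m' - m); rewrite -addrA -turnD addrCA subrr addr0.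
Defined.


Let B := projT1 (cid (bar_bounded bar)).
Let IB t : I t -> `|t| <= B := projT2 (cid (bar_bounded bar)) t.

(** In terms of functions, the map from e_* k_I to F given by u; [pull_push] is its composite with
    the map given by l. *)
Definition push (c : R -> k) := periodization (fun t => c t *: u t).

Definition pull_push c t := dot (push c (circle_map t)) (l t).

Definition supported (c : R -> k) := forall t, ~ I t -> c t = 0.

Let NI t : B < `|t| -> ~ I t.
Proof. by move=> Bt /IB; rewrite leNgt Bt. Qed.

Let cB c : supported c -> forall t, B < `|t| -> c t = 0.
Proof. by move=> c0 t /NI /c0. Qed.

Let cuB c : supported c -> forall t, B < `|t| -> c t *: u t = 0.
Proof. by move=> c0 t Bt; rewrite (cB c0)// scale0r. Qed.

Lemma push_linear a c d x : supported c -> supported d ->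
  push (fun t => a * c t + d t) x = a *: push c x + push d x.
Proof.
move=> c0 d0; rewrite /push -(periodization_linear _ _ (cuB c0) (cuB d0)).
by congr periodization; apply: funext => t; rewrite scalerDl scalerA.
Qed.

Lemma push_eq0 c t : supported c -> (forall m, c (t + turn m) = 0) -> push c (circle_map t) = 0.
Proof.
move=> c0 ct; have [N NE] := periodization_range t (cuB c0); rewrite /push NE.
by rewrite big1// => m _; rewrite ct scale0r.
Qed.

Lemma pull_push_linear a c d t : supported c -> supported d ->
  pull_push (fun s => a * c s + d s) t = a * pull_push c t + pull_push d t.
Proof. by move=> c0 d0; rewrite /pull_push push_linear// dotDl. Qed.

Lemma pull_push_off c t : ~ I t -> pull_push c t = 0.
Proof. by move=> NIt; rewrite /pull_push (bar_l0 bar NIt) dot0r. Qed.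

(** These are the functions that represent the sections of e_* k_I over U. *)
Definition coefficient (U : opens (circle R)) (c : R -> k) := supported c /\
  forall t, U (circle_map t) -> \forall r \near t, I r -> c r = c t.

Lemma push_adm U c t : coefficient U c -> U (circle_map t) -> M t (push c \o circle_map).
Proof.
move=> [c0 clc] Ut.
have cu s : U (circle_map s) -> M s (fun r => c r *: u r).
  move=> Us; have [Is|NIs] := pselect (I s).
    apply: (adm_near (admZ (c s) (bar_adm bar Is))).
    apply: filterS (clc s Us) => r cr; have [Ir|NIr] := pselect (I r).
      by rewrite cr.
    by rewrite (bar_u0 bar NIr) !scaler0.
  apply: (adm_near (adm0 M s)); apply: filterS (clc s Us) => r cr.
  have [Ir|NIr] := pselect (I r); first by rewrite cr// c0// scale0r.
  by rewrite (bar_u0 bar NIr) scaler0.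
(* The margin 1 makes a single finite range of turns valid for all s at distance less than 1 from
   t. *)
pose N := Num.bound (B + `|t| + 1).
have NP : B + `|t| + 1 <= N%:R.
  have [B0|/ltW B0] := leP 0 (B + `|t| + 1); first exact/ltW/archi_boundP.
  exact: le_trans B0 _.
have Ms : M t (fun s => \sum_(m <- int_range N) c (s + turn m) *: u (s + turn m)).
  by apply: adm_sum => m; apply: (adm_turn (f := fun r => c r *: u r)); apply: cu; rewrite circle_mapD.
apply: (adm_near Ms).
have t1 : t - 1 < t by lra.
have t2 : t < t + 1 by lra.
apply: filterS2 (near_gt t1) (near_lt t2) => s s1 s2.
rewrite /= /push (periodizationE (cuB c0) (N := N))//.
apply: le_trans NP; have := lerB_dist s t.
have : `|s - t| < 1 by rewrite ltr_norml; lra.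
lra.
Qed.

Lemma pull_push_coefficient U c : coefficient U c -> coefficient U (pull_push c).
Proof.
move=> cU; split; first by move=> t; exact: pull_push_off.
move=> t Ut; exact: (bar_dual bar (push_adm cU Ut)).
Qed.

Lemma coefficientB U c d : coefficient U c -> coefficient U d ->
  coefficient U (fun t => c t - d t).
Proof.
move=> [c0 clc] [d0 dlc]; split; first by move=> t Nt; rewrite c0// d0// subrr.
by move=> t Ut; apply: filterS2 (clc t Ut) (dlc t Ut) => r cr dr Ir; rewrite cr// dr.
Qed.

Lemma coefficientD U c d : coefficient U c -> coefficient U d ->
  coefficient U (fun t => c t + d t).
Proof.
move=> [c0 clc] [d0 dlc]; split; first by move=> t Nt; rewrite c0// d0// addr0.
by move=> t Ut; apply: filterS2 (clc t Ut) (dlc t Ut) => r cr dr Ir; rewrite cr// dr.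
Qed.


(** The sign e merges the two forms of triangularity: in the sum for [pull_push c t], the term c t
    is joined only by values of c at translates of t further in the direction e. *)
Lemma triangular_sign : exists e : int, (e = 1 \/ e = -1) /\
  forall t m, e * m < 0 -> dot (u (t + turn m)) (l t) = 0.
Proof.
case: (bar_triangular bar) => tri; [exists 1|exists (-1)]; split; [by left| |by right|].
  move=> t m; rewrite mul1r => m0.
  have mE : m = - (`|m|%N)%:Z by lia.
  rewrite -[in l t](subrK (turn (`|m|%N)%:Z) t) -turnN {1}mE.
  by apply: tri; lia.
move=> t m; rewrite mulN1r oppr_lt0 => m0.
have -> : m = (`|m|%N)%:Z by lia.
by apply: tri; lia.
Qed.

(** One step of the unipotent recursion. If c vanishes beyond a threshold in the direction e, then
    for t less than one turn before the threshold all off-diagonal terms vanish. *)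
Lemma pull_push_top (e : int) c (j : nat) t : e = 1 \/ e = -1 ->
  (forall t m, e * m < 0 -> dot (u (t + turn m)) (l t) = 0) -> supported c ->
  (forall s, B - turn j%:Z < e%:~R * s -> c s = 0) ->
  B - turn j.+1%:Z < e%:~R * t -> pull_push c t = c t.
Proof.
move=> e1 tri c0 cj tj; have [It|NIt] := pselect (I t); last by rewrite pull_push_off// c0.
have [N NE] := periodization_range t (cuB c0).
rewrite /pull_push /push NE dot_sum (bigD1_seq 0) ?int_range_uniq ?mem_int_range//=.
rewrite turn0 addr0 dotZl (bar_pair bar It) mulr1 big1 ?addr0// => m m0.
rewrite dotZl; have [em|em] := ltP (e * m) 0; first by rewrite tri// mulr0.
rewrite cj ?mul0r//.
have /(turn_ge R) : 0 < e * m by case: e1 em => ->; lia.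
rewrite intrM -mulrA => H; rewrite (mulrDr e%:~R); move: tj; rewrite intS turnD mulr1z mul1r; lra.
Qed.

Lemma supported_top (e : int) c s : e = 1 \/ e = -1 -> supported c ->
  B - turn 0 < e%:~R * s -> c s = 0.
Proof.
move=> e1 c0; rewrite turn0 subr0 => Bs; apply: (cB c0); apply: lt_le_trans Bs _.
by case: e1 => ->; rewrite ?mul1r ?mulN1r ?ler_norm// -normrN ler_norm.
Qed.

(** I is bounded, so finitely many turns of the threshold pass over all of it; this ends both
    recursions. *)
Lemma bottom_exists (e : int) : e = 1 \/ e = -1 ->
  exists j : nat, forall s, I s -> B - turn j%:Z < e%:~R * s.
Proof.
move=> e1; exists (Num.bound (B + B)) => s Is.
have sB := IB Is.
have BB : B + B < (Num.bound (B + B))%:R.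
  by apply: archi_boundP; have := normr_ge0 s; lra.
have : `|e%:~R * s| <= B by case: e1 => ->; rewrite ?mul1r ?mulN1r ?normrN.
rewrite ler_norml => /andP[H _]; apply: lt_le_trans H.
set b := Num.bound _ in BB *.
have : b%:R <= turn b%:Z :> R by rewrite ler_peMr// ?ler0n//; have := pi_ge2 R; lra.
lra.
Qed.

Lemma pull_push_inj c : supported c -> (forall t, pull_push c t = 0) -> forall t, c t = 0.
Proof.
move=> c0 pc; have [e [e1 tri]] := triangular_sign.
have H (j : nat) : forall s, B - turn j%:Z < e%:~R * s -> c s = 0.
  elim: j => [|j IH] s; first exact: supported_top.
  by move=> sj; rewrite -(pull_push_top e1 tri c0 IH sj).
have [j jP] := bottom_exists e1 => t.
by have [/jP/H//|/c0] := pselect (I t).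
Qed.

(** Successive approximation: the residue r vanishes beyond the current threshold, and adding it to
    d makes the equation hold on one more turn. *)
Lemma pull_push_surj U c : coefficient U c ->
  exists2 d, coefficient U d & forall t, pull_push d t = c t.
Proof.
move=> cU; have [e [e1 tri]] := triangular_sign.
have H (j : nat) : exists2 d, coefficient U d &
    forall s, B - turn j%:Z < e%:~R * s -> pull_push d s = c s.
  elim: j => [|j [d dU dP]].
    exists (fun=> 0); first by split=> // t _; exact: near_all.
    move=> s sB; rewrite (supported_top e1 cU.1 sB).
    by rewrite (pull_push_top (j := 0) (e := e) e1 tri)//; move: sB; rewrite intS turnD;
      have := turn1_gt0 R; lra.
  pose r t := c t - pull_push d t.
  have rU : coefficient U r by apply: coefficientB cU (pull_push_coefficient dU).
  exists (fun t => 1 * r t + d t).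
    by have := coefficientD rU dU; congr coefficient; apply: funext => t; rewrite mul1r.
  move=> s sj; rewrite pull_push_linear ?mul1r; [|exact: rU.1|exact: dU.1].
  rewrite (pull_push_top e1 tri rU.1 _ sj) ?subrK// => s' sj'.
  by rewrite /r dP// subrr.
have [j jP] := bottom_exists e1; have [d dU dP] := H j.
exists d => // t; have [/jP/dP//|NI_] := pselect (I t).
by rewrite pull_push_off// cU.1.
Qed.

Definition push_sum (U : opens (circle R)) (f : sheaf_of ker_sheaf U)
    (s : interval_sheaf k I U) x := sec_fun f x + push (interval_fun s) x.

Lemma interval_fun_coefficient (U : opens (circle R)) (s : interval_sheaf k I U) : coefficient U (interval_fun s).
Proof. by split=> t; [exact: interval_fun_off|exact: interval_fun_near]. Qed.

Lemma push_sum_adm (U : opens (circle R)) (f : sheaf_of ker_sheaf U) (s : interval_sheaf k I U) t :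
  U (circle_map t) -> M t (push_sum f s \o circle_map).
Proof.
move=> Ut; have [Mf _] := sec_fun_adm f Ut.
apply: (adm_near (adm_linear 1 Mf (push_adm (interval_fun_coefficient s) Ut))).
by apply: near_all => r; rewrite scale1r.
Qed.

(** Since the composite endomorphism of e_* k_I is bijective, F is the direct sum of the image of
    the map given by u and the kernel of the map given by l. *)
Lemma sheaf_split : sheaf_iso (sheaf_of M) (dsum2 (sheaf_of ker_sheaf) (interval_sheaf k I)).
Proof.
apply: sheaf_iso_sym.
pose h U (p : dsum2 (sheaf_of ker_sheaf) (interval_sheaf k I) U) : sheaf_of M U :=
  projT1 (cid (sec_fun_exists (fun t => @push_sum_adm U p.1 p.2 t))).
have hE (U : opens (circle R)) p x : U x -> sec_fun (h U p) x = sec_fun p.1 x + push (interval_fun p.2) x :=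
  projT2 (cid (sec_fun_exists (fun t => @push_sum_adm U p.1 p.2 t))) x.
have sup (U : opens (circle R)) (s : interval_sheaf k I U) : supported (interval_fun s).
  by have [] := interval_fun_coefficient s.
have lin U : linear (h U).
  move=> c p q; apply: sec_fun_inj => x Ux; rewrite sec_fun_linear !hE//=.
  rewrite sec_fun_linear scalerDr addrACA; congr (_ + _).
  rewrite -push_linear//; congr (push _ x); apply: funext => t.
  exact: interval_fun_linear.
have nat (U V : opens (circle R)) (VU : V `<=` U) p :
    mklin (lin V) (res VU p) = res VU (mklin (lin U) p).
  apply: sec_fun_inj => x Vx; rewrite sec_fun_res// !hE//=; last exact: VU.
  rewrite (sec_fun_res VU)//; congr (_ + _).
  have [t xE] := circle_map_surj x; subst x.
  have sup1 := sup _ (res VU p.2); have sup2 := sup _ p.2.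
  have sup3 r : ~ I r -> interval_fun (res VU p.2) r - interval_fun p.2 r = 0.
    by move=> N; rewrite sup1// sup2// subrr.
  apply/subr0_eq; rewrite addrC -scaleN1r -push_linear//.
  apply: push_eq0 => [r N|m]; first by rewrite mulN1r addrC; exact: sup3.
  by rewrite (interval_fun_res VU) ?circle_mapD// mulN1r addNr.
apply: (@bijective_hom_iso _ _ _ _ (SheafHom nat)) => U => [[f s] E|g].
  have E0 x : U x -> sec_fun f x + push (interval_fun s) x = 0.
    by move=> Ux; rewrite -(hE U (f, s))//= [h U _]E sec_fun0.
  (* Pairing the equation with l kills f and leaves [pull_push] of s. *)
  have c0 t : interval_fun s t = 0.
    apply: pull_push_inj => // r.
    have [Ur|NU] := pselect (U (circle_map r)); last first.
      rewrite /pull_push push_eq0 ?dot0l// => m.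
      by apply: line_fun_off => -[_ Ur]; apply: NU; move: Ur; rewrite /= circle_mapD.
    have [_ /nbhs_singleton/(_ 0)] := sec_fun_adm f Ur; rewrite turn0 addr0 => f0.
    have := congr1 (fun v => dot v (l r)) (E0 _ Ur).
    by rewrite dot0l -[sec_fun f _]scale1r dotDl f0 mulr0 add0r.
  have -> : s = 0.
    apply: interval_fun_inj => r Ur; rewrite c0.
    have := interval_fun_linear 1 (0 : interval_sheaf k I U) 0 r.
    by rewrite scale1r addr0 mul1r => /(congr1 (fun v => v - interval_fun (0 : interval_sheaf k I U) r));
      rewrite addrK subrr.
  congr pair; apply: sec_fun_inj => x Ux; rewrite sec_fun0.
  have [t xE] := circle_map_surj x; subst x.
  by rewrite -[RHS](E0 _ Ux) push_eq0 ?addr0.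
(* Solving [pull_push d = c] makes g minus the push of d a section of the kernel. *)
pose c t := dot (sec_fun g (circle_map t)) (l t).
have cU : coefficient U c.
  split; first by move=> t N; rewrite /c (bar_l0 bar N) dot0r.
  by move=> t Ut; exact: (bar_dual bar (sec_fun_adm g Ut)).
have [d dU dc] := pull_push_surj cU.
have [s sE] := interval_fun_exists dU.1 dU.2.
have ps t : U (circle_map t) -> push (interval_fun s) (circle_map t) = push d (circle_map t).
  move=> Ut; apply/subr0_eq; rewrite addrC -scaleN1r -push_linear//; last exact: dU.1.
  apply: push_eq0 => [r N|m]; first by rewrite dU.1// sup// mulr0 addr0.
  by rewrite sE ?circle_mapD// mulN1r addNr.
have gk t : U (circle_map t) ->
    ker_sheaf t ((fun x => sec_fun g x - push (interval_fun s) x) \o circle_map).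
  move=> Ut; split.
    exact: (admB (sec_fun_adm g Ut) (push_adm (interval_fun_coefficient s) Ut)).
  apply: filterS (near_opens Ut) => r Ur m.
  rewrite -[_ r]/(sec_fun g (circle_map r) - push (interval_fun s) (circle_map r)).
  by rewrite dotBl ps// -(circle_mapD r m) -[dot (push _ _) _]/(pull_push _ _) dc /c subrr.
have [f fE] := sec_fun_exists gk.
by exists (f, s); apply: sec_fun_inj => x Ux; rewrite /= hE//= fE// subrK.
Qed.

End Splitting.

(** * Sheaves without defects *)

Section Dimension.
Context (k : fieldType) (D : nat).
Implicit Types (P Q : 'rV[k]_D -> Prop).

Definition span_mx P : 'M[k]_D := xget 0 [set A | forall v, P v <-> (v <= A)%MS].

Lemma span_mxP P : linear_subspace P -> forall v, P v <-> (v <= span_mx P)%MS.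
Proof.
move=> /subspace_mx[A AP]; rewrite /span_mx.
by case: xgetP => [B _ BP //|/(_ A)[]].
Qed.

Definition dimension P := \rank (span_mx P).

Lemma dimension_le P Q : linear_subspace P -> linear_subspace Q ->
  (forall v, P v -> Q v) -> (dimension P <= dimension Q)%N.
Proof.
move=> sP sQ PQ; apply: mxrankS; apply/row_subP => i.
by apply/(span_mxP sQ)/PQ/(span_mxP sP); exact: row_sub.
Qed.

Lemma dimension_lt P Q v : linear_subspace P -> linear_subspace Q ->
  (forall v, P v -> Q v) -> Q v -> ~ P v -> (dimension P < dimension Q)%N.
Proof.
move=> sP sQ PQ Qv NPv; apply: rank_ltmx; rewrite /ltmx; apply/andP; split.
  apply/row_subP => i; apply/(span_mxP sQ)/PQ/(span_mxP sP); exact: row_sub.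
apply/negP => QP; apply: NPv; apply/(span_mxP sP); apply: submx_trans QP.
exact/(span_mxP sQ).
Qed.

Definition is_basis P r (y : 'I_r -> 'rV[k]_D) :=
  [/\ forall i, P (y i), forall v, P v -> exists c, v = \sum_i c i *: y i
    & forall c, \sum_i c i *: y i = 0 -> forall i, c i = 0].

Lemma sum_rows r (c : 'rV[k]_r) (Y : 'M[k]_(r, D)) :
  c *m Y = \sum_i c 0 i *: row i Y.
Proof. exact: mulmx_sum_row. Qed.

Lemma basis_exists P : linear_subspace P ->
  exists y : 'I_(dimension P) -> 'rV[k]_D, is_basis P y.
Proof.
move=> sP; exists (fun i => row i (row_base (span_mx P))); split.
- move=> i; apply/(span_mxP sP); apply: submx_trans (row_sub _ _) _.
  by rewrite eq_row_base.
- move=> v /(span_mxP sP); rewrite -(eq_row_base (span_mx P)) => /submxP[c ->].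
  by exists (fun i => c 0 i); rewrite sum_rows.
- move=> c cE i; have : (\row_i c i) *m row_base (span_mx P) = 0.
    by rewrite sum_rows -[RHS]cE; apply: eq_bigr => j _; rewrite mxE.
  have /row_free_inj inj := row_base_free (span_mx P).
  by rewrite -[RHS](mul0mx _ (row_base (span_mx P))) => /inj/rowP/(_ i); rewrite !mxE.
Qed.

Lemma basis_transfer P Q (C : 'rV[k]_D -> 'rV[k]_D -> Prop) r (y z : 'I_r -> 'rV[k]_D) :
  linear_relation C -> (forall i, C (y i) (z i)) -> is_basis P y ->
  (forall i, Q (z i)) -> (forall v, Q v -> exists x, P x /\ C x v) ->
  (forall v, C 0 v -> v = 0) -> (forall x, C x 0 -> x = 0) -> is_basis Q z.
Proof.
move=> sC Cyz [_ gen free] Qz QP C0r C0l; split=> //.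
  move=> v /QP[x [/gen[c xE] Cxv]]; exists c; apply/subr0_eq/C0r.
  have := linear_relationB sC Cxv (linear_relation_sum c sC Cyz).
  by rewrite -xE subrr.
move=> c cE; apply: free; apply: C0l.
by have := linear_relation_sum c sC Cyz; rewrite cE.
Qed.

(** C is the graph of a linear map that is defined on a subspace of P and reaches all of Q. If the
    dimensions are equal, lifts of a basis of Q form a basis of P, so the map is defined on P and is
    injective. *)
Lemma dimension_relation P Q (C : 'rV[k]_D -> 'rV[k]_D -> Prop) :
  linear_subspace P -> linear_subspace Q -> linear_relation C ->
  (forall x y, C x y -> P x) -> (forall y, Q y -> exists x, C x y) ->
  (forall y, C 0 y -> y = 0) ->
  (dimension Q <= dimension P)%N /\
  ((dimension P <= dimension Q)%N ->
     (forall x, P x -> exists y, C x y) /\ forall x, C x 0 -> x = 0).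
Proof.
move=> sP sQ sC CP QC C0; have [y [Qy genQ freeQ]] := basis_exists sQ.
pose x i := projT1 (cid (QC _ (Qy i))).
have Cxy i : C (x i) (y i) := projT2 (cid (QC _ (Qy i))).
pose X := \matrix_i x i.
have rX i : row i X = x i by rewrite rowK.
have C_sum (c : 'rV[k]_(dimension Q)) : C (c *m X) (\sum_i c 0 i *: y i).
  rewrite sum_rows; under eq_bigr do rewrite rX.
  exact: linear_relation_sum.
have Xfree : row_free X.
  apply/inj_row_free => c cX; apply/rowP => i; rewrite mxE.
  by apply: (freeQ (fun i => c 0 i)); apply: C0; have := C_sum c; rewrite cX.
have XP : (X <= span_mx P)%MS.
  by apply/row_subP => i; rewrite rX; apply/(span_mxP sP)/CP; exact: Cxy.
have rkX : \rank X = dimension Q by apply/eqP.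
split; first by rewrite -rkX; exact: mxrankS.
move=> le; have PX : (span_mx P <= X)%MS.
  by rewrite -(mxrank_leqif_sup XP) eqn_leq mxrankS//= rkX.
have PXE v : P v -> exists c, v = c *m X.
  by move=> /(span_mxP sP)/submx_trans/(_ PX)/submxP.
split=> [v /PXE[c ->]|v Cv]; first by exists (\sum_i c 0 i *: y i); exact: C_sum.
have [c vE] := PXE _ (CP _ _ Cv); rewrite vE.
suff -> : c = 0 by rewrite mul0mx.
apply/rowP => i; rewrite mxE; apply: (freeQ (fun i => c 0 i)); apply: C0.
have := linear_relationB sC (C_sum c) Cv.
by rewrite -vE subrr subr0.
Qed.

End Dimension.

Section Kernel.
Context (R : realType) (k : fieldType) (D : nat) (n : nat) (a : nat -> R).
Context (aP : grid n a) (M : function_sheaf R k D) (MP : cell_constant a M).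
Context (I : set R) (u : R -> 'rV[k]_D) (l : R -> 'cV[k]_D) (bar : is_bar M I u l).
Hypothesis l_cell : forall q t t' (m : int), odd q -> cell a q t -> cell a q t' ->
  l (t + turn m) = l (t' + turn m).

Lemma ker_cell_constant : cell_constant a (ker_sheaf M l).
Proof.
split=> [i t f oi ct [Mf _]|i t t' v oi ct ct' [Mv v0]]; first exact: (cell_flat MP oi ct Mf).
split; first exact: (cell_value_indep MP oi ct ct').
apply: filterS (near_odd_cell oi ct') => s cs m.
by rewrite (l_cell m oi cs ct); have := nbhs_singleton v0.
Qed.

Lemma ker_value_sub i v : cell_value a (ker_sheaf M l) i v -> cell_value a M i v.
Proof. by move=> [t [f [ct [Mf _] ft]]]; exists t, f. Qed.

(** The value [u t] is lost, since it pairs to 1 with [l t]. *)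
Lemma ker_value_proper i t : cell a i t -> I t ->
  exists v, cell_value a M i v /\ ~ cell_value a (ker_sheaf M l) i v.
Proof.
move=> ct It; exists (u t); split; first by exists t, u; split=> //; exact: (bar_adm bar).
move=> [t' [f [ct' [Mf f0] ft']]].
have : dot (u t) (l t) = 0.
  have /(_ 0) := nbhs_singleton f0; rewrite ft'.
  have [oi|ei] := boolP (odd i); first by rewrite (l_cell 0 oi ct' ct) turn0 addr0.
  move: ct ct'; rewrite -(even_halfK ei) !cell_evenE => /eqP -> /eqP ->.
  by rewrite turn0 addr0.
by rewrite (bar_pair bar It) => /eqP; rewrite oner_eq0.
Qed.

End Kernel.

Section LocallyConstant.
Context (R : realType) (k : fieldType) (D : nat) (n : nat) (a : nat -> R).
Context (aP : grid n a) (M : function_sheaf R k D) (MP : cell_constant a M).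

Lemma cell_value_turn i v : cell_value a M (i + n.*2) v <-> cell_value a M i v.
Proof.
have cE j t : cell a (j + n.*2) (t + turn 1%:Z) = cell a j t.
  by rewrite -[n.*2]mul1n (cell_turn aP).
split=> -[t [f [ct Mf ft]]].
  have tE : t = (t + turn (- 1%:Z)) + turn 1%:Z by rewrite turnN subrK.
  exists (t + turn (- 1%:Z)), (fun s => f (s + turn 1%:Z)); split.
  - by rewrite -cE -tE.
  - by apply: adm_turn; rewrite -tE.
  - by rewrite -tE.
exists (t + turn 1%:Z), (fun s => f (s + turn (- 1%:Z))); split.
- by rewrite cE.
- apply: adm_turnN; apply: (adm_near Mf); apply: near_all => s.
  by rewrite turnN addrK.
- by rewrite turnN addrK.
Qed.

Lemma left_defect_turn i : left_defect a M (i + n.*2) -> left_defect a M i.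
Proof.
rewrite /left_defect oddD odd_double addbF; case: ifP => _ [y [Hy Ny]]; exists y.
  by split=> //; apply/(cell_rel_turn aP).
split; first by apply/cell_value_turn; rewrite addSn.
by move=> x /(cell_rel_turn aP); exact: Ny.
Qed.

Lemma left_defect_mod i : left_defect a M i -> exists2 j, (j < n.*2)%N & left_defect a M j.
Proof.
have n20 : (0 < n.*2)%N by rewrite double_gt0 (grid_gt0 aP).
elim/ltn_ind: i => i IH di; have [h|h] := ltnP i n.*2; first by exists i.
apply: (IH (i - n.*2)%N); first by lia.
by apply: left_defect_turn; rewrite subnK.
Qed.

Hypothesis nodefect : forall i, ~ left_defect a M i.

Local Notation V i := (cell_value a M i).
Local Notation C i := (cell_rel a M i).

Let Vsub i : linear_subspace (V i) := cell_value_subspace aP MP i.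
Let Clin i : linear_relation (C i) := @cell_rel_linear _ _ _ a M i.

Lemma rel_right_total i y : V i.+1 y -> exists x, C i x y.
Proof.
move=> Vy; have [oi|/negbTE ei] := boolP (odd i); first exact: (cell_rel_right_total aP MP oi Vy).
apply: contrapT => N; apply: (@nodefect i); rewrite /left_defect ei.
by exists y; split=> // x Cx; apply: N; exists x.
Qed.

Lemma rel0r i y : C i 0 y -> y = 0.
Proof.
move=> Cy; have [oi|ei] := boolP (odd i); last exact: (cell_rel0r aP ei Cy).
apply: contrapT => N; apply: (@nodefect i); rewrite /left_defect oi.
by exists y.
Qed.

Lemma dimension_cell i : (dimension (V i) <= dimension (V i.+1))%N.
Proof.
have le j : (dimension (V j.+1) <= dimension (V j))%N.
  have CV x y : C j x y -> V j x by move=> Cxy; exact: (cell_rel_left aP Cxy).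
  by have [] := dimension_relation (Vsub j) (Vsub j.+1) (Clin j) CV (@rel_right_total j) (@rel0r j).
have leM j m : (dimension (V (j + m)) <= dimension (V j))%N.
  elim: m => [|m IH]; first by rewrite addn0.
  by rewrite addnS; exact: leq_trans (le _) IH.
(* From [i.+1] the cell one period after [i] is reached in [n.*2.-1] steps, none of which raises the
   dimension. *)
have -> : V i = V (i + n.*2)%N.
  by apply: funext => v; apply/propext; apply: iff_sym; exact: cell_value_turn.
have n0 := grid_gt0 aP.
by rewrite (_ : i + n.*2 = i.+1 + n.*2.-1)%N ?leM//; lia.
Qed.

Lemma rel_left i : (forall x, V i x -> exists y, C i x y) /\ forall x, C i x 0 -> x = 0.
Proof.
have CV x y : C i x y -> V i x by move=> Cxy; exact: (cell_rel_left aP Cxy).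
have [_] := dimension_relation (Vsub i) (Vsub i.+1) (Clin i) CV (@rel_right_total i) (@rel0r i).
by apply; exact: dimension_cell.
Qed.

(** The bound [a 1] leaves a cell on both sides of every grid point considered. Without defects each
    relation is a bijection between the values on neighbouring cells, so germs whose values form a
    basis at t still give a basis nearby. *)
Lemma near_basis t : a 1%N <= t -> exists r (f : 'I_r -> R -> 'rV[k]_D),
  \forall s \near t, (forall i, M s (f i)) /\
    exists q, cell a q s /\ is_basis (V q) (fun i => f i s).
Proof.
move=> at1; have a01 := grid_lt aP 0.
have [q cq] := cell_exists aP (le_trans (ltW a01) at1).
have [y yB] := basis_exists (Vsub q); exists (dimension (V q)).
have ex i : exists f, M t f /\ f t = y i.
  have [Vy _ _] := yB; have Vyi := Vy i; have [oq|eq_] := boolP (odd q).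
    by exists (fun=> y i); split=> //; exact: (cell_value_adm MP oq Vyi cq).
  move: Vyi cq; rewrite -(even_halfK eq_) cell_evenE => /cell_value_point Vyi /eqP ->.
  exact: Vyi.
pose f i := projT1 (cid (ex i)).
have fP i : M t (f i) /\ f i t = y i := projT2 (cid (ex i)).
exists f.
have nM : \forall s \near t, forall i, M s (f i).
  by apply: (@filter_forall _ _ _ _ (nbhs_filter t)) => i; apply: adm_open; exact: (fP i).1.
have [oq|eq_] := boolP (odd q).
  have nf : \forall s \near t, forall i, f i s = y i.
    apply: (@filter_forall _ _ _ _ (nbhs_filter t)) => i; have [Mf <-] := fP i.
    exact: (cell_flat MP oq cq Mf).
  apply: filterS3 nM nf (near_odd_cell oq cq) => s Ms fs cs; split=> //.
  by exists q; split=> //; rewrite (_ : (fun i => f i s) = y)//; apply: funext.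
have [j qE] : exists j, q = j.+1.*2.
  exists q./2.-1; rewrite prednK ?even_halfK//.
  move: cq; rewrite -(even_halfK eq_) cell_evenE doubleK lt0n => /eqP tE.
  by apply/negP => /eqP q0; move: at1; rewrite tE q0 leNgt a01.
subst q; move: cq; rewrite cell_evenE => /eqP tE; subst t.
have exr i : exists z, \forall s \near a j.+1, a j.+1 < s -> f i s = z.
  by apply: (adm_right_limit aP MP); exact: (fP i).1.
have exl i : exists z, \forall s \near a j.+1, s < a j.+1 -> f i s = z.
  by apply: (adm_left_limit aP MP); exact: (fP i).1.
pose zr i := projT1 (cid (exr i)); have zrP i := projT2 (cid (exr i)).
pose zl i := projT1 (cid (exl i)); have zlP i := projT2 (cid (exl i)).
have Cr i : C j.+1.*2 (y i) (zr i).
  by apply/(cell_rel_evenP aP); exists (f i); split; [exact: (fP i).1|exact: (fP i).2|exact: zrP].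
have Cl i : C j.*2.+1 (zl i) (y i).
  by apply/(cell_rel_oddP aP); exists (f i); split; [exact: (fP i).1|exact: (fP i).2|exact: zlP].
have zrB : is_basis (V j.+1.*2.+1) zr.
  apply: (basis_transfer (Clin j.+1.*2) Cr yB).
  - by move=> i; exact: (cell_rel_right aP (Cr i)).
  - move=> v Vv; have [x Cx] := rel_right_total Vv; exists x; split=> //.
    exact: (cell_rel_left aP Cx).
  - exact: rel0r.
  - exact: (rel_left _).2.
have zlB : is_basis (V j.*2.+1) zl.
  apply: (@basis_transfer _ _ _ _ (fun x v => C j.*2.+1 v x) _ y zl _ Cl yB).
  - split; first exact: (Clin _).1.
    by move=> c x v x' v' h h'; exact: (Clin _).2.
  - by move=> i; exact: (cell_rel_left aP (Cl i)).
  - move=> v Vv; have [x Cx] := (rel_left _).1 v Vv; exists x; split=> //.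
    exact: (cell_rel_right aP Cx).
  - exact: (rel_left _).2.
  - by move=> x; exact: rel0r.
have nr : \forall s \near a j.+1, forall i, a j.+1 < s -> f i s = zr i.
  by apply: (@filter_forall _ _ _ _ (nbhs_filter (a j.+1))) => i; exact: zrP.
have nl : \forall s \near a j.+1, forall i, s < a j.+1 -> f i s = zl i.
  by apply: (@filter_forall _ _ _ _ (nbhs_filter (a j.+1))) => i; exact: zlP.
have nb : \forall s \near a j.+1, a j < s < a j.+2.
  by apply: filterS2 (near_gt (grid_lt aP j)) (near_lt (grid_lt aP j.+1)) => s -> ->.
have nlr : \forall s \near a j.+1, forall i,
    (a j.+1 < s -> f i s = zr i) /\ (s < a j.+1 -> f i s = zl i).
  by apply: filterS2 nr nl => s h1 h2 i; split; [exact: h1|exact: h2].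
apply: filterS3 nM nlr nb => s Ms flr /andP[js sj]; split=> //.
have [sa|sa|sa] := ltgtP s (a j.+1).
- exists j.*2.+1; rewrite cell_oddE js sa; split=> //.
  by rewrite (_ : (fun i => f i s) = zl)//; apply: funext => i; exact: (flr i).2.
- exists j.+1.*2.+1; rewrite cell_oddE sj sa; split=> //.
  by rewrite (_ : (fun i => f i s) = zr)//; apply: funext => i; exact: (flr i).1.
- exists j.+1.*2; rewrite cell_evenE sa; split=> //.
  by rewrite (_ : (fun i => f i (a j.+1)) = y)//; apply: funext => i; exact: (fP i).2.
Qed.

End LocallyConstant.

Lemma circle_map_surj_ge (R : realType) (b : R) (x : circle R) :
  exists2 t, b <= t & circle_map t = x.
Proof.
have [r <-] := circle_map_surj x.
exists (r + turn (Num.bound `|b - r|)%:Z); last exact: circle_mapD.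
rewrite -lerBlDl; apply: le_trans (ler_norm _) _.
apply/ltW/(lt_le_trans (archi_boundP (normr_ge0 _))).
by rewrite ler_peMr ?ler0n//; have := pi_ge2 R; lra.
Qed.

Lemma circle_map_inj_near (R : realType) (t r s : R) :
  `|r - t| < 1 -> `|s - t| < 1 -> circle_map r = circle_map s -> r = s.
Proof.
rewrite !ltr_norml => rt st /circle_map_eqP[m rE].
have p2 := pi_ge2 R.
suff m0 : m = 0 by rewrite rE m0 turn0 addr0.
have [m0|m0|//] := ltgtP m 0; exfalso.
  by have := turn_le R m0; move: rE; set w := turn m => rE h; lra.
by have := turn_ge R m0; move: rE; set w := turn m => rE h; lra.
Qed.

Section LocallyConstantSheaf.
Context (R : realType) (k : fieldType) (D : nat) (M : function_sheaf R k D).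

Lemma sec_fun_germ (U V : opens (circle R)) x (Ux : U x) (Vx : V x)
    (s : sheaf_of M U) (t : sheaf_of M V) :
  germ Ux s = germ Vx t -> sec_fun s x = sec_fun t x.
Proof.
move=> /germ_eqP[W [WU [WV [Wx E]]]].
by rewrite -(sec_fun_res WU s Wx) E sec_fun_res.
Qed.

Lemma sec_fun_sum (U : opens (circle R)) r (c : 'I_r -> k) (s : 'I_r -> sheaf_of M U) x :
  sec_fun (\sum_i c i *: s i) x = \sum_i c i *: sec_fun (s i) x.
Proof.
elim/big_ind2: _ => [|v v' w w' E E'|i _]; first exact: sec_fun0.
  by have := sec_fun_linear 1 v' w' x; rewrite !scale1r E E'.
by have := sec_fun_linear (c i) (s i) 0 x; rewrite sec_fun0 !addr0.
Qed.

Lemma constant_near (t : R) r (f : 'I_r -> R -> 'rV[k]_D) :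
  (\forall s \near t, (forall i, M s (f i)) /\
     is_basis (fun v => exists g, M s g /\ g s = v) (fun i => f i s)) ->
  exists U : opens (circle R), U (circle_map t) /\
    constant_of_finite_rank (sheaf_restrict U (sheaf_of M)).
Proof.
(* An interval of radius at most 1 is shorter than 2 pi, so e is injective on it and the f i descend
   to an arc. *)
move=> /nbhs_ballP[e /= e0 eP]; pose d := Num.min e 1.
have d0 : 0 < d by rewrite lt_min e0 ltr01.
have de : d <= e by rewrite ge_min lexx.
have d1 : d <= 1 by rewrite ge_min lexx orbT.
pose J s := `|s - t| < d.
have JP s : J s -> (forall i, M s (f i)) /\
     is_basis (fun v => exists g, M s g /\ g s = v) (fun i => f i s).
  by rewrite /J => Js; apply: eP; rewrite /ball /= distrC; exact: lt_le_trans de.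
have nJ s : J s -> \forall r \near s, J r.
  rewrite /J ltr_distl => /andP[/near_gt h1 /near_lt h2].
  by apply: filterS2 h1 h2 => q q1 q2; rewrite ltr_distl q1 q2.
pose u x := exists2 s, J s & circle_map s = x.
have u_open : open (u : set (circle R)).
  rewrite openE => x [s Js <-]; apply/near_circle_map.
  by apply: filterS (nJ s Js) => q Jq; exists q.
pose U := Opens u_open.
pose F i x := if pselect (u x) is left h then f i (s2val (cid2 h)) else 0.
have FE i s : J s -> F i (circle_map s) = f i s.
  move=> Js; rewrite /F; case: pselect => [h|[]]; last by exists s.
  case: (cid2 h) => q /= Jq qs; congr f; apply: (circle_map_inj_near (t := t)) qs.
    exact: lt_le_trans Jq d1.
  exact: lt_le_trans Js d1.
have FM i q : U (circle_map q) -> M q (F i \o circle_map).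
  move=> [s Js /esym/circle_map_eqP[m qE]]; subst q; apply: adm_turnN.
  have [/(_ i) Mf _] := JP s Js; apply: (adm_near Mf).
  by apply: filterS (nJ s Js) => q Jq; rewrite /= circle_mapD FE.
pose S i := projT1 (cid (sec_fun_exists (FM i))).
have SE i x : U x -> sec_fun (S i) x = F i x := projT2 (cid (sec_fun_exists (FM i))) x.
have Sf i s : J s -> sec_fun (S i) (circle_map s) = f i s.
  by move=> Js; rewrite SE ?FE//; exists s.
exists U; split; first by exists t => //; rewrite /J subrr normr0.
apply: (@constant_of_basis _ _ _ U r S) => x Ux; have [s Js xE] := Ux; subst x.
  move=> g; have [V [Vx [h ->]]] := stalkP g.
  have [_ [_ gen _]] := JP s Js.
  have [c cE] : exists c, sec_fun h (circle_map s) = \sum_i c i *: f i s.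
    by apply: gen; exists (fun q => sec_fun h (circle_map q)); split=> //; exact: sec_fun_adm.
  exists c; rewrite germ_sum; apply: germ_sec_fun; rewrite sec_fun_sum cE.
  by apply: eq_bigr => i _; rewrite Sf.
move=> c; rewrite germ_sum -(germ0 _ Ux) => /sec_fun_germ.
rewrite sec_fun_sum sec_fun0 => cE; have [_ [_ _ free]] := JP s Js.
by apply: free; rewrite -[RHS]cE; apply: eq_bigr => i _; rewrite Sf.
Qed.

Context (n : nat) (a : nat -> R) (aP : grid n a) (MP : cell_constant a M).

Lemma locally_constant_of_nodefect : (forall i, ~ left_defect a M i) ->
  locally_constant_of_finite_rank (sheaf_of M).
Proof.
move=> nd x; have [t at1 <-] := circle_map_surj_ge (a 1%N) x.
have [r [f fP]] := near_basis aP MP nd at1.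
apply: (@constant_near t r f); apply: filterS fP => s [Ms [q [cq [Vf gen free]]]].
split=> //; split=> // [i|v [g [Mg gv]]]; first by exists (f i).
by apply: gen; exists s, g.
Qed.

End LocallyConstantSheaf.

(** * Induction on the dimensions of the cells *)

Section Induction.
Context (R : realType) (k : fieldType) (D : nat) (n : nat) (a : nat -> R) (aP : grid n a).

Lemma function_sheaf_decomposition (M : function_sheaf R k D) : cell_constant a M ->
  exists (A : finType) (I : A -> set R) (L : sheaf k (circle R)),
    [/\ forall x, [/\ I x !=set0, is_interval (I x) & bounded_set (I x)],
        locally_constant_of_finite_rank L
      & sheaf_iso (sheaf_of M) (dsum2 L (dsum (fun x => interval_sheaf k (I x))))].
Proof.
(* The sum runs over one period; the index is shifted because a defect at [i] starts a bar on the
   cell [i.+1]. *)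
pose mu (N : function_sheaf R k D) := (\sum_(i < n.*2) dimension (cell_value a N i.+1))%N.
have [m] := ubnP (mu M); elim: m M => // m IH M Mm MP.
have [[i di]|nd] := pselect (exists i, left_defect a M i); last first.
  exists void, (fun=> set0), (sheaf_of M); split=> [[]||].
    by apply: (locally_constant_of_nodefect aP MP) => i di; apply: nd; exists i.
  pose h U (s : sheaf_of M U) : dsum2 (sheaf_of M)
    (dsum (fun x : void => interval_sheaf k (@set0 R))) U := (s, fun x : void => match x with end).
  have lin U : linear (h U).
    by move=> c s t; congr pair; apply: dprodP => -[].
  have nat_ (U V : opens (circle R)) (VU : V `<=` U) s :
      mklin (lin V) (res VU s) = res VU (mklin (lin U) s).
    by congr pair; apply: dprodP => -[].
  apply: (@bijective_hom_iso _ _ _ _ (SheafHom nat_)) => U => [s /(congr1 fst)//|[s t]].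
  by exists s; congr pair; apply: dprodP => -[].
have {i di} [i i2n di] := left_defect_mod aP di.
have [I [u [l [bar lc Icell]]]] := bar_of_defect aP MP di.
pose K := ker_sheaf M l.
have KP : cell_constant a K := ker_cell_constant MP lc.
have Kle j : (dimension (cell_value a K j) <= dimension (cell_value a M j))%N.
  apply: dimension_le; [exact: (cell_value_subspace aP KP)|exact: (cell_value_subspace aP MP)|].
  by move=> v; exact: ker_value_sub.
have Klt : (mu K < mu M)%N.
  rewrite /mu (bigD1 (Ordinal i2n))//= [X in (_ < X)%N](bigD1 (Ordinal i2n))//=.
  rewrite -addSn leq_add//; last by apply: leq_sum => j _; exact: Kle.
  have [t ct] := cell_nonempty aP i.+1.
  have [v [Mv NKv]] := ker_value_proper bar lc ct (Icell t ct).
  apply: (@dimension_lt _ _ _ _ v) => //.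
  - exact: (cell_value_subspace aP KP).
  - exact: (cell_value_subspace aP MP).
  - by move=> w; exact: ker_value_sub.
have [||A [J [L [JP LP LK]]]] := IH K; [|exact: KP|].
  by rewrite -ltnS; exact: leq_trans Mm.
exists (option A), (fun o => if o is Some x then J x else I), L; split=> //.
  case=> [x|]; first exact: JP.
  split; [exact: (bar_nonempty bar)|exact: (bar_interval bar)|].
  have [B BP] := bar_bounded bar; exists B; split; first exact: num_real.
  by move=> C BC t It; exact: le_trans (BP t It) (ltW BC).
apply: (@sheaf_iso_option _ _ _ (sheaf_of K)); last exact: LK.
exact: sheaf_split bar.
Qed.

End Induction.

(** * Constructible sheaves as function sheaves *)

Section Coordinates.
Context (R : realType) (k : fieldType) (F : sheaf k (circle R)) (D : nat).
Context (kap : forall x, stalk F x -> 'rV[k]_D).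
Hypothesis kap_lin : forall x, linear (@kap x).
Hypothesis kap_inj : forall x, injective (@kap x).

(** The coordinates may jump between points: admissible functions are by definition the coordinates
    of sections of F, and injectivity of each [kap x] gives [adm_eq0]. *)
Definition adm_coord t h := exists (W : opens (circle R)) (s : F W), W (circle_map t) /\
  \forall r \near t, forall Wr : W (circle_map r), h r = kap (germ Wr s).

Lemma kap_germ x y (W : opens (circle R)) (Wx : W x) (Wy : W y) (s : F W) :
  x = y -> kap (germ Wx s) = kap (germ Wy s).
Proof. by move=> xy; subst y; rewrite (germ_irr Wx Wy). Qed.

Lemma kap0 x : kap (0 : stalk F x) = 0.
Proof. by have := kap_lin (-1) (0 : stalk F x) 0; rewrite scaler0 addr0 scaleN1r addNr. Qed.

Definition coord_sheaf : function_sheaf R k D.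
Proof.
apply: (@FunctionSheaf R k D adm_coord).
- move=> t; exists opensT, 0; split=> //; apply: near_all => r Wr.
  by rewrite germ0 kap0.
- move=> t c f g [W [s [Wt fs]]] [W' [s' [Wt' gs]]].
  have iW : opensI W W' `<=` W by move=> x [].
  have iW' : opensI W W' `<=` W' by move=> x [].
  exists (opensI W W'), (c *: res iW s + res iW' s'); split=> //.
  apply: filterS2 fs gs => r fs gs WWr; rewrite (fs WWr.1) (gs WWr.2).
  by rewrite germ_linear kap_lin (germ_res iW WWr.1) (germ_res iW' WWr.2).
- move=> t f g [W [s [Wt fs]]] fg; exists W, s; split=> //.
  by apply: filterS2 fs fg => r fs <- Wr; exact: fs.
- move=> t f [W [s [Wt fs]]].
  have fs' : \forall q \near t, \forall r \near q,
    forall Wr : W (circle_map r), f r = kap (germ Wr s) by exact: nbhs_interior fs.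
  by apply: filterS2 fs' (near_opens Wt) => q qs Wq; exists W, s.
- move=> t f [W [s [Wt fs]]] ft.
  have : germ Wt s = 0 by apply: kap_inj; rewrite kap0 -(nbhs_singleton fs Wt).
  move=> /germ_eq0/near_circle_map g0.
  apply: filterS3 fs g0 (near_opens Wt) => r fr gr Wr.
  by rewrite (fr Wr) gr kap0.
- move=> t m f [W [s [Wt /near_translate fs]]]; exists W, s; split.
    by rewrite -(circle_mapD t m).
  apply: filterS fs => r fr Wr.
  have Wr' : W (circle_map (r + turn m)) by rewrite circle_mapD.
  by rewrite (fr Wr'); apply: kap_germ; rewrite circle_mapD.
Defined.

Lemma coord_sheaf_iso : sheaf_iso F (sheaf_of coord_sheaf).
Proof.
pose f (U : opens (circle R)) (s : F U) :
  family_sheaf (fun _ : circle R => 'rV[k]_D : lmodType k) U := fun x Ux => kap (germ Ux s).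
have f_adm (U : opens (circle R)) s : admissible coord_sheaf (f U s).
  move=> t Ut; exists U, s; split=> //; apply: near_all => r Ur.
  by rewrite (total_funE _ Ur).
pose h U s : sheaf_of coord_sheaf U :=
  Subsec (asboolT (f_adm U s) : f U s \in subsec_pred (admissible_property coord_sheaf) U).
have hE (U : opens (circle R)) s x (Ux : U x) : sec_fun (h U s) x = kap (germ Ux s).
  by rewrite /sec_fun (total_funE _ Ux).
have lin U : linear (h U).
  move=> c s t; apply: sec_fun_inj => x Ux; rewrite sec_fun_linear !(hE _ _ _ Ux).
  by rewrite germ_linear kap_lin.
have nat_ (U V : opens (circle R)) (VU : V `<=` U) s :
    mklin (lin V) (res VU s) = res VU (mklin (lin U) s).
  apply: sec_fun_inj => x Vx; rewrite sec_fun_res// (hE _ _ _ Vx) (hE _ _ _ (VU _ Vx)).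
  by rewrite (germ_res VU (VU x Vx)).
apply: (@bijective_hom_iso _ _ _ _ (SheafHom nat_)) => U => [s E|g].
  apply: germ_inj => x Ux; apply: kap_inj.
  by rewrite germ0 kap0 -(hE U s x Ux) -(sec_fun0 coord_sheaf U x) -[in RHS]E.
have loc x (Ux : U x) : exists (W : opens (circle R)) (s : F W), W x /\
    \forall y \near x, forall Wy : W y, U y -> sec_fun g y = kap (germ Wy s).
  have [t xE] := circle_map_surj x; subst x.
  have [W [s [Wt near]]] := sec_fun_adm g Ux; exists W, s; split=> //.
  by apply/near_circle_map; apply: filterS near => r E Wr _.
have ex x (Ux : U x) : exists h : stalk F x, kap h = sec_fun g x.
  have [W [s [Wx near]]] := loc x Ux; exists (germ Wx s).
  by rewrite (nbhs_singleton near Wx Ux).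
pose gm x Ux := projT1 (cid (ex x Ux)).
have gmE x Ux : kap (gm x Ux) = sec_fun g x := projT2 (cid (ex x Ux)).
have [s sE] : exists s : F U, forall x (Ux : U x), germ Ux s = gm x Ux.
  apply: glue_germs => x Ux; have [W [s [Wx near]]] := loc x Ux.
  exists W, s; split=> //; apply: filterS near => y E Wy Uy.
  by apply: kap_inj; rewrite gmE (E Wy Uy).
by exists s; apply: sec_fun_inj => x Ux; rewrite /= (hE _ _ _ Ux) sE gmE.
Qed.

End Coordinates.

(** * The grid over a finite subset of the circle *)

Section Grid.
Context (R : realType).

Lemma circle_map_surj_period (x : circle R) : exists2 t, 0 <= t < 2 * pi & circle_map t = x.
Proof.
have [r <-] := circle_map_surj x; have p0 := turn1_gt0 R.
exists (r + turn (- Num.floor (r / (2 * pi)))); last exact: circle_mapD.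
have := floor_itv (r / (2 * pi)).
rewrite turnN ler_pdivlMr// ltr_pdivrMr// turnD mulr1z; lra.
Qed.

Lemma grid_exists (P : set (circle R)) : finite_set P ->
  exists n a, grid n a /\ forall j t, a j < t < a j.+1 -> ~ P (circle_map t).
Proof.
move=> /finite_seqP[p pE].
pose lift x : R := s2val (cid2 (circle_map_surj_period x)).
have lift_itv x : 0 <= lift x < 2 * pi by rewrite /lift; case: cid2.
have liftK x : circle_map (lift x) = x by rewrite /lift; case: cid2.
(* Adding 0 keeps the grid nonempty, even if no stratum is a point, and makes 0 the first point of
   the period. *)
pose q := sort <=%R (undup (0 :: [seq lift x | x <- p])).
have q_sorted : sorted <%R q by rewrite lt_sorted_uniq_le sort_uniq undup_uniq sort_le_sorted.
have q_mem t : (t \in q) = (t == 0) || (t \in [seq lift x | x <- p]).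
  by rewrite mem_sort mem_undup in_cons.
have q_itv t : t \in q -> 0 <= t < 2 * pi.
  by rewrite q_mem => /orP[/eqP ->|/mapP[x _ ->]//]; rewrite lexx turn1_gt0.
pose n := size q.
have n0 : (0 < n)%N.
  by rewrite /n; case: q q_mem {q_sorted q_itv n} => // /(_ 0); rewrite eqxx.
have q_lt i j : (i < j < n)%N -> q`_i < q`_j.
  move=> /andP[ij jn]; rewrite (lt_sorted_ltn_nth 0)//; first by rewrite inE (ltn_trans ij).
have q0 : q`_0 = 0.
  have [i iq qi] : exists2 i, (i < n)%N & q`_i = 0.
    by apply/nthP; rewrite q_mem eqxx.
  case: i iq qi => // i iq qi; have : q`_0 < q`_i.+1 by apply: q_lt.
  have /q_itv : q`_0 \in q by exact: mem_nth.
  by rewrite qi => /andP[h _] /(le_lt_trans h); rewrite ltxx.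
pose a j : R := q`_(j %% n) + turn (j %/ n)%N%:Z.
have aD j m : a (j + m * n)%N = a j + turn m%:Z.
  by rewrite /a addnC modnMDl divnMDl// PoszD turnD addrA addrAC.
have a_small i : (i < n)%N -> a i = q`_i.
  by move=> h; rewrite /a modn_small// divn_small// turn0 addr0.
have aP : grid n a.
  split=> //; last by move=> j; have := aD j 1%N; rewrite mul1n mulr1z mul1r.
  move=> j; rewrite (divn_eq j n) addnC -addSn !aD ltrD2r.
  have := ltn_pmod j n0; set r := (j %% n)%N => rn.
  rewrite a_small//; move: (rn); rewrite leq_eqVlt => /orP[/eqP rE|rn'].
    rewrite rE -[n in a n]add0n -[n in a (0 + n)%N]mul1n aD a_small// q0 add0r mulr1z mul1r.
    by have /q_itv/andP[] : q`_r \in q by exact: mem_nth.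
  by rewrite a_small// q_lt// ltnSn.
exists n, a; split=> // j t /andP[jt tj] Pt.
pose w := lift (circle_map t).
have wq : w \in q.
  by rewrite q_mem; apply/orP; right; apply: map_f; move: Pt; rewrite pE.
have [i iq wE] : exists2 i, (i < n)%N & q`_i = w by exact/nthP.
have /circle_map_eqP[m tE] : circle_map t = circle_map w by rewrite liftK.
have t0 : 0 < t.
  apply: le_lt_trans jt; rewrite -q0 -a_small//; exact: (grid_homo_le aP).
have /andP[w0 w2] := q_itv w wq.
have m0 : 0 <= m.
  rewrite leNgt; apply/negP => m0.
  have : t < 0; last by rewrite ltNge ltW.
  by have := ltr_leD w2 (turn_le R m0); rewrite -tE subrr.
have tE' : t = a (i + `|m|%N * n)%N.
  by rewrite aD a_small// wE tE gez0_abs.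
have [h|h] := leqP (i + `|m|%N * n) j.
  by have := grid_homo_le aP h; rewrite -tE' leNgt jt.
by have := grid_homo_le aP h; rewrite -tE' leNgt tj.
Qed.

End Grid.

(** Strata may have different ranks, so k^n is embedded in k^D. Surjectivity is then lost; what
    survives is that all points of S have the same image in k^D. *)
Lemma padded_coordinates (k : fieldType) (X : topologicalType) (F : sheaf k X) (S : set X) :
  constant_of_finite_rank (sheaf_restrict S F) ->
  exists n, forall D, (n <= D)%N -> exists kap : forall x, stalk F x -> 'rV[k]_D,
  [/\ forall x, S x -> linear (kap x),
      forall x, S x -> injective (kap x),
      forall x y, S x -> S y -> forall g, exists h, kap y h = kap x g
    & forall (U : opens X) (s : F U) x (Ux : U x), S x ->
        \forall y \near x, S y -> forall Uy : U y, kap y (germ Uy s) = kap x (germ Ux s)].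
Proof.
move=> /constant_coordinates[n [kap [lin inj surj flat]]]; exists n => D nD.
have free : row_free (pid_mx n : 'M[k]_(n, D)) by rewrite /row_free rank_pid_mx.
exists (fun x g => kap x g *m pid_mx n); split.
- by move=> x Sx c g h; rewrite lin// mulmxDl scalemxAl.
- by move=> x Sx g h /(row_free_inj free)/(inj _ Sx).
- by move=> x y Sx Sy g; have [h hE] := surj _ Sy (kap x g); exists h; rewrite hE.
- move=> U s x Ux Sx; apply: filterS (flat U s x Ux Sx) => y E Sy Uy.
  by rewrite E.
Qed.

(** * Strata of the circle *)

Section Stratification.
Context (R : realType) (T : set (set (circle R))) (TP : analytic_stratification T).

Lemma circle_map_near_neq (s t : R) : circle_map s <> circle_map t ->
  \forall r \near s, circle_map r <> circle_map t.
Proof.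
move=> st.
have s1 : s - 1 < s by lra.
have s2 : s < s + 1 by lra.
have n1 : \forall r \near s, `|r - s| < 1.
  by apply: filterS2 (near_gt s1) (near_lt s2) => r r1 r2; rewrite ltr_norml; lra.
have [[r0 r0s r0t]|N] := pselect (exists2 r, `|r - s| < 1 & circle_map r = circle_map t).
  have n2 : \forall r \near s, r <> r0.
    have : s != r0 by apply/eqP => E; apply: st; rewrite E.
    rewrite neq_lt => /orP[/near_lt|/near_gt]; apply: filterS => r rr E.
      by move: rr; rewrite E ltxx.
    by move: rr; rewrite E ltxx.
  apply: filterS2 n1 n2 => r rs rr0 rt; apply: rr0.
  by apply: (circle_map_inj_near rs r0s); rewrite rt.
by apply: filterS n1 => r rs rt; apply: N; exists r.
Qed.

Lemma closed_circle_point (x : circle R) : closed [set x].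
Proof.
rewrite -[X in closed X]setCK; apply: open_closedC.
rewrite openE => y yx; rewrite /interior.
have [s sE] := circle_map_surj y; have [t tE] := circle_map_surj x; subst x y.
by apply/near_circle_map; apply: circle_map_near_neq => E; apply: yx.
Qed.

(** Where S is not a neighbourhood of its point x, the submanifold condition isolates x in S; then
    {x} is open and closed in the connected set S. *)
Lemma stratum_open_or_point S : T S -> open S \/ exists x, S = [set x].
Proof.
move=> TS; have [oS|NoS] := pselect (open S); [by left|right].
have [x [Sx Nx]] : exists x, S x /\ ~ nbhs x S.
  apply: contrapT => N; apply: NoS; rewrite openE => x Sx.
  by rewrite /interior; apply: contrapT => Nx; apply: N; exists x.
exists x; apply/esym.
have [t tx [near|near]] := stratum_submanifold TP TS Sx.
  by exfalso; apply: Nx; rewrite -tx; exact/near_circle_map.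
have near1 : \forall y \near x, S y -> y = x.
  rewrite -tx; apply/near_circle_map; apply: filterS near => s sP Ss.
  by have /sP -> := Ss.
apply: (stratum_connected TP TS); first by exists x.
  exists (interior [set y | S y -> y = x]); first exact: open_interior.
  apply/seteqP; split=> [_ ->|y [Sy /interior_subset/(_ Sy)]//].
  by split.
exists [set x]; first exact: closed_circle_point.
by apply/seteqP; split=> [_ ->|y []].
Qed.

Lemma strata_finite : finite_set T.
Proof.
have [tcov _ tne] := stratification_partition TP.
pose V (t : R) := s2val (cid2 (stratification_locally_finite TP (circle_map t))).
have VP t : nbhs (circle_map t) (V t) := s2valP (cid2 (stratification_locally_finite TP (circle_map t))).
have Vfin t : finite_set [set S | T S /\ S `&` V t !=set0] :=
  s2valP' (cid2 (stratification_locally_finite TP (circle_map t))).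
pose f t : set R := interior [set s | V t (circle_map s)].
have := @segment_compact R 0 (2 * pi); rewrite compact_cover.
move=> /(_ R setT f)[].
- by move=> t _; exact: open_interior.
- move=> t _; exists t => //.
  by apply/near_circle_map; exact: VP.
move=> E _ cov.
(* Strata are nonempty, so each one meets one of the finitely many neighbourhoods of the cover. *)
have sub : T `<=` \bigcup_(t in [set` E]) [set S | T S /\ S `&` V t !=set0].
  move=> S TS; have [x Sx] := tne S TS.
  have [t /andP[t0 t2] tx] := circle_map_surj_period x; subst x.
  have [|r rE frt] := cov t; first by rewrite /= in_itv /= t0 ltW.
  exists r => //; split=> //; exists (circle_map t); split=> //.
  exact: (interior_subset frt).
by apply: (sub_finite_set sub); apply: bigcup_finite => // t _; exact: Vfin.
Qed.

Definition stratum (x : circle R) : set (circle R) := xget set0 [set S | T S /\ S x].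

Lemma stratumP x : T (stratum x) /\ stratum x x.
Proof.
have [tcov _ _] := stratification_partition TP.
have : [set: circle R] x by [].
rewrite -tcov => -[S TS Sx].
by rewrite /stratum; case: xgetP => [S' _ //|/(_ S)[]].
Qed.

Lemma stratum_eq S x : T S -> S x -> stratum x = S.
Proof.
move=> TS Sx; have [_ triv _] := stratification_partition TP.
by have [TS' Sx'] := stratumP x; apply: triv => //; exists x.
Qed.

Lemma nonopen_finite : finite_set [set x | ~ open (stratum x)].
Proof.
pose h (S : set (circle R)) : circle R := xget (circle_map 0) S.
have sub : [set x | ~ open (stratum x)] `<=` h @` T; last first.
  exact: (sub_finite_set sub (finite_image h strata_finite)).
move=> x /= Nx; have [TS Sx] := stratumP x.
have [//|[y SE]] := stratum_open_or_point TS.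
exists (stratum x) => //; move: Sx; rewrite SE /h => ->.
by case: xgetP => [z _ ->//|/(_ y)]; case.
Qed.

End Stratification.

(** * From constructible sheaves to function sheaves *)

Section Decomposition.
Context (R : realType) (k : fieldType) (F : sheaf k (circle R)).

Lemma constructible_function_sheaf : constructible F ->
  exists D n a (M : function_sheaf R k D),
    [/\ grid n a, cell_constant a M & sheaf_iso F (sheaf_of M)].
Proof.
move=> [T TP Fcst].
have ex S : exists n, T S -> forall D, (n <= D)%N ->
    exists kap : forall x, stalk F x -> 'rV[k]_D,
    [/\ forall x, S x -> linear (kap x),
      forall x, S x -> injective (kap x),
      forall x y, S x -> S y -> forall g, exists h, kap y h = kap x g
    & forall (U : opens (circle R)) (s : F U) x (Ux : U x), S x ->
        \forall y \near x, S y -> forall Uy : U y, kap y (germ Uy s) = kap x (germ Ux s)].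
  have [TS|N] := pselect (T S); last by exists 0%N.
  by have [n nP] := padded_coordinates (Fcst S TS); exists n.
pose rk S := projT1 (cid (ex S)).
have /finite_seqP[l lE] := strata_finite TP.
pose D := (\max_(S <- l) rk S)%N.
have rkD S : T S -> (rk S <= D)%N.
  by move=> TS; apply: leq_bigmax_seq => //; move: TS; rewrite lE.
have ex2 S : exists kap : forall x, stalk F x -> 'rV[k]_D, T S ->
    [/\ forall x, S x -> linear (kap x),
      forall x, S x -> injective (kap x),
      forall x y, S x -> S y -> forall g, exists h, kap y h = kap x g
    & forall (U : opens (circle R)) (s : F U) x (Ux : U x), S x ->
        \forall y \near x, S y -> forall Uy : U y, kap y (germ Uy s) = kap x (germ Ux s)].
  have [TS|N] := pselect (T S); last by exists (fun _ _ => 0).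
  have [kap kapP] := projT2 (cid (ex S)) TS D (rkD S TS).
  by exists kap.
pose kapS S := projT1 (cid (ex2 S)).
have kapSP S (TS : T S) := projT2 (cid (ex2 S)) TS.
pose kap x (g : stalk F x) := kapS (stratum T x) x g.
have kap_lin x : linear (@kap x).
  by have [TS Sx] := stratumP TP x; have [lin _ _ _] := kapSP _ TS; exact: lin.
have kap_inj x : injective (@kap x).
  by have [TS Sx] := stratumP TP x; have [_ inj _ _] := kapSP _ TS; exact: inj.
(* All point strata become grid points. On an interval cell the stratum through a point is thus
   open, hence locally constant, hence the same all along the cell. *)
have [n [a [aP aN]]] := grid_exists (nonopen_finite TP).
have cell_open i t : odd i -> cell a i t -> open (stratum T (circle_map t)).
  rewrite /cell => -> /aN; exact: contrapT.
have near_stratum i t : odd i -> cell a i t ->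
    \forall s \near t, stratum T (circle_map s) = stratum T (circle_map t).
  move=> oi ct; have [TS St] := stratumP TP (circle_map t).
  have : \forall x \near circle_map t, stratum T (circle_map t) x.
    by apply: open_nbhs_nbhs; split=> //; exact: cell_open ct.
  by move=> /near_circle_map; apply: filterS => s Ss; exact: stratum_eq.
have kap_flat i t (W : opens (circle R)) (s : F W) (Wt : W (circle_map t)) : odd i -> cell a i t ->
    \forall r \near t, forall Wr : W (circle_map r), kap _ (germ Wr s) = kap _ (germ Wt s).
  move=> oi ct; have [TS St] := stratumP TP (circle_map t); have [_ _ _ flat] := kapSP _ TS.
  have /near_circle_map := flat W s _ Wt St.
  apply: filterS2 (near_stratum i t oi ct) => r rt fr Wr.
  by rewrite /kap rt; apply: fr; rewrite -rt; have [] := stratumP TP (circle_map r).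
exists D, n, a, (coord_sheaf kap_lin kap_inj); split=> //; last exact: coord_sheaf_iso.
split=> [i t f oi ct [W [s [Wt fs]]]|i t t' v oi ct ct' [W [s [Wt vs]]]].
  have f0 := nbhs_singleton fs Wt.
  apply: filterS3 fs (kap_flat i t W s Wt oi ct) (near_opens Wt) => r fr kr Wr.
  by rewrite (fr Wr) (kr Wr) f0.
have SE : stratum T (circle_map t) = stratum T (circle_map t').
  move: (ct) (ct'); rewrite /cell oi => h h'.
  apply: (@locally_constant_interval _ _ (fun s => stratum T (circle_map s)) _ _ _ t t' h h').
  by move=> q qi; apply: (near_stratum i) => //; rewrite /cell oi.
have [TS St] := stratumP TP (circle_map t); have [_ _ tr _] := kapSP _ TS.
have St' : stratum T (circle_map t) (circle_map t').
  by rewrite SE; have [] := stratumP TP (circle_map t').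
(* The common image of the coordinates along a stratum provides a germ at t' with the value v. *)
have [h hE] := tr _ _ St St' (germ Wt s).
have [W' [Wt' [s' h']]] := stalkP h; subst h.
have vE : v = kap _ (germ Wt' s').
  by rewrite (nbhs_singleton vs Wt) /kap -SE.
exists W', s'; split=> //; apply: filterS (kap_flat i t' W' s' Wt' oi ct') => r kr Wr.
by rewrite kr.
Qed.

End Decomposition.

Theorem proposition8p4 (R : realType) (k : fieldType)
    (F : sheaf k (circle R)) (F_constructible : constructible F) :
  exists (A : finType) (I : A -> set R) (n : A -> nat) (L : sheaf k (circle R)),
    [/\ forall a, [/\ I a !=set0, is_interval (I a) & bounded_set (I a)],
        locally_constant_of_finite_rank L
      & sheaf_iso F
          (dsum2 L
             (dsum (fun a => direct_image circle_map
                               (sheaf_power (constant_on k (I a)) (n a)))))].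
Proof.
have [D [n [a [M [aP MP FM]]]]] := constructible_function_sheaf F_constructible.
have [A [I [L [IP LP ML]]]] := function_sheaf_decomposition aP MP.
(* Bars are split off one at a time; a multiplicity appears as several indices with the same
   interval. *)
exists A, I, (fun=> 1%N), L; split=> //.
exact: sheaf_iso_trans FM ML.
Qed.
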